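(* Let $p$ and $q$ be in $[1,\infty)$. Then $F^p(\mathbb{Z})$ is isometrically isomorphic to $F^q(\mathbb{Z})$ (as Banach algebras) if and only if either $p=q$ or $\frac{1}{p}+\frac{1}{q}=1$.
   Context: All Banach spaces are complex. For $p\in[1,\infty)$ and a countable discrete group $G$, $F^p(G)$ denotes the Banach algebra obtained as the completion of $\ell^1(G)$ (with convolution) in the norm $\|f\|=\sup\|\rho(f)\|$, where the supremum is over all contractive representations (contractive algebra homomorphisms) $\rho\colon\ell^1(G)\to\mathcal{B}(E)$ on separable $L^p$-spaces $E$, i.e. separable Banach spaces isometrically isomorphic to $L^p(X,\mu)$ for some $\sigma$-finite measure space $(X,\mu)$. Here $\mathcal{B}(E)$ is the Banach algebra of bounded linear operators on $E$. Since $\mathbb{Z}$ is amenable, $F^p(\mathbb{Z})$ coincides canonically and isometrically with the algebra of $p$-pseudofunctions $F^p_\lambda(\mathbb{Z})$, which is the completion of $\ell^1(\mathbb{Z})$ in the norm $\|f\|=\|\lambda_p(f)\|_{\mathcal{B}(\ell^p(\mathbb{Z}))}$, where $\lambda_p(f)\xi=f*\xi$ is the left regular representation. Two Banach algebras are isometrically isomorphic if there is a bijective, linear, multiplicative, norm-preserving map between them. *)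

(* Defs.v *)
From HB Require Import structures.
From mathcomp Require Import all_boot all_order all_algebra.
From mathcomp Require Import complex.
From mathcomp Require Import all_classical all_reals all_analysis.
From mathcomp Require Import ring lra.

Set Implicit Arguments.
Unset Strict Implicit.
Unset Printing Implicit Defensive.

Import Order.TTheory GRing.Theory Num.Theory numFieldNormedType.Exports ComplexField.Normc.

Local Open Scope classical_set_scope.
Local Open Scope ring_scope.
Local Open Scope complex_scope.

Section AbsoluteSums.
Context {R : realType}.
Implicit Types T S : choiceType.

Definition rsummable T (u : T -> R) := summable [set: T] (EFin \o u).

(* Unconditional sums: sum of the positive part minus sum of the negative part;
   only meaningful on absolutely summable families, as for [csum] below. *)
Definition rsum T (u : T -> R) : R :=
  fine (\esum_(x in [set: T]) (EFin \o u)^\+ x)%E -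
  fine (\esum_(x in [set: T]) (EFin \o u)^\- x)%E.

Definition csummable T (u : T -> R[i]) := rsummable (fun x => normc (u x)).

Definition csum T (u : T -> R[i]) : R[i] :=
  rsum (fun x => complex.Re (u x)) +i* rsum (fun x => complex.Im (u x)).

Lemma le_rsummable T (u v : T -> R) : (forall x, `|u x| <= `|v x|) ->
  rsummable v -> rsummable u.
Proof.
move=> uv; apply: le_lt_trans; apply: le_esum => x _ /=.
by rewrite lee_fin.
Qed.

Lemma rsummableD T (u v : T -> R) : rsummable u -> rsummable v ->
  rsummable (fun x => u x + v x).
Proof. exact: summableD. Qed.

Lemma rsummableN T (u : T -> R) : rsummable u -> rsummable (fun x => - u x).
Proof. by apply: le_rsummable => x; rewrite normrN. Qed.

Lemma esumZ T (c : R) (a : T -> \bar R) : 0 <= c -> (forall x, 0 <= a x)%E ->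
  (\esum_(x in [set: T]) (c%:E * a x) = c%:E * \esum_(x in [set: T]) a x)%E.
Proof.
suff le (d : R) (b : T -> \bar R) : 0 <= d -> (forall x, 0 <= b x)%E ->
    (\esum_(x in [set: T]) (d%:E * b x) <= d%:E * \esum_(x in [set: T]) b x)%E.
  move=> c0 a0; apply/eqP; rewrite eq_le le//=.
  have [->|cn0] := eqVneq c 0.
    by rewrite mul0e; apply: esum_ge0 => x _; rewrite mul0e.
  have cp : 0 < c by rewrite lt_def cn0.
  rewrite -lee_pdivlMl//.
  have ci0 : 0 <= c^-1 by rewrite invr_ge0.
  apply: le_trans (le _ (fun x => c%:E * a x)%E ci0 _); last first.
    by move=> x; rewrite mule_ge0// lee_fin.
  apply: le_esum => x _; rewrite muleA -EFinM mulVf// mul1e//.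
move=> d0 b0; apply: ge_ereal_sup => _ [A [finA _] <-].
rewrite -ge0_mule_fsumr//.
by apply: lee_wpmul2l; rewrite ?lee_fin//; apply: ereal_sup_ubound; exists A.
Qed.

Lemma rsummableZ T (c : R) (u : T -> R) : rsummable u ->
  rsummable (fun x => c * u x).
Proof.
move=> su; rewrite /rsummable /summable.
rewrite (@eq_esum _ _ _ _ (fun x => `|c|%:E * `|(EFin \o u) x|)%E); last first.
  by move=> x _ /=; rewrite normrM EFinM.
by rewrite esumZ// -ge0_fin_numE ?esum_ge0// ?fin_numM//
   ?mule_ge0 ?esum_ge0// -?summableE.
Qed.

Lemma ge0_rsummable_fin T (a : T -> R) : (forall x, 0 <= a x) -> rsummable a ->
  (\esum_(x in [set: T]) (a x)%:E)%E \is a fin_num.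
Proof.
move=> a0; rewrite /rsummable summableE; congr (_ \is a fin_num).
by apply: eq_esum => x _ /=; rewrite ger0_norm.
Qed.

Lemma rsumE T (a b : T -> R) : (forall x, 0 <= a x) -> (forall x, 0 <= b x) ->
  rsummable a -> rsummable b ->
  rsum (fun x => a x - b x) = fine (\esum_(x in [set: T]) (a x)%:E)%E -
                              fine (\esum_(x in [set: T]) (b x)%:E)%E.
Proof.
move=> a0 b0 sa sb.
have sab : summable [set: T] (EFin \o (fun x => a x - b x)).
  by apply: rsummableD => //; exact: rsummableN.
rewrite /rsum -!fineB ?ge0_rsummable_fin//.
- congr fine.
  rewrite -(@esumB _ _ setT (EFin \o a) (EFin \o b))// => x _ /=; rewrite lee_fin//.
- have := summable_funepos sab; rewrite summableE; congr (_ \is a fin_num).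
  by apply: eq_esum => x _; rewrite gee0_abs ?funepos_ge0.
- have := summable_funeneg sab; rewrite summableE; congr (_ \is a fin_num).
  by apply: eq_esum => x _; rewrite gee0_abs ?funeneg_ge0.
Qed.

Definition rpos (x : R) := Num.max x 0.
Definition rneg (x : R) := Num.max (- x) 0.
Lemma rpos_ge0 x : 0 <= rpos x. Proof. by rewrite /rpos le_max lexx orbT. Qed.
Lemma rneg_ge0 x : 0 <= rneg x. Proof. by rewrite /rneg le_max lexx orbT. Qed.
Lemma rposneg x : x = rpos x - rneg x.
Proof.
rewrite /rpos /rneg; have [x0|x0] := lerP 0 x.
  by rewrite (max_r (_ : - x <= 0)) ?subr0// oppr_le0.
by rewrite (max_l (_ : 0 <= - x)) ?oppr_ge0 ?ltW// sub0r opprK.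
Qed.
Lemma rposD x : rpos x <= `|x|.
Proof. by rewrite /rpos ge_max ler_norm normr_ge0. Qed.
Lemma rnegD x : rneg x <= `|x|.
Proof. by rewrite /rneg ge_max -normrN ler_norm normr_ge0. Qed.

Lemma rsummable_pos T (u : T -> R) : rsummable u -> rsummable (rpos \o u).
Proof.
by apply: le_rsummable => x /=; rewrite ger0_norm ?rpos_ge0// rposD.
Qed.

Lemma rsummable_neg T (u : T -> R) : rsummable u -> rsummable (rneg \o u).
Proof.
by apply: le_rsummable => x /=; rewrite ger0_norm ?rneg_ge0// rnegD.
Qed.

Lemma eq_rsum T (u v : T -> R) : u =1 v -> rsum u = rsum v.
Proof. by move=> /funext ->. Qed.

Lemma rsumpn T (u : T -> R) : rsummable u ->
  rsum u = fine (\esum_(x in [set: T]) (rpos (u x))%:E)%E -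
           fine (\esum_(x in [set: T]) (rneg (u x))%:E)%E.
Proof.
move=> su; rewrite (@eq_rsum _ u (fun x => rpos (u x) - rneg (u x))).
  by rewrite rsumE// => [x|x||]; rewrite ?rpos_ge0 ?rneg_ge0//;
    [exact: rsummable_pos|exact: rsummable_neg].
by move=> x; rewrite -rposneg.
Qed.

Lemma ge0_esumD T (a b : T -> R) : (forall x, 0 <= a x) -> (forall x, 0 <= b x) ->
  rsummable a -> rsummable b ->
  fine (\esum_(x in [set: T]) (a x + b x)%:E)%E =
  fine (\esum_(x in [set: T]) (a x)%:E)%E +
  fine (\esum_(x in [set: T]) (b x)%:E)%E.
Proof.
move=> a0 b0 sa sb; rewrite -fineD ?ge0_rsummable_fin//; congr fine.
by rewrite -esumD// => x _; rewrite lee_fin.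
Qed.

Lemma rsumD T (u v : T -> R) : rsummable u -> rsummable v ->
  rsum (fun x => u x + v x) = rsum u + rsum v.
Proof.
move=> su sv.
have spu := rsummable_pos su; have snu := rsummable_neg su.
have spv := rsummable_pos sv; have snv := rsummable_neg sv.
rewrite (@eq_rsum _ _ (fun x => (rpos (u x) + rpos (v x)) -
                                (rneg (u x) + rneg (v x)))); last first.
  by move=> x; rewrite {1}(rposneg (u x)) {1}(rposneg (v x)); lra.
rewrite rsumE ?ge0_esumD// ?rsumpn//; first lra;
  by move=> *; rewrite ?rpos_ge0 ?rneg_ge0 ?addr_ge0 ?rpos_ge0 ?rneg_ge0//;
  exact: rsummableD.
Qed.

Lemma rsumN T (u : T -> R) : rsummable u -> rsum (fun x => - u x) = - rsum u.
Proof.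
move=> su; rewrite (@eq_rsum _ _ (fun x => rneg (u x) - rpos (u x))); last first.
  by move=> x; rewrite {1}(rposneg (u x)); lra.
rewrite rsumE; last 2 first.
  exact: rsummable_neg.
  exact: rsummable_pos.
  by rewrite rsumpn//; lra.
  by move=> x; exact: rneg_ge0.
  by move=> x; exact: rpos_ge0.
Qed.

Lemma rsumZ T (c : R) (u : T -> R) : rsummable u ->
  rsum (fun x => c * u x) = c * rsum u.
Proof.
move=> su.
wlog c0 : c / 0 <= c.
  move=> h; have [/h//|c0] := lerP 0 c.
  rewrite (@eq_rsum _ _ (fun x => - (- c * u x))); last by move=> x; lra.
  by rewrite rsumN ?h; [lra|lra|exact: rsummableZ].
rewrite (@eq_rsum _ _ (fun x => c * rpos (u x) - c * rneg (u x))); last first.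
  by move=> x; rewrite {1}(rposneg (u x)); lra.
have sp := rsummable_pos su; have sn := rsummable_neg su.
rewrite rsumE; last 2 first.
  exact: rsummableZ sp.
  exact: rsummableZ sn.
  rewrite rsumpn//.
  under eq_esum do rewrite EFinM.
  under [X in _ - fine X]eq_esum do rewrite EFinM.
  rewrite !esumZ//; last 2 first.
    by move=> x; rewrite lee_fin rneg_ge0.
    by move=> x; rewrite lee_fin rpos_ge0.
  rewrite !fineM//; first by rewrite /= mulrBr.
  by apply: ge0_rsummable_fin => // x; exact: rneg_ge0.
  by apply: ge0_rsummable_fin => // x; exact: rpos_ge0.
  by move=> x; rewrite mulr_ge0 ?rpos_ge0.
  by move=> x; rewrite mulr_ge0 ?rneg_ge0.
Qed.

Lemma reindex_rsummable T S (e : T -> S) (u : S -> R) : bijective e ->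
  rsummable u -> rsummable (fun x => u (e x)).
Proof.
move=> be; rewrite /rsummable /summable => su.
rewrite -(@reindex_esum _ _ _ setT setT e (fun y => `|(EFin \o u) y|%E))//.
by rewrite setTT_bijective.
Qed.

Lemma reindex_rsum T S (e : T -> S) (u : S -> R) : bijective e ->
  rsum (fun x => u (e x)) = rsum u.
Proof.
move=> be; have be' : set_bij [set: T] [set: S] e by rewrite setTT_bijective.
rewrite /rsum; congr (fine _ - fine _); rewrite [RHS](@reindex_esum _ _ _ setT setT e)//.
  by apply: eq_esum => x _; rewrite !funeposE.
by apply: eq_esum => x _; rewrite !funenegE.
Qed.

Lemma esum_pair T S (a : T -> S -> \bar R) : (forall x y, 0 <= a x y)%E ->
  (\esum_(x in [set: T]) \esum_(y in [set: S]) a x y =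
   \esum_(z in [set: T * S]) a z.1 z.2)%E.
Proof.
move=> a0; rewrite (@esum_esum _ _ _ setT (fun=> setT))//; congr esum.
by apply/seteqP; split.
Qed.

Lemma rsummable_pair T S (a : T * S -> R) :
  rsummable a <->
  ((forall x, rsummable (fun y => a (x, y))) /\
   (\esum_(x in [set: T]) \esum_(y in [set: S]) `|a (x, y)|%:E < +oo)%E).
Proof.
have E : (\esum_(x in [set: T]) \esum_(y in [set: S]) `|a (x, y)|%:E =
   \esum_(z in [set: T * S]) `|(EFin \o a) z|)%E.
  rewrite esum_pair; last by move=> x y; rewrite lee_fin.
  by apply: eq_esum => -[x y] _.
split => [sa|[_]]; last by rewrite E.
rewrite E; split => // x; apply: le_lt_trans sa; rewrite -E.
apply: (@le_trans _ _ (\esum_(x' in [set x]) \esum_(y in [set: S]) `|a (x', y)|%:E)%E).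
  by rewrite esum_set1// esum_ge0// => y _; rewrite lee_fin.
rewrite (@esum_mkcond _ _ [set x]); apply: le_esum => z _.
by case: ifP => // _; apply: esum_ge0 => y _; rewrite lee_fin.
Qed.

Lemma ge0_rsum_pair T S (a : T * S -> R) : (forall z, 0 <= a z) ->
  rsummable a ->
  (forall x, 0 <= fine (\esum_(y in [set: S]) (a (x, y))%:E)%E) /\
  rsummable (fun x => fine (\esum_(y in [set: S]) (a (x, y))%:E)%E) /\
  (\esum_(x in [set: T]) (fine (\esum_(y in [set: S]) (a (x, y))%:E))%:E =
   \esum_(z in [set: T * S]) (a z)%:E)%E.
Proof.
move=> a0 sa; have [sax sax'] := (rsummable_pair a).1 sa.
have fin x : (\esum_(y in [set: S]) (a (x, y))%:E)%E \is a fin_num.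
  by apply: ge0_rsummable_fin.
have p0 x : 0 <= fine (\esum_(y in [set: S]) (a (x, y))%:E)%E.
  by apply: fine_ge0; apply: esum_ge0 => y _; rewrite lee_fin.
have E : (\esum_(x in [set: T]) (fine (\esum_(y in [set: S]) (a (x, y))%:E))%:E =
   \esum_(z in [set: T * S]) (a z)%:E)%E.
  under eq_esum do rewrite fineK//.
  rewrite esum_pair; last by move=> x y; rewrite lee_fin.
  by apply: eq_esum => -[x y] _.
split=> //; split=> //.
rewrite /rsummable /summable.
under eq_esum do rewrite /= ger0_norm//.
by rewrite E -ge0_fin_numE ?ge0_rsummable_fin// esum_ge0// => z _; rewrite lee_fin.
Qed.

Lemma rsum_pair T S (a : T * S -> R) : rsummable a ->
  rsummable (fun x => rsum (fun y => a (x, y))) /\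
  rsum (fun x => rsum (fun y => a (x, y))) = rsum a.
Proof.
move=> sa; have [sax _] := (rsummable_pair a).1 sa.
have [p0 [sp Ep]] := ge0_rsum_pair (fun z => rpos_ge0 (a z)) (rsummable_pos sa).
have [n0 [sn En]] := ge0_rsum_pair (fun z => rneg_ge0 (a z)) (rsummable_neg sa).
have E : (fun x => rsum (fun y => a (x, y))) =
  (fun x => fine (\esum_(y in [set: S]) (rpos (a (x, y)))%:E)%E -
            fine (\esum_(y in [set: S]) (rneg (a (x, y)))%:E)%E).
  by apply/funext => x; rewrite rsumpn//.
rewrite E; split; first by apply: rsummableD => //; exact: rsummableN.
by rewrite rsumE// (rsumpn sa) Ep En.
Qed.

Lemma bij_swap T S : bijective (fun z : T * S => (z.2, z.1)).
Proof. by exists (fun z => (z.2, z.1)); case. Qed.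

Lemma rsum_exchange T S (a : T -> S -> R) :
  rsummable (fun z : T * S => a z.1 z.2) ->
  rsum (fun x => rsum (fun y => a x y)) = rsum (fun y => rsum (fun x => a x y)).
Proof.
move=> sa; have [_ E1] := rsum_pair sa.
have sa' : rsummable (fun z : S * T => a z.2 z.1).
  exact: (reindex_rsummable (bij_swap S T) sa).
have [_ E2] := rsum_pair sa'.
rewrite /= in E1 E2; rewrite E1 E2.
by rewrite -(reindex_rsum (fun z => a z.1 z.2) (bij_swap S T)).
Qed.

End AbsoluteSums.

Section ComplexSums.
Context {R : realType}.
Implicit Types T S : choiceType.

Lemma normc_ge0 (z : R[i]) : 0 <= normc z.
Proof. by case: z => a b; exact: sqrtr_ge0. Qed.

Lemma Re_le_normc (z : R[i]) : `|complex.Re z| <= normc z.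
Proof.
case: z => a b /=; rewrite -sqrtr_sqr ler_sqrt ?lerDl ?addr_ge0 ?sqr_ge0//.
Qed.

Lemma Im_le_normc (z : R[i]) : `|complex.Im z| <= normc z.
Proof.
case: z => a b /=; rewrite -sqrtr_sqr ler_sqrt ?lerDr ?addr_ge0 ?sqr_ge0//.
Qed.

Lemma normc_le_ReIm (z : R[i]) :
  normc z <= `|complex.Re z| + `|complex.Im z|.
Proof.
case: z => a b /=; rewrite -[leRHS]ger0_norm ?addr_ge0// -sqrtr_sqr.
rewrite ler_sqrt ?sqr_ge0// sqrrD !real_normK ?num_real//.
rewrite -addrA lerD2l lerDr mulrn_wge0// mulr_ge0//.
Qed.

Lemma csummableP T (u : T -> R[i]) : csummable u <->
  rsummable (fun x => complex.Re (u x)) /\ rsummable (fun x => complex.Im (u x)).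
Proof.
split=> [su|[sr si]].
  split; apply: le_rsummable su => x; rewrite [leRHS]ger0_norm ?normc_ge0//.
    exact: Re_le_normc.
  exact: Im_le_normc.
apply: (@le_rsummable _ _ _
  (fun x => `|complex.Re (u x)| + `|complex.Im (u x)|)).
  move=> x; rewrite [leLHS]ger0_norm ?normc_ge0// [leRHS]ger0_norm ?addr_ge0//.
  exact: normc_le_ReIm.
by apply: rsummableD; [apply: le_rsummable sr|apply: le_rsummable si] => x;
  rewrite normr_id.
Qed.

Lemma csummableD T (u v : T -> R[i]) : csummable u -> csummable v ->
  csummable (fun x => u x + v x).
Proof.
move=> /csummableP[ur ui] /csummableP[vr vi]; apply/csummableP; split.
  rewrite (_ : (fun _ => _) = (fun x => complex.Re (u x) + complex.Re (v x))).
    exact: rsummableD.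
  by apply/funext => x; case: (u x) (v x) => ? ? [].
rewrite (_ : (fun _ => _) = (fun x => complex.Im (u x) + complex.Im (v x))).
  exact: rsummableD.
by apply/funext => x; case: (u x) (v x) => ? ? [].
Qed.

Lemma csummableZ T (c : R[i]) (u : T -> R[i]) : csummable u ->
  csummable (fun x => c * u x).
Proof.
move=> su; apply: le_rsummable (rsummableZ (normc c) su) => x.
by rewrite normcM.
Qed.

Lemma csumD T (u v : T -> R[i]) : csummable u -> csummable v ->
  csum (fun x => u x + v x) = csum u + csum v.
Proof.
move=> /csummableP[ur ui] /csummableP[vr vi]; rewrite /csum.
rewrite (_ : (fun x => complex.Re _) =
             (fun x => complex.Re (u x) + complex.Re (v x))); last first.
  by apply/funext => x; case: (u x) (v x) => ? ? [].
rewrite (_ : (fun x => complex.Im _) =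
             (fun x => complex.Im (u x) + complex.Im (v x))); last first.
  by apply/funext => x; case: (u x) (v x) => ? ? [].
by rewrite !rsumD.
Qed.

Lemma csumZ T (c : R[i]) (u : T -> R[i]) : csummable u ->
  csum (fun x => c * u x) = c * csum u.
Proof.
move=> /csummableP[ur ui]; case: c => a b; rewrite /csum.
rewrite (_ : (fun x => complex.Re _) =
    (fun x => a * complex.Re (u x) + (- b) * complex.Im (u x))); last first.
  by apply/funext => x; case: (u x) => ? ? /=; rewrite mulNr.
rewrite (_ : (fun x => complex.Im _) =
    (fun x => a * complex.Im (u x) + b * complex.Re (u x))); last first.
  by apply/funext => x; case: (u x) => ? ? /=.
rewrite !rsumD ?rsumZ//; last 4 first.
- exact: rsummableZ.
- exact: rsummableZ.
- exact: rsummableZ.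
- exact: rsummableZ.
by apply/eqP; rewrite eq_complex /= mulNr !eqxx.
Qed.

Lemma eq_csum T (u v : T -> R[i]) : u =1 v -> csum u = csum v.
Proof. by move=> /funext ->. Qed.

Lemma reindex_csummable T S (e : T -> S) (u : S -> R[i]) : bijective e ->
  csummable u -> csummable (fun x => u (e x)).
Proof. exact: reindex_rsummable. Qed.

Lemma reindex_csum T S (e : T -> S) (u : S -> R[i]) : bijective e ->
  csum (fun x => u (e x)) = csum u.
Proof.
move=> be; rewrite /csum (reindex_rsum (fun y => complex.Re (u y)) be).
by rewrite (reindex_rsum (fun y => complex.Im (u y)) be).
Qed.

Lemma csummable_csum T S (a : T * S -> R[i]) : csummable a ->
  csummable (fun x => csum (fun y => a (x, y))).
Proof.
move=> /csummableP[ar ai]; apply/csummableP; split => /=.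
  by have [] := rsum_pair ar.
by have [] := rsum_pair ai.
Qed.

Lemma csum_exchange T S (a : T -> S -> R[i]) :
  csummable (fun z : T * S => a z.1 z.2) ->
  csum (fun x => csum (fun y => a x y)) = csum (fun y => csum (fun x => a x y)).
Proof.
by move=> /csummableP[ar ai]; congr (_ +i* _) => /=;
  [exact: rsum_exchange ar|exact: rsum_exchange ai].
Qed.

Lemma csummable_row T S (a : T * S -> R[i]) x : csummable a ->
  csummable (fun y => a (x, y)).
Proof. by move=> /rsummable_pair[+ _]; exact. Qed.

Lemma csummable_prod T S (u : T -> R[i]) (v : S -> R[i]) :
  csummable u -> csummable v ->
  csummable (fun z : T * S => u z.1 * v z.2).
Proof.
move=> su sv; apply/rsummable_pair; split => [x|/=].
  exact: (csummableZ (u x) sv).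
under eq_esum.
  move=> x _.
  under eq_esum do rewrite normcM normrM EFinM.
  rewrite esumZ//.
  over.
have fin T' (w : T' -> R[i]) : csummable w ->
    (\esum_(y in [set: T']) `|normc (w y)|%:E)%E \is a fin_num.
  by move=> sw; apply: ge0_rsummable_fin => //; apply: le_rsummable sw => x;
    rewrite normr_id.
under eq_esum do rewrite muleC -(fineK (fin _ _ sv)).
rewrite esumZ//; last by rewrite fine_ge0// esum_ge0.
by rewrite fineK ?fin// -ge0_fin_numE ?mule_ge0 ?esum_ge0// fin_numM// fin.
Qed.

Lemma csummable_le T (u : T -> R[i]) : csummable u ->
  exists2 M : R, 0 <= M & forall x, normc (u x) <= M.
Proof.
move=> su; have fin := ge0_rsummable_fin (fun x => normc_ge0 (u x)) su.
have nn x : (0 <= (normc (u x))%:E)%E by rewrite lee_fin normc_ge0.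
exists (fine (\esum_(x in [set: T]) (normc (u x))%:E)%E).
  by rewrite fine_ge0// esum_ge0.
move=> x; rewrite -lee_fin fineK//.
rewrite -(@esum_set1 _ _ x (fun x => (normc (u x))%:E))//.
rewrite (@esum_mkcond _ _ [set x]); apply: le_esum => z _.
by case: ifP.
Qed.

End ComplexSums.

Section Convolution.
Context {R : realType}.
Implicit Types f g h : int -> R[i].

Definition conv f g : int -> R[i] :=
  fun n => csum (fun k : int => f k * g (n - k)).

Definition delta0 : int -> R[i] := fun n => (n == 0)%:R.

Let shear_bij : bijective (fun z : int * int => (z.2, z.1 - z.2)).
Proof.
by exists (fun z => (z.1 + z.2, z.1)) => -[m k] /=; congr pair;
  [rewrite addrC subrK|rewrite addrC addKr].
Qed.

Let refl_bij (n : int) : bijective (fun k : int => n - k).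
Proof. by exists (fun k => n - k) => k; rewrite opprB addrC subrK. Qed.

Let shift_bij (n : int) : bijective (fun k : int => k - n).
Proof. by exists (fun k => k + n) => k; rewrite ?subrK ?addrK. Qed.

Lemma csummable_shear f g : csummable f -> csummable g ->
  csummable (fun z : int * int => f z.2 * g (z.1 - z.2)).
Proof.
by move=> sf sg; exact: (reindex_csummable shear_bij (csummable_prod sf sg)).
Qed.

Lemma csummable_convrow f g n : csummable f -> csummable g ->
  csummable (fun k => f k * g (n - k)).
Proof. by move=> sf /(csummable_shear sf)/(csummable_row n). Qed.

Lemma csummable_conv f g : csummable f -> csummable g -> csummable (conv f g).
Proof. by move=> sf /(csummable_shear sf)/csummable_csum. Qed.

Lemma convC f g : conv f g = conv g f.
Proof.
apply/funext => n; rewrite /conv.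
rewrite -(reindex_csum (fun k => g k * f (n - k)) (refl_bij n)).
by apply: eq_csum => k /=; rewrite subKr mulrC.
Qed.

Lemma conv_delta0 f : conv delta0 f = f.
Proof.
have esum0 (u : int -> \bar R) : (forall k, k != 0 -> u k = 0%E) ->
    (0 <= u 0%R)%E -> (\esum_(k in [set: int]) u k = u 0%R)%E.
  move=> u0 up; rewrite -(esum_set1 up) (esum_mkcond [set 0]).
  apply: eq_esum => k _; case: ifPn => // /negP kn0; apply: u0.
  by apply/eqP => k0; apply: kn0; rewrite k0 inE.
have rsum0 (u : int -> R) : (forall k, k != 0 -> u k = 0) -> rsum u = u 0.
  move=> u0; rewrite /rsum !esum0 ?funepos_ge0 ?funeneg_ge0//.
  - by rewrite funeposE funenegE /= -!EFin_max /= -/(rpos _) -/(rneg _) -rposneg.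
  - by move=> k /u0 uk; rewrite ?funenegE ?funeposE /= uk ?oppr0 maxxx.
  - by move=> k /u0 uk; rewrite ?funenegE ?funeposE /= uk ?oppr0 maxxx.
apply/funext => n; rewrite /conv /csum !rsum0.
- by rewrite /delta0 eqxx mul1r subr0; case: (f n).
- by move=> k /negPf k0; rewrite /delta0 k0 mul0r.
- by move=> k /negPf k0; rewrite /delta0 k0 mul0r.
Qed.

Lemma csummable_delta0 : csummable delta0.
Proof.
rewrite /csummable /rsummable /summable.
rewrite (@eq_esum _ _ _ _ (fun k => if k \in [set (0 : int)] then 1%:E else 0%E)).
  by rewrite -esum_mkcond esum_set1 ?ltry// lee_fin.
move=> k _ /=; rewrite /delta0; case: ifPn => [/set_mem ->|].
  by rewrite eqxx normc1 normr1.
move=> /negP kn0; case: eqVneq => [k0|]; last by rewrite normc0 normr0.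
by exfalso; apply: kn0; rewrite k0 inE.
Qed.

Lemma convDl f g h : csummable f -> csummable g -> csummable h ->
  conv (f + g) h = conv f h + conv g h.
Proof.
move=> sf sg sh; apply/funext => n; rewrite -[RHS]/(conv f h n + conv g h n) /conv.
rewrite -csumD; [|exact: csummable_convrow..].
by apply: eq_csum => k; rewrite -mulrDl.
Qed.

Lemma convZl (c : R[i]) f g : csummable f -> csummable g ->
  conv (c *: f) g = c *: conv f g.
Proof.
move=> sf sg; apply/funext => n; rewrite -[RHS]/(c * conv f g n) /conv.
rewrite -csumZ; last exact: csummable_convrow.
by apply: eq_csum => k; rewrite mulrA.
Qed.

Lemma convA f g h : csummable f -> csummable g -> csummable h ->
  conv f (conv g h) = conv (conv f g) h.
Proof.
move=> sf sg sh; apply/funext => n; apply/esym; rewrite /conv.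
transitivity (csum (fun m => csum (fun k => f k * g (m - k) * h (n - m)))).
  apply: eq_csum => m; rewrite mulrC -csumZ; last exact: csummable_convrow.
  by apply: eq_csum => k; rewrite mulrC.
rewrite csum_exchange.
  apply: eq_csum => k.
  transitivity (csum (fun m => f k * (g (m - k) * h (n - k - (m - k))))).
    by apply: eq_csum => m; rewrite mulrA opprB addrA subrK.
  rewrite csumZ; last first.
    apply: (reindex_csummable (u := fun j => g j * h (n - k - j)) (shift_bij k)).
    exact: csummable_convrow.
  by rewrite (reindex_csum (fun j => g j * h (n - k - j)) (shift_bij k)).
have [M M0 hM] := csummable_le sh.
apply: le_rsummable (rsummableZ M (csummable_shear sf sg)) => -[m k] /=.
rewrite normcM [leLHS]ger0_norm ?mulr_ge0 ?normc_ge0//.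
by rewrite ger0_norm ?mulr_ge0 ?normc_ge0// mulrC ler_wpM2r ?normc_ge0.
Qed.

End Convolution.

Section Ell1.
Context {R : realType}.

Definition csummable_pred : {pred int -> R[i]} := fun f => `[< csummable f >].

Lemma csummable_submod : submod_closed csummable_pred.
Proof.
split=> [|c f g /asboolP sf /asboolP sg]; apply/asboolP.
  by apply: (le_rsummable _ csummable_delta0) => n; rewrite normc0 normr0.
by apply: csummableD => //; exact: csummableZ.
Qed.

HB.instance Definition _ :=
  GRing.isSubmodClosed.Build R[i] (int -> R[i]) csummable_pred csummable_submod.
End Ell1.

Record ell1 (R : realType) := Ell1 {
  ell1_fun :> int -> R[i];
  ell1_mem : ell1_fun \in csummable_pred }.

HB.instance Definition _ (R : realType) := [isSub for @ell1_fun R].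
HB.instance Definition _ (R : realType) := [Choice of ell1 R by <:].
HB.instance Definition _ (R : realType) :=
  [SubChoice_isSubLmodule of ell1 R by <:].

Section Ell1Algebra.
Context {R : realType}.
Implicit Types f g h : ell1 R.

Lemma ell1P f : csummable f. Proof. exact/asboolP/ell1_mem. Qed.

Definition ell1_one : ell1 R := Ell1 (asboolT csummable_delta0).
Definition ell1_mul f g : ell1 R :=
  Ell1 (asboolT (csummable_conv (ell1P f) (ell1P g))).

Let ell1_mulA : associative ell1_mul.
Proof. by move=> f g h; apply/val_inj/convA; exact: ell1P. Qed.
Let ell1_mulC : commutative ell1_mul.
Proof. by move=> f g; apply/val_inj/convC. Qed.
Let ell1_mul1 : left_id ell1_one ell1_mul.
Proof. by move=> f; apply/val_inj/conv_delta0. Qed.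
Let ell1_mulDl : left_distributive ell1_mul +%R.
Proof. by move=> f g h; apply/val_inj/convDl; exact: ell1P. Qed.
Let ell1_one_neq0 : ell1_one != 0.
Proof.
apply/eqP => /(congr1 (fun f : ell1 R => f 0)) /= /eqP.
by rewrite /delta0 eqxx oner_eq0.
Qed.

HB.instance Definition _ := GRing.Zmodule_isComNzRing.Build (ell1 R)
  ell1_mulA ell1_mulC ell1_mul1 ell1_mulDl ell1_one_neq0.

Let ell1_scaleAl (c : R[i]) f g : c *: (f * g) = c *: f * g.
Proof. by apply/esym/val_inj/convZl; exact: ell1P. Qed.

HB.instance Definition _ :=
  GRing.Lmodule_isLalgebra.Build R[i] (ell1 R) ell1_scaleAl.
HB.instance Definition _ := GRing.Lalgebra_isComAlgebra.Build R[i] (ell1 R).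

Definition ell1_norm f : R :=
  fine (\esum_(n in [set: int]) (normc (f n))%:E)%E.

End Ell1Algebra.
Section BoundedOperators.
Context {R : realType} (E : normedModType R[i]).
Implicit Types (x : E) (T U : E -> E).

(* Norms of normed modules over R[i] are R[i]-valued; [rnorm] takes values in R
   (see [rnormE]). *)
Definition rnorm x : R := complex.Re `|x|.

Definition bounded_operator T :=
  linear T /\ exists M : R, forall x, rnorm (T x) <= M * rnorm x.

Definition opnorm T : R := sup [set rnorm (T x) | x in [set x | rnorm x <= 1]].

Lemma rnormE x : `|x| = (rnorm x)%:C.
Proof.
have := normr_ge0 x; rewrite /rnorm; case: `|x| => a b.
by rewrite lecE /= => /andP[/eqP -> _].
Qed.

Lemma rnorm_ge0 x : 0 <= rnorm x.
Proof. by have := normr_ge0 x; rewrite rnormE lecR. Qed.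

Lemma rnorm0 : rnorm 0 = 0. Proof. by rewrite /rnorm normr0. Qed.

Lemma rnormD x y : rnorm (x + y) <= rnorm x + rnorm y.
Proof. by have := ler_normD x y; rewrite !rnormE -rmorphD lecR. Qed.

Lemma rnormZ (c : R[i]) x : rnorm (c *: x) = normc c * rnorm x.
Proof. by rewrite {1}/rnorm normrZ rnormE -rmorphM. Qed.

Lemma rnorm_eq0 x : rnorm x = 0 -> x = 0.
Proof. by move=> x0; apply/eqP; rewrite -normr_eq0 rnormE x0. Qed.

Lemma opnorm_ubound T : bounded_operator T ->
  has_ubound [set rnorm (T x) | x in [set x | rnorm x <= 1]].
Proof.
move=> [_ [M MT]]; exists (Num.max M 0) => _ [x /= x1 <-].
apply: (le_trans (MT x)); apply: (@le_trans _ _ (Num.max M 0 * rnorm x)).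
  by rewrite ler_wpM2r ?rnorm_ge0// le_max lexx.
by rewrite ler_piMr// le_max lexx orbT.
Qed.

Lemma opnorm_ge T x : bounded_operator T -> rnorm x <= 1 ->
  rnorm (T x) <= opnorm T.
Proof. by move=> bT x1; apply: ub_le_sup (opnorm_ubound bT) _ _; exists x. Qed.

Lemma opnorm_ge0 T : bounded_operator T -> 0 <= opnorm T.
Proof.
move=> bT; apply: le_trans (rnorm_ge0 (T 0)) (opnorm_ge bT _).
by rewrite rnorm0.
Qed.

Lemma opnorm_le T (M : R) : (forall x, rnorm x <= 1 -> rnorm (T x) <= M) ->
  opnorm T <= M.
Proof.
move=> TM; apply: ge_sup; first by exists (rnorm (T 0)), 0; rewrite //= rnorm0.
by move=> _ [x x1 <-]; exact: TM.
Qed.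

Lemma le_opnorm T x : bounded_operator T ->
  rnorm (T x) <= opnorm T * rnorm x.
Proof.
move=> bT; have [lT _] := bT.
have TZ (c : R[i]) y : T (c *: y) = c *: T y.
  have T0 : T 0 = 0.
    by have := lT 1 0 0; rewrite !scale1r addr0 -[LHS]addr0 => /addrI.
  by have := lT c y 0; rewrite T0 !addr0.
have [x0|xn0] := eqVneq (rnorm x) 0.
  rewrite x0 mulr0 (rnorm_eq0 x0) -(scale0r 0) TZ scale0r rnorm0//.
have xp : 0 < rnorm x by rewrite lt_def xn0 rnorm_ge0.
have nci : normc ((rnorm x)^-1)%:C = (rnorm x)^-1.
  by rewrite /normc /= expr0n/= addr0 sqrtr_sqr ger0_norm// invr_ge0 ltW.
have := @opnorm_ge T (((rnorm x)^-1)%:C *: x) bT.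
by rewrite TZ !rnormZ nci mulVf// lexx ler_pdivrMl// mulrC => /(_ isT).
Qed.

End BoundedOperators.

Section Representations.
Context {R : realType}.

(* The p-integrable complex functions, before identification modulo a.e.
   equality. *)
Definition complex_Lp d (X : measurableType d)
    (mu : {measure set X -> \bar R}) (p : R) : set (X -> R[i]) :=
  [set f : X -> R[i] | [/\ measurable_fun [set: X] (fun x => complex.Re (f x)),
               measurable_fun [set: X] (fun x => complex.Im (f x)) &
               (Lnorm mu p%:E (fun x => (normc (f x))%:E) < +oo)%E]].

(* L^p(X, mu) is the quotient of [complex_Lp mu p] by the functions of zero
   seminorm, so an isometric isomorphism from L^p(X, mu) onto E is the same thing
   as a surjective, linear, seminorm-preserving map Pi from [complex_Lp mu p] to E
   (the values of Pi outside of [complex_Lp mu p] are irrelevant). *)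
Definition Lp_space (p : R) (E : completeNormedModType R[i]) :=
  exists (d : measure_display) (X : measurableType d)
    (mu : {sigma_finite_measure set X -> \bar R}) (Pi : (X -> R[i]) -> E),
  [/\ forall (c : R[i]) f g, complex_Lp mu p f -> complex_Lp mu p g ->
        Pi (c *: f + g) = c *: Pi f + Pi g,
      forall f, complex_Lp mu p f ->
        (rnorm (Pi f))%:E = Lnorm mu p%:E (fun x => (normc (f x))%:E) &
      forall e : E, exists2 f, complex_Lp mu p f & Pi f = e].

Definition separable_space (E : topologicalType) :=
  exists D : set E, countable D /\ dense D.

(* Algebra homomorphisms are not required to preserve the unit. *)
Record contractive_rep (E : normedModType R[i]) (rho : ell1 R -> E -> E) := {
  rep_bounded : forall f, bounded_operator (rho f);
  rep_linear : forall (c : R[i]) f g x,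
    rho (c *: f + g) x = c *: rho f x + rho g x;
  rep_mul : forall f g x, rho (f * g) x = rho f (rho g x);
  rep_contractive : forall f, opnorm (rho f) <= ell1_norm f }.

Definition Fp_values (p : R) (f : ell1 R) : set R :=
  [set r | exists (E : completeNormedModType R[i]) (rho : ell1 R -> E -> E),
    [/\ separable_space E, Lp_space p E, contractive_rep rho & r = opnorm (rho f)]].

(* The set of values is bounded above by [ell1_norm f], so [sup] is the actual
   supremum. *)
Definition Fp_norm (p : R) (f : ell1 R) : R := sup (Fp_values p f).

Lemma Fp_valuesP p f r : Fp_values p f r -> 0 <= r /\ r <= Fp_norm p f.
Proof.
move=> fr; split; first by case: fr => E [rho [_ _ [bnd _ _ _] ->]];
  exact: opnorm_ge0.
apply: ub_le_sup fr; exists (ell1_norm f) => _ [E [rho [_ _ [_ _ _ ctr] ->]]].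
exact: ctr.
Qed.

Lemma Fp_norm_le p f M : 0 <= M -> (forall r, Fp_values p f r -> r <= M) ->
  Fp_norm p f <= M.
Proof.
move=> M0 fM; rewrite /Fp_norm.
have [->|/set0P fn] := eqVneq (Fp_values p f) set0; first by rewrite sup0.
exact: ge_sup.
Qed.

Lemma Fp_norm_ge0 p f : 0 <= Fp_norm p f.
Proof.
have [f0|/set0P[r /Fp_valuesP[r0 rf]]] := eqVneq (Fp_values p f) set0.
  by rewrite /Fp_norm f0 sup0.
exact: le_trans r0 rf.
Qed.

Lemma Fp_normD p f g : Fp_norm p (f + g) <= Fp_norm p f + Fp_norm p g.
Proof.
apply: Fp_norm_le; first by rewrite addr_ge0 ?Fp_norm_ge0.
move=> _ [E [rho [sE lE ctr ->]]].
apply: opnorm_le => x x1.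
have := rep_linear ctr 1 f g x; rewrite !scale1r => ->.
apply: le_trans (rnormD _ _) (lerD _ _).
  apply: (le_trans (opnorm_ge (rep_bounded ctr f) x1)).
  by have [] := @Fp_valuesP p f (opnorm (rho f)) _; [exists E, rho|].
apply: (le_trans (opnorm_ge (rep_bounded ctr g) x1)).
by have [] := @Fp_valuesP p g (opnorm (rho g)) _; [exists E, rho|].
Qed.

Lemma Fp_normM p f g : Fp_norm p (f * g) <= Fp_norm p f * Fp_norm p g.
Proof.
apply: Fp_norm_le; first by rewrite mulr_ge0 ?Fp_norm_ge0.
move=> _ [E [rho [sE lE ctr ->]]].
have vf : opnorm (rho f) <= Fp_norm p f.
  by have [] := @Fp_valuesP p f (opnorm (rho f)) _; [exists E, rho|].
have vg : opnorm (rho g) <= Fp_norm p g.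
  by have [] := @Fp_valuesP p g (opnorm (rho g)) _; [exists E, rho|].
apply: opnorm_le => x x1; rewrite (rep_mul ctr).
apply: (le_trans (le_opnorm _ (rep_bounded ctr f))).
apply: ler_pM; rewrite ?opnorm_ge0 ?rnorm_ge0//; first exact: rep_bounded.
exact: le_trans (opnorm_ge (rep_bounded ctr g) x1) vg.
Qed.

Lemma Fp_normZ p (c : R[i]) f : Fp_norm p (c *: f) = normc c * Fp_norm p f.
Proof.
have le (a : R[i]) h : Fp_norm p (a *: h) <= normc a * Fp_norm p h.
  apply: Fp_norm_le; first by rewrite mulr_ge0 ?normc_ge0 ?Fp_norm_ge0.
  move=> _ [E [rho [sE lE ctr ->]]].
  have rho0 x : rho 0 x = 0.
    have := rep_linear ctr 1 0 0 x; rewrite !scale1r addr0 -[LHS]addr0.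
    by move=> /addrI.
  apply: opnorm_le => x x1.
  rewrite -[a *: h]addr0 (rep_linear ctr) rho0 addr0 rnormZ.
  rewrite ler_wpM2l ?normc_ge0//.
  apply: (le_trans (opnorm_ge (rep_bounded ctr h) x1)).
  by have [] := @Fp_valuesP p h (opnorm (rho h)) _; [exists E, rho|].
apply/eqP; rewrite eq_le le/=.
have [->|c0] := eqVneq c 0; first by rewrite normc0 mul0r Fp_norm_ge0.
have ncp : 0 < normc c.
  by rewrite lt_def normc_ge0 andbT; apply: contra c0 => /eqP/eq0_normc ->.
by rewrite -ler_pdivlMl// -normcV; apply: le_trans (le _ _);
  rewrite scalerA mulVf// scale1r.
Qed.

End Representations.

Record alg_seminorm (R : realType) (A : algType R[i]) := AlgSeminorm {
  semi_norm :> A -> R;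
  semi_ge0 : forall x, 0 <= semi_norm x;
  semiD : forall x y, semi_norm (x + y) <= semi_norm x + semi_norm y;
  semiZ : forall (c : R[i]) x, semi_norm (c *: x) = normc c * semi_norm x;
  semiM : forall x y, semi_norm (x * y) <= semi_norm x * semi_norm y }.

Definition Fp_seminorm (R : realType) (p : R) : alg_seminorm (ell1 R) :=
  AlgSeminorm (Fp_norm_ge0 p) (Fp_normD p) (Fp_normZ p) (Fp_normM p).
Record banach_algebra (K : numFieldType) := BanachAlgebra {
  banach_space :> completeNormedModType K;
  banach_mul : banach_space -> banach_space -> banach_space;
  banach_mulA : associative banach_mul;
  banach_mulDl : left_distributive banach_mul +%R;
  banach_mulDr : right_distributive banach_mul +%R;
  banach_scaleAl : forall (k : K) x y,
    banach_mul (k *: x) y = k *: banach_mul x y;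
  banach_scaleAr : forall (k : K) x y,
    banach_mul x (k *: y) = k *: banach_mul x y;
  banach_normM : forall x y, `|banach_mul x y| <= `|x| * `|y| }.

(* Completion of A for the seminorm N: Cauchy sequences modulo null sequences.
   [to_completion] is the canonical homomorphism, it preserves the (semi)norm and
   has dense range. *)
Section Completion.
Context {R : realType} {A : algType R[i]} (N : alg_seminorm A).
Implicit Types (u v w : nat -> A) (x y z : A).

Definition N_cauchy u := forall e : R, 0 < e ->
  exists n, forall i j, (n <= i)%N -> (n <= j)%N -> N (u i - u j) < e.

Definition N_null u := forall e : R, 0 < e ->
  exists n, forall i, (n <= i)%N -> N (u i) < e.

Let semi0 : N 0 = 0.
Proof. by rewrite -(scale0r 0) semiZ normc0 mul0r. Qed.

Let semiN x : N (- x) = N x.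
Proof. by rewrite -scaleN1r semiZ normcN normc1 mul1r. Qed.

Let semiB x y : N (x - y) = N (y - x).
Proof. by rewrite -semiN opprB. Qed.

Let semi_dist x y : `|N x - N y| <= N (x - y).
Proof.
rewrite ler_norml; apply/andP; split.
  have := semiD N (y - x) x; rewrite subrK semiB; lra.
by have := semiD N (x - y) y; rewrite subrK; lra.
Qed.

Lemma N_cauchy_bounded u : N_cauchy u ->
  exists2 M, 0 < M & forall i, N (u i) <= M.
Proof.
move=> /(_ 1 ltr01)[n un].
exists (1 + N (u n) + \sum_(k < n) N (u k)).
  by rewrite -addrA ltr_pwDl// addr_ge0 ?semi_ge0// sumr_ge0// => k _;
    exact: semi_ge0.
move=> i; have s0 : 0 <= \sum_(k < n) N (u k).
  by apply: sumr_ge0 => k _; exact: semi_ge0.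
have [ni|ni] := leqP n i.
  have := un _ _ ni (leqnn n); have := semiD N (u i - u n) (u n).
  by rewrite subrK; lra.
rewrite (bigD1 (Ordinal ni))//=.
have : 0 <= \sum_(k < n | k != Ordinal ni) N (u k).
  by apply: sumr_ge0 => k _; exact: semi_ge0.
by have := semi_ge0 N (u n); lra.
Qed.

Lemma N_cauchyD u v : N_cauchy u -> N_cauchy v -> N_cauchy (u + v).
Proof.
move=> cu cv e e0; have e2 : 0 < e / 2 by lra.
have [[n un] [m vm]] := (cu _ e2, cv _ e2).
exists (maxn n m) => i j; rewrite !geq_max => /andP[ni mi] /andP[nj mj].
have := un _ _ ni nj; have := vm _ _ mi mj.
have := semiD N (u i - u j) (v i - v j).
rewrite (_ : u i - u j + _ = (u + v) i - (u + v) j); first lra.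
by rewrite /= opprD addrACA.
Qed.

Lemma N_cauchyZ (c : R[i]) u : N_cauchy u -> N_cauchy (c *: u).
Proof.
move=> cu e e0; have c1 : 0 < normc c + 1 by have := normc_ge0 c; lra.
have [n un] := cu (e / (normc c + 1)) (divr_gt0 e0 c1).
exists n => i j ni nj; have := un _ _ ni nj.
rewrite ltr_pdivlMr// -[(c *: u) i]/(c *: u i) -[(c *: u) j]/(c *: u j).
rewrite -scalerBr semiZ; apply: le_lt_trans.
by rewrite mulrC ler_wpM2l ?semi_ge0// lerDl.
Qed.

Lemma N_cauchyM u v : N_cauchy u -> N_cauchy v -> N_cauchy (u * v).
Proof.
move=> cu cv; have [M M0 uM] := N_cauchy_bounded cu.
have [L L0 vL] := N_cauchy_bounded cv.
move=> e e0; have eL : 0 < e / 2 / L by rewrite !divr_gt0.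
have eM : 0 < e / 2 / M by rewrite !divr_gt0.
have [[n un] [m vm]] := (cu _ eL, cv _ eM).
exists (maxn n m) => i j; rewrite !geq_max => /andP[ni mi] /andP[nj mj].
have := un _ _ ni nj; have := vm _ _ mi mj; rewrite !ltr_pdivlMr// => h1 h2.
rewrite (_ : (u * v) i - _ = (u i - u j) * v i + u j * (v i - v j)).
  apply: (le_lt_trans (semiD _ _ _)).
  have := semiM N (u i - u j) (v i); have := semiM N (u j) (v i - v j).
  have := ler_wpM2l (semi_ge0 N (u i - u j)) (vL i).
  have := ler_wpM2r (semi_ge0 N (v i - v j)) (uM j).
  by rewrite (mulrC M); lra.
by rewrite /= mulrBl mulrBr addrA subrK.
Qed.

Lemma N_cauchy_cst x : N_cauchy (fun=> x).
Proof. by move=> e e0; exists 0 => i j _ _; rewrite subrr semi0. Qed.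

Definition N_cauchy_pred : {pred nat -> A} := fun u => `[< N_cauchy u >].

Lemma N_cauchy_submod : submod_closed N_cauchy_pred.
Proof.
split=> [|c u v /asboolP cu /asboolP cv]; apply/asboolP.
  exact: (N_cauchy_cst 0).
by apply: N_cauchyD => //; exact: N_cauchyZ.
Qed.

HB.instance Definition _ :=
  GRing.isSubmodClosed.Build R[i] (nat -> A) N_cauchy_pred N_cauchy_submod.

Lemma N_cauchy_subring : subring_closed N_cauchy_pred.
Proof.
split=> [|u v cu cv|u v /asboolP cu /asboolP cv].
- exact/asboolP/(N_cauchy_cst 1).
- exact: rpredB.
- exact/asboolP/N_cauchyM.
Qed.

Record cauchy_seq := CauchySeq {
  cauchy_fun :> nat -> A;
  cauchy_mem : cauchy_fun \in N_cauchy_pred }.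

HB.instance Definition _ := [isSub for cauchy_fun].
HB.instance Definition _ := [Choice of cauchy_seq by <:].
HB.instance Definition _ := [SubChoice_isSubLmodule of cauchy_seq by <:].
HB.instance Definition _ := 
  GRing.SubZmodule_isSubPzRing.Build (nat -> A) N_cauchy_pred cauchy_seq
    N_cauchy_subring.

Implicit Types (s t : cauchy_seq).

Lemma cauchy_seqP s : N_cauchy s. Proof. exact/asboolP/cauchy_mem. Qed.

Definition seq_equiv s t := `[< N_null (s - t : cauchy_seq) >].

Let nullD u v : N_null u -> N_null v -> N_null (u + v).
Proof.
move=> cu cv e e0; have e2 : 0 < e / 2 by lra.
have [[n un] [m vm]] := (cu _ e2, cv _ e2).
exists (maxn n m) => i; rewrite !geq_max => /andP[ni mi].
have := un _ ni; have := vm _ mi; have := semiD N (u i) (v i).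
by rewrite -[(u + v) i]/(u i + v i); lra.
Qed.

Let nullZ (c : R[i]) u : N_null u -> N_null (c *: u).
Proof.
move=> cu e e0; have c1 : 0 < normc c + 1 by have := normc_ge0 c; lra.
have [n un] := cu (e / (normc c + 1)) (divr_gt0 e0 c1).
exists n => i ni; have := un _ ni.
rewrite ltr_pdivlMr// -[(c *: u) i]/(c *: u i) semiZ; apply: le_lt_trans.
by rewrite mulrC ler_wpM2l ?semi_ge0// lerDl.
Qed.

Let nullMr u v : N_null u -> N_cauchy v -> N_null (u * v).
Proof.
move=> nu /N_cauchy_bounded[M M0 vM] e e0.
have [n un] := nu _ (divr_gt0 e0 M0); exists n => i ni.
have := un _ ni; rewrite ltr_pdivlMr//; apply: le_lt_trans.
by apply: (le_trans (semiM N _ _)); rewrite ler_wpM2l ?semi_ge0.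
Qed.

Let nullMl u v : N_cauchy u -> N_null v -> N_null (u * v).
Proof.
move=> /N_cauchy_bounded[M M0 uM] nv e e0.
have [n vn] := nv _ (divr_gt0 e0 M0); exists n => i ni.
have := vn _ ni; rewrite ltr_pdivlMr// mulrC; apply: le_lt_trans.
by apply: (le_trans (semiM N _ _)); rewrite ler_wpM2r ?semi_ge0.
Qed.

Lemma seq_equiv_refl : reflexive seq_equiv.
Proof.
by move=> s; apply/asboolP; rewrite subrr => e e0; exists 0 => i _; rewrite semi0.
Qed.

Lemma seq_equiv_sym : symmetric seq_equiv.
Proof.
by move=> s t; apply/asboolP/asboolP => h; rewrite -opprB -scaleN1r; exact: nullZ.
Qed.

Lemma seq_equiv_trans : transitive seq_equiv.
Proof.
move=> t s r /asboolP st /asboolP tr; apply/asboolP.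
by rewrite -(subrK t s) -addrA; exact: nullD.
Qed.

Canonical seq_equiv_rel :=
  EquivRel seq_equiv seq_equiv_refl seq_equiv_sym seq_equiv_trans.

Definition completion := {eq_quot seq_equiv}%qT.

HB.instance Definition _ := Choice.on completion.
HB.instance Definition _ := EqQuotient.on completion.

Local Notation cls s := (\pi_completion s)%qT.

Lemma clsP s t : cls s = cls t <-> N_null (s - t : cauchy_seq).
Proof. by split => [/eqmodP/asboolP|h]; last exact/eqmodP/asboolP. Qed.

Let reprP s : N_null (repr (cls s) - s : cauchy_seq).
Proof. by apply/clsP; rewrite reprK. Qed.

Implicit Types (a b c : completion).

Definition completion_add a b : completion := cls (repr a + repr b).
Definition completion_opp a : completion := cls (- repr a).
Definition completion_scale (k : R[i]) a : completion := cls (k *: repr a).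
Definition completion_mul a b : completion := cls (repr a * repr b).

Let addE s t : completion_add (cls s) (cls t) = cls (s + t).
Proof. by apply/clsP; rewrite opprD addrACA; apply: nullD; exact: reprP. Qed.

Let oppE s : completion_opp (cls s) = cls (- s).
Proof. by apply/clsP; rewrite -opprD -scaleN1r; apply: nullZ; exact: reprP. Qed.

Let scaleE k s : completion_scale k (cls s) = cls (k *: s).
Proof. by apply/clsP; rewrite -scalerBr; apply: nullZ; exact: reprP. Qed.

Let mulE s t : completion_mul (cls s) (cls t) = cls (s * t).
Proof.
apply/clsP.
rewrite (_ : _ - _ = (repr (cls s) - s) * repr (cls t) +
                     s * (repr (cls t) - t)).
  apply: nullD; first by apply: nullMr; [exact: reprP|exact: cauchy_seqP].
  by apply: nullMl; [exact: cauchy_seqP|exact: reprP].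
by rewrite mulrBl mulrBr addrA subrK.
Qed.

Let clsK a : exists s, a = cls s.
Proof. by exists (repr a); rewrite reprK. Qed.

Let addA : associative completion_add.
Proof.
move=> a b c; have [[s ->] [t ->] [r ->]] := And3 (clsK a) (clsK b) (clsK c).
by rewrite !addE addrA.
Qed.

Let addC : commutative completion_add.
Proof.
by move=> a b; have [[s ->] [t ->]] := (clsK a, clsK b); rewrite !addE addrC.
Qed.

Let add0 : left_id (cls 0) completion_add.
Proof. by move=> a; have [s ->] := clsK a; rewrite addE add0r. Qed.

Let addN : left_inverse (cls 0) completion_opp completion_add.
Proof. by move=> a; have [s ->] := clsK a; rewrite oppE addE addNr. Qed.

HB.instance Definition _ := GRing.isZmodule.Build completion addA addC add0 addN.

Let clsD s t : cls s + cls t = cls (s + t). Proof. exact: addE. Qed.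

Let scaleA k l a :
  completion_scale k (completion_scale l a) = completion_scale (k * l) a.
Proof. by have [s ->] := clsK a; rewrite !scaleE scalerA. Qed.

Let scale1 : left_id 1 completion_scale.
Proof. by move=> a; have [s ->] := clsK a; rewrite scaleE scale1r. Qed.

Let scaleDr : right_distributive completion_scale +%R.
Proof.
move=> k a b; have [[s ->] [t ->]] := (clsK a, clsK b).
by rewrite clsD !scaleE clsD scalerDr.
Qed.

Let scaleDl a : {morph completion_scale^~ a : k l / k + l}.
Proof. by move=> k l; have [s ->] := clsK a; rewrite !scaleE clsD scalerDl. Qed.

HB.instance Definition _ := GRing.Zmodule_isLmodule.Build R[i] completion
  scaleA scale1 scaleDr scaleDl.

Let mulA : associative completion_mul.
Proof.
move=> a b c; have [[s ->] [t ->] [r ->]] := And3 (clsK a) (clsK b) (clsK c).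
by rewrite !mulE mulrA.
Qed.

Let mulDl : left_distributive completion_mul +%R.
Proof.
move=> a b c; have [[s ->] [t ->] [r ->]] := And3 (clsK a) (clsK b) (clsK c).
by rewrite clsD !mulE clsD mulrDl.
Qed.

Let mulDr : right_distributive completion_mul +%R.
Proof.
move=> a b c; have [[s ->] [t ->] [r ->]] := And3 (clsK a) (clsK b) (clsK c).
by rewrite clsD !mulE clsD mulrDr.
Qed.

Let clsZ k s : k *: cls s = cls (k *: s). Proof. exact: scaleE. Qed.

Definition limN u : R := lim (N (u n) @[n --> \oo]).

Lemma cvg_limN u : N_cauchy u -> N (u n) @[n --> \oo] --> limN u.
Proof.
move=> cu; apply: cauchy_cvg; apply/cauchy_exP => e e0.
have [n un] := cu _ e0; exists (N (u n)).
exists n => // i /= ni; apply: le_lt_trans (semi_dist _ _) _.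
exact: un.
Qed.

Let limN_eq u l : N (u n) @[n --> \oo] --> l -> limN u = l.
Proof. by move=> ul; apply: cvg_lim. Qed.

Let limN_null u v : N_cauchy v -> N_null (u - v) -> limN u = limN v.
Proof.
move=> cv nuv; apply: limN_eq.
rewrite (_ : (fun n => N (u n)) = (fun n => N (v n) + (N (u n) - N (v n)))).
  rewrite -[X in _ --> X]addr0; apply: cvgD; first exact: cvg_limN.
  apply/cvgrPdist_lt => e e0; have [n un] := nuv _ e0.
  exists n => // i /= ni; rewrite sub0r normrN.
  exact: le_lt_trans (semi_dist _ _) (un _ ni).
by apply/funext => n; rewrite addrC subrK.
Qed.

Let limN_ge0 u : N_cauchy u -> 0 <= limN u.
Proof.
move=> cu; apply: limr_ge; first by apply: cvgP (cvg_limN cu).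
by apply: nearW => n; exact: semi_ge0.
Qed.

Let limND u v : N_cauchy u -> N_cauchy v -> limN (u + v) <= limN u + limN v.
Proof.
move=> cu cv; have cuv : N (u n) + N (v n) @[n --> \oo] --> limN u + limN v.
  by apply: cvgD; exact: cvg_limN.
rewrite -(cvg_lim (@Rhausdorff R) cuv); apply: ler_lim.
- by apply: cvgP (cvg_limN (N_cauchyD cu cv)).
- exact: cvgP cuv.
- by apply: nearW => n; exact: semiD.
Qed.

Let limNM u v : N_cauchy u -> N_cauchy v -> limN (u * v) <= limN u * limN v.
Proof.
move=> cu cv; have cuv : N (u n) * N (v n) @[n --> \oo] --> limN u * limN v.
  by apply: cvgM; exact: cvg_limN.
rewrite -(cvg_lim (@Rhausdorff R) cuv); apply: ler_lim.
- by apply: cvgP (cvg_limN (N_cauchyM cu cv)).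
- exact: cvgP cuv.
- by apply: nearW => n; exact: semiM.
Qed.

Let limNZ (k : R[i]) u : N_cauchy u -> limN (k *: u) = normc k * limN u.
Proof.
move=> cu; apply: limN_eq.
rewrite (_ : (fun n => N ((k *: u) n)) = (fun n => normc k * N (u n))).
  by apply: cvgMr; exact: cvg_limN.
by apply/funext => n; exact: semiZ.
Qed.

Let limN0 u : N_cauchy u -> limN u = 0 -> N_null u.
Proof.
move=> cu u0 e e0; have := cvg_limN cu; rewrite u0.
move=> /cvgrPdist_lt/(_ e e0)[n _ un]; exists n => i ni.
by have := un i ni; rewrite sub0r normrN ger0_norm ?semi_ge0.
Qed.

Definition completion_norm a : R := limN (repr a).

Let normE s : completion_norm (cls s) = limN s.
Proof. by apply: limN_null; [exact: cauchy_seqP|exact: reprP]. Qed.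

Let cnormD a b :
  (completion_norm (a + b))%:C <= (completion_norm a)%:C + (completion_norm b)%:C.
Proof.
have [[s ->] [t ->]] := (clsK a, clsK b); rewrite clsD !normE -rmorphD lecR.
by apply: limND; exact: cauchy_seqP.
Qed.

Let cnormZ (k : R[i]) a :
  (completion_norm (k *: a))%:C = `|k| * (completion_norm a)%:C.
Proof.
have [s ->] := clsK a; rewrite clsZ !normE -[`|k|]/((normc k)%:C) -rmorphM; congr _%:C.
by apply: limNZ; exact: cauchy_seqP.
Qed.

Let cnorm0 a : (completion_norm a)%:C = 0 -> a = 0.
Proof.
have [s ->] := clsK a; rewrite normE => /eqP; rewrite eq_complex /= eqxx andbT.
move=> /eqP/(limN0 (@cauchy_seqP s)) s0; apply/clsP.
by rewrite subr0.
Qed.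

HB.instance Definition _ :=
  Lmodule_isNormed.Build R[i] completion cnormD cnormZ cnorm0.

Definition to_completion x : completion :=
  cls (CauchySeq (asboolT (@N_cauchy_cst x))).

Let completion_normE a : `|a| = (completion_norm a)%:C. Proof. by []. Qed.

Lemma to_completion_norm x : `|to_completion x| = (N x)%:C.
Proof.
rewrite completion_normE normE; congr _%:C; apply: limN_eq.
by apply: cvg_near_cst; exact: nearW.
Qed.

Lemma to_completion_linear : linear to_completion.
Proof.
move=> k x y; rewrite clsZ clsD; congr (cls _); exact: val_inj.
Qed.

Lemma to_completionM x y :
  to_completion (x * y) = completion_mul (to_completion x) (to_completion y).
Proof. by rewrite mulE; congr (cls _); exact: val_inj. Qed.

Let to_completionB x y : to_completion x - to_completion y = to_completion (x - y).
Proof.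
have := to_completion_linear (-1) y x; rewrite !scaleN1r addrC => <-.
by rewrite addrC.
Qed.

Let cls_approx s (e : R) : 0 < e ->
  exists n, forall i, (n <= i)%N -> `|cls s - to_completion (s i)| <= e%:C.
Proof.
move=> e0; have [n sn] := cauchy_seqP s e0; exists n => i ni.
set t : cauchy_seq := CauchySeq (asboolT (@N_cauchy_cst (s i))).
have -> : cls s - to_completion (s i) = cls (s - t).
  by rewrite /to_completion -/t -[- cls t]scaleN1r clsZ clsD scaleN1r.
rewrite completion_normE normE lecR.
apply: limr_le; first exact: cvgP (cvg_limN (@cauchy_seqP (s - t))).
exists n => // j /= nj; exact/ltW/sn.
Qed.

Let complex_pos_real (e : R[i]) : 0 < e -> exists2 r : R, 0 < r & r%:C < e.
Proof.
case: e => u w; rewrite ltcE /= => /andP[/eqP w0 u0]; exists (u / 2); first lra.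
by rewrite ltcE /= w0 eqxx /=; lra.
Qed.

Lemma to_completion_dense : dense (range to_completion).
Proof.
move=> O [a Oa] oO; have := open_nbhs_nbhs (conj oO Oa).
rewrite -nbhs_ballE => -[e /= e0 aO]; have [s sa] := clsK a.
have [r r0 re] := complex_pos_real e0.
have [n sn] := cls_approx s r0; exists (to_completion (s n)); split => //.
by apply: aO; rewrite -ball_normE /= sa; apply: le_lt_trans re; exact: sn.
Qed.

Let posC (e : R) : 0 < e -> 0 < e%:C :> R[i]. Proof. by move=> e0; rewrite ltcR. Qed.

Lemma completion_complete (F : set_system completion) :
  ProperFilter F -> cauchy F -> cvg F.
Proof.
move=> PF /cauchyP Fc.
have h0 n : 0 < n.+1%:R^-1 :> R by rewrite invr_gt0.
have /choice[v vF] : forall n, exists x : A,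
    F (ball (to_completion x) (n.+1%:R^-1)%:C).
  move=> n; have e2 : 0 < n.+1%:R^-1 / 2 :> R by rewrite divr_gt0.
  have [a Fa] := Fc _ (posC e2); have [s sa] := clsK a.
  have [m sm] := cls_approx s e2; exists (s m).
  apply: filterS Fa => b; rewrite -!ball_normE /= => ab.
  have -> : (n.+1%:R^-1)%:C = (n.+1%:R^-1 / 2)%:C + (n.+1%:R^-1 / 2)%:C :> R[i].
    by rewrite -rmorphD -splitr.
  rewrite -(subrK a (to_completion _)) -addrA.
  apply: (le_lt_trans (ler_normD _ _)); apply: ler_ltD => //.
  by rewrite distrC sa; exact: sm.
have Nv i j : N (v i - v j) < i.+1%:R^-1 + j.+1%:R^-1.
  have [b []] := filter_ex (filterI (vF i) (vF j)).
  rewrite -!ball_normE /= => vib vjb.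
  rewrite -ltcR -to_completion_norm -to_completionB rmorphD.
  rewrite -(subrK b (to_completion (v i))) -addrA.
  by apply: (le_lt_trans (ler_normD _ _)); rewrite ltrD// distrC.
have cv : N_cauchy v.
  move=> e e0; have e2 : 0 < e / 2 by rewrite divr_gt0.
  have [n hn] : exists n : nat, n.+1%:R^-1 < e / 2.
    by have [n _ hn] := near_infty_natSinv_lt (PosNum e2); exists n; apply: hn => /=.
  exists n => i j ni nj; apply: lt_trans (Nv i j) _.
  have le k : (n <= k)%N -> k.+1%:R^-1 <= n.+1%:R^-1 :> R.
    by move=> nk; rewrite lef_pV2 ?posrE// ler_nat.
  apply: le_lt_trans (lerD (le i ni) (le j nj)) _.
  by rewrite (splitr e) ltrD.
pose s : cauchy_seq := CauchySeq (asboolT cv).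
apply/cvg_ex; exists (cls s); apply/cvg_ballP => e e0.
have [r r0 re] := complex_pos_real e0.
have r2 : 0 < r / 2 by rewrite divr_gt0.
have [m sm] := cls_approx s r2.
have [n _ hn] := near_infty_natSinv_lt (PosNum r2).
have {}hn := hn (maxn m n) (leq_maxr _ _).
apply: filterS (vF (maxn m n)) => b; rewrite -!ball_normE /= => vb.
apply: le_lt_trans re.
have -> : r%:C = (r / 2)%:C + (r / 2)%:C :> R[i] by rewrite -rmorphD -splitr.
rewrite -(subrK (to_completion (s (maxn m n))) (cls s)) -addrA.
apply: (le_trans (ler_normD _ _)); apply: lerD; first exact/sm/leq_maxl.
by apply: (le_trans (ltW vb)); rewrite lecR ltW.
Qed.

HB.instance Definition _ := Uniform_isComplete.Build completion completion_complete.

Let cscaleAl (k : R[i]) a b :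
  completion_mul (k *: a) b = k *: completion_mul a b.
Proof.
have [[s ->] [t ->]] := (clsK a, clsK b); rewrite clsZ !mulE clsZ; congr (cls _).
by apply/val_inj/funext => n; rewrite [RHS]scalerAl.
Qed.

Let cscaleAr (k : R[i]) a b :
  completion_mul a (k *: b) = k *: completion_mul a b.
Proof.
have [[s ->] [t ->]] := (clsK a, clsK b); rewrite clsZ !mulE clsZ; congr (cls _).
by apply/val_inj/funext => n; rewrite [RHS]scalerAr.
Qed.

Let cnormM a b : `|completion_mul a b| <= `|a| * `|b|.
Proof.
have [[s ->] [t ->]] := (clsK a, clsK b); rewrite mulE !completion_normE !normE.
by rewrite -rmorphM lecR; apply: limNM; exact: cauchy_seqP.
Qed.

Definition completion_algebra : banach_algebra R[i] :=
  BanachAlgebra mulA mulDl mulDr cscaleAl cscaleAr cnormM.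

End Completion.

Definition isometrically_isomorphic (K : numFieldType) (A B : banach_algebra K) :=
  exists phi : A -> B,
    [/\ bijective phi, linear phi,
        {morph phi : x y / banach_mul x y >-> banach_mul x y} &
        forall x, `|phi x| = `|x|].

(* The Banach algebra F^p(Z). *)
Definition FpZ (R : realType) (p : R) : banach_algebra R[i] :=
  completion_algebra (Fp_seminorm p).

(* Main.v *)
Require Import Defs.
From HB Require Import structures.
From mathcomp Require Import all_boot all_order all_algebra.
From mathcomp Require Import complex.
From mathcomp Require Import all_classical all_reals all_analysis.
From mathcomp Require Import measurable_realfun.
From mathcomp Require Import zify ring lra.

Set Implicit Arguments.
Unset Strict Implicit.
Unset Printing Implicit Defensive.

Import Order.TTheory GRing.Theory Num.Theory numFieldNormedType.Exports ComplexField.Normc.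

Local Open Scope classical_set_scope.
Local Open Scope ring_scope.
Local Open Scope complex_scope.

(** Write [||f||_p] for the norm of [F^p(Z)] and [u] for the generator [delta_1].

Composing an isometric isomorphism [F^p(Z) -> F^q(Z)] with the representations
of [F^q(Z)] on [L^q]-spaces yields contractive representations of [l^1(Z)] on
[L^q]-spaces, so universality of the norm gives [||f||_p <= ||f||_q] on
[l^1(Z)]; by symmetry the two norms agree.  Everything is thus reduced to
comparing [||.||_p] and [||.||_q].

By transference, [||f||_p], for [f] a polynomial in [u], is the best common
bound of the convolution operators defined by [f] on [l^p(Z/n)], [n >= 2].
By duality these bounds agree for conjugate exponents.

Conversely, the first-order behaviour of [||1 + t (u - u^-1)||_p] as [t]
decreases to [0] is governed by the numerical range of [u - u^-1] on [l^p],
namely by the supremum of [sum_j 2 sqrt(w_j w_(j+1)) |sinh ((1 - 2/p) z_j)|]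
over weights [w] of total mass [1], where [w_j = w_(j+1) exp (2 z_j)].  Since
[sinh (c z) / c] increases with [c] for [z > 0], this is strictly increasing in
[|1 - 2/p|]; equality of the norms therefore forces [|1 - 2/p| = |1 - 2/q|]. *)

(** * Inequalities for real powers *)

(** The isomorphism is not assumed to fix [u]. Its form does not matter, because the supremum
    defining the norm of F^q(Z) runs over all contractive representations of l^1(Z), including those
    in which [u] acts through an arbitrary image of the generator. Put D = u - u^-1. The numerical
    range bounds the norm of 1 + t D from below; the difficulty is a matching upper bound. If the
    numerical range is at most k, then 1 - t D shrinks no vector by more than the factor 1 - t k.
    Since (1 - t D)(1 + t D) = 1 - t^2 D^2 has norm at most 1 + 4 t^2, the norm of 1 + t D is at
    most (1 + 4 t^2) / (1 - t k). Let p be the exponent with the larger |1 - 2/p|, let l < 1 be the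
    ratio of |1 - 2/q| to |1 - 2/p|, and let C be the p-norm up to t^2. The map s -> s^(q/p) keeps
    the weights w, so the numerical range for q is at most l (C - 1) / t. Equal norms would give C -
    1 <= l (C - 1) + O(t^2), whereas C - 1 is at least a positive multiple of t. *)

Section Powers.
Context {R : realType}.
Implicit Types (a b p q t : R) (I : finType).

(** Young's inequality for [a] and [b ^ (p - 1)] with exponents [p] and [p / (p - 1)], rearranged.
    The second exponent degenerates at [p = 1], which is treated apart. *)
Lemma powR_tangent a b p : 0 <= a -> 0 <= b -> 1 <= p ->
  b `^ p + p * b `^ (p - 1) * (a - b) <= a `^ p.
Proof.
move=> a0 b0; rewrite le_eqVlt => /predU1P[<-|p1].
  by rewrite subrr !powRr0 !powRr1//; lra.
have p0 : 0 < p by lra.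
have q0 : 0 < p / (p - 1) by rewrite divr_gt0//; lra.
have pq : p^-1 + (p / (p - 1))^-1 = 1 by field; rewrite !gt_eqF//; lra.
have := conjugate_powR a0 (powR_ge0 b (p - 1)) p0 q0 pq.
rewrite -powRrM [(p - 1) * _]mulrC divfK ?gt_eqF//; last lra.
rewrite -(ler_pM2l p0) mulrDr [p * (_ / p)]mulrCA divff ?gt_eqF// mulr1.
have -> : p * (b `^ p / (p / (p - 1))) = (p - 1) * b `^ p.
  by field; rewrite !gt_eqF//; lra.
have := mulr_powRB1 b0 p0; set B := b `^ (p - 1); set C := b `^ p.
set A := a `^ p => bB; rewrite -!mulrA [B * _]mulrBr [B * b]mulrC bB.
rewrite !mulrBr !mulrA; have := bB; nra.
Qed.

Lemma ler_powR2 p a b : 0 <= p -> 0 <= a -> a <= b -> a `^ p <= b `^ p.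
Proof.
move=> p0 a0 ab; apply: ge0_ler_powR; rewrite ?nnegrE//.
exact: le_trans ab.
Qed.

Lemma ler_powR_inv p a b : 0 < p -> 0 <= a -> 0 <= b -> a `^ p <= b `^ p -> a <= b.
Proof.
move=> p0 a0 b0; apply: contraTT; rewrite -!ltNge => ba.
by apply: gt0_ltr_powR; rewrite ?nnegrE.
Qed.

Lemma powRV p a : 0 <= a -> (a^-1) `^ p = (a `^ p)^-1.
Proof. by move=> a0; rewrite -powR_inv1// powRAC powR_inv1 ?powR_ge0. Qed.

Lemma powRVK p a : p != 0 -> 0 <= a -> (a `^ p^-1) `^ p = a.
Proof. by move=> p0 a0; rewrite -powRrM mulVf// powRr1. Qed.

Lemma powRKV p a : p != 0 -> 0 <= a -> (a `^ p) `^ p^-1 = a.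
Proof. by move=> p0 a0; rewrite -powRrM mulfV// powRr1. Qed.

(** The weights are not normalised; their total mass enters through the power [p - 1]. *)
Lemma powR_jensen I (w : I -> R) (c : I -> R) p : 1 <= p ->
  (forall i, 0 <= w i) -> (forall i, 0 <= c i) ->
  (\sum_i w i * c i) `^ p <= (\sum_i w i) `^ (p - 1) * \sum_i w i * c i `^ p.
Proof.
move=> p1 w0 c0; set A := \sum_i w i; set S := \sum_i w i * c i.
have A0 : 0 <= A by exact: sumr_ge0.
have S0 : 0 <= S by apply: sumr_ge0 => i _; exact: mulr_ge0.
have pp : 0 < p by lra.
have [Az|An] := eqVneq A 0.
  have w_0 i : w i = 0.
    by apply/eqP; rewrite eq_le w0 -{1}Az /A (bigD1 i)//= lerDl sumr_ge0.
  have -> : S = 0 by rewrite /S big1// => i _; rewrite w_0 mul0r.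
  rewrite powR0 ?gt_eqF// mulr_ge0 ?powR_ge0// sumr_ge0// => i _.
  by rewrite mulr_ge0 ?powR_ge0.
have Ap : 0 < A by rewrite lt_def An.
set b := S / A; have b0 : 0 <= b by rewrite divr_ge0.
have -> : S = A * b by rewrite /b mulrC divfK.
rewrite powRM// -(mulr_powRB1 A0 pp) mulrC !mulrA mulrC ler_wpM2l ?powR_ge0//.
(* [b] is the weighted mean of the [c i], so the linear parts of the tangents at [b] cancel in the
   sum. *)
have -> : b `^ p * A = \sum_i w i * (b `^ p + p * b `^ (p - 1) * (c i - b)).
  under eq_bigr do rewrite mulrDr [_ * (_ * _)]mulrCA mulrBr.
  rewrite big_split/= -mulr_suml -/A mulrC -mulr_sumr sumrB -mulr_suml -/A -/S.
  by rewrite /b [A * (S / A)]mulrC divfK// subrr mulr0 addr0.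
by apply: ler_sum => i _; rewrite ler_wpM2l ?w0//; exact: powR_tangent.
Qed.

(* Hölder's inequality in disguise: the tangent inequality at [y i], applied to
   [z i / C], needs neither the dual exponent nor a case split on [p = 1]. *)
Lemma holder_bound I (y z : I -> R) p (C : R) : 1 <= p -> 0 < C ->
  (forall i, 0 <= y i) -> (forall i, 0 <= z i) ->
  \sum_i z i `^ p <= C `^ p * \sum_i y i `^ p ->
  \sum_i y i `^ (p - 1) * z i <= C * \sum_i y i `^ p.
Proof.
move=> p1 C0 y0 z0 zy; have p0 : 0 < p by lra.
have h : \sum_i (y i `^ p + p * y i `^ (p - 1) * (z i / C - y i)) <=
    \sum_i (z i / C) `^ p.
  apply: ler_sum => i _; apply: powR_tangent => //.
  by rewrite divr_ge0// ltW.
have e1 : \sum_i (z i / C) `^ p <= \sum_i y i `^ p.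
  under eq_bigr => i _ do rewrite powRM ?invr_ge0 ?(ltW C0)// powRV ?(ltW C0)//.
  rewrite -mulr_suml.
  by rewrite ler_pdivrMr ?powR_gt0// mulrC.
have e2 : \sum_i (y i `^ p + p * y i `^ (p - 1) * (z i / C - y i)) =
    \sum_i y i `^ p +
    p * ((\sum_i y i `^ (p - 1) * z i) / C - \sum_i y i `^ p).
  rewrite big_split/= mulr_suml -sumrB mulr_sumr; congr (_ + _).
  by apply: eq_bigr => i _; rewrite -(mulr_powRB1 (y0 i) p0); ring.
move: h; rewrite e2 => /le_trans/(_ e1); rewrite gerDl pmulr_rle0// subr_le0.
by rewrite ler_pdivrMr// mulrC.
Qed.

End Powers.

(** * Convolution operators on cycles and duality *)

Section Normc.
Context {R : realType}.
Implicit Types (x y z : R[i]) (p q : R).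

Lemma ReD x y : complex.Re (x + y) = complex.Re x + complex.Re y.
Proof. by case: x; case: y. Qed.

Lemma normc_sum (I : Type) (r : seq I) (P : pred I) (F : I -> R[i]) :
  normc (\sum_(i <- r | P i) F i) <= \sum_(i <- r | P i) normc (F i).
Proof.
elim/big_rec2: _ => [|i b a _ ab]; first by rewrite normc0.
by apply: (le_trans (le_normcD _ _)); rewrite lerD2l.
Qed.

Lemma normcR (a : R) : normc a%:C = `|a|.
Proof. by rewrite /normc /= expr0n/= addr0 sqrtr_sqr. Qed.

Lemma normc_conj z : normc z^* = normc z.
Proof. by case: z => a b; rewrite /= sqrrN. Qed.

Lemma mul_conjc z : z * z^* = (normc z ^+ 2)%:C.
Proof.
case: z => a b /=; rewrite sqr_sqrtr ?addr_ge0 ?sqr_ge0//.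
by apply/eqP; rewrite eq_complex /=; apply/andP; split; apply/eqP; ring.
Qed.

(* [z |z| ^ (q - 2)] conjugated: the function dual to [z] in the pairing of
   [L^q] with its dual. *)
Definition dualc q z : R[i] := z^* * (normc z `^ (q - 2))%:C.

Lemma mul_dualc q z : 0 < q -> z * dualc q z = (normc z `^ q)%:C.
Proof.
move=> q0; rewrite /dualc mulrA mul_conjc -rmorphM /=; congr _%:C.
have [->|z0] := eqVneq z 0; first by rewrite normc0 expr0n/= mul0r powR0 ?gt_eqF.
have n0 : normc z != 0 by apply: contra z0 => /eqP/eq0_normc ->.
by rewrite -powR_mulrn ?normc_ge0// -powRD ?n0 ?implybT//; congr (_ `^ _); lra.
Qed.

(** Only an inequality: at [z = 0] and [q = 1] the right-hand side is 0 to the power 0, that is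
    1. *)
Lemma normc_dualc_le q z : normc (dualc q z) <= normc z `^ (q - 1).
Proof.
rewrite /dualc normcM normc_conj normcR ger0_norm ?powR_ge0//.
have [->|z0] := eqVneq z 0; first by rewrite normc0 mul0r powR_ge0.
have n0 : normc z != 0 by apply: contra z0 => /eqP/eq0_normc ->.
rewrite -[X in X * _]powRr1 ?normc_ge0// -powRD ?n0 ?implybT//.
by rewrite (_ : 1 + (q - 2) = q - 1)//; lra.
Qed.

End Normc.

Section CyclicBounds.
Context {R : realType}.
Implicit Types (p q C : R) (c : nat -> R[i]) (d n : nat).

Definition powsum p (I : finType) (y : I -> R[i]) : R := \sum_i normc (y i) `^ p.

(** The polynomial with coefficients [c] in the shift [y -> y (_ + 1)]. The index type ['I_n.+2] is
    a nonzero ring, so indices wrap around the cycle. *)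
Definition cyc_op n d c (y : 'I_n.+2 -> R[i]) : 'I_n.+2 -> R[i] :=
  fun j => \sum_(k < d) c k * y (j + k%:R).

Definition cyc_bound p d c C := forall n (y : 'I_n.+2 -> R[i]),
  powsum p (cyc_op d c y) <= C `^ p * powsum p y.

Lemma powsum_ge0 p (I : finType) (y : I -> R[i]) : 0 <= powsum p y.
Proof. by apply: sumr_ge0 => i _; exact: powR_ge0. Qed.

(** The transpose of the operator is its conjugate by the reflection [j -> - j], so it obeys the
    same bound on l^p. Pairing [z] with its dual function [w] gives [powsum q z]; moving the
    operator onto [w] and applying Young's inequality produces a term [B / p] that is absorbed on
    the left. *)
Lemma cyc_bound_dual p q d c C : 1 < p -> 1 < q -> p^-1 + q^-1 = 1 -> 0 < C ->
  cyc_bound p d c C -> cyc_bound q d c C.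
Proof.
move=> p1 q1 pq C0 bp n y.
have p0 : 0 < p by lra.
have q0 : 0 < q by lra.
set z := cyc_op d c y; pose w j := dualc q (z j).
pose v i := cyc_op d c (fun j => w (- j)) (- i).
have E : (powsum q z)%:C = \sum_i y i * v i.
  rewrite /powsum rmorph_sum /=.
  transitivity (\sum_j \sum_(k < d) c k * y (j + k%:R) * w j).
    by apply: eq_bigr => j _; rewrite -mulr_suml -/(cyc_op d c y j) mul_dualc.
  rewrite exchange_big /=.
  transitivity (\sum_(k < d) \sum_j c k * y j * w (j - k%:R)).
    apply: eq_bigr => k _; rewrite [RHS](reindex_inj (addIr k%:R))/=.
    by apply: eq_bigr => j _; rewrite addrK.
  rewrite exchange_big /=; apply: eq_bigr => j _; rewrite mulr_sumr.
  apply: eq_bigr => k _; rewrite opprD opprK; ring.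
have vw : powsum p v <= C `^ p * powsum q z.
  rewrite (_ : powsum p v = powsum p (cyc_op d c (fun j => w (- j)))); last first.
    by rewrite /powsum [RHS](reindex_inj (@oppr_inj _)).
  apply: (le_trans (bp _ _)); rewrite ler_wpM2l ?powR_ge0//.
  rewrite /powsum [leRHS](reindex_inj (@oppr_inj _))/=.
  apply: ler_sum => j _.
  apply: le_trans (ler_powR2 (ltW p0) (normc_ge0 _) (normc_dualc_le _ _)) _.
  rewrite -powRrM (_ : (q - 1) * p = q)//.
  have : (p^-1 + q^-1) * (p * q) = p * q by rewrite pq mul1r.
  rewrite mulrDl mulrA mulVf ?gt_eqF// mulrCA mulVf ?gt_eqF//; lra.
have B0 := powsum_ge0 q z; set B := powsum q z in B0 E vw *.
have le : B <= C `^ q * powsum q y / q + B / p.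
  apply: (@le_trans _ _ (normc B%:C)); first by rewrite normcR ler_norm.
  rewrite E; apply: (le_trans (normc_sum _ _ _)).
  (* The factor [C] is shared out so that the bound [vw] turns the second sum into exactly
     [B / p]. *)
  apply: (@le_trans _ _ (\sum_i ((C * normc (y i)) `^ q / q + (normc (v i) / C) `^ p / p))).
    apply: ler_sum => i _; rewrite normcM addrC.
    have -> : normc (y i) * normc (v i) = (normc (v i) / C) * (C * normc (y i)).
      by field; rewrite gt_eqF.
    by apply: conjugate_powR => //; rewrite ?divr_ge0 ?mulr_ge0 ?normc_ge0// ltW.
  rewrite big_split /=; apply: lerD.
    rewrite -mulr_suml ler_pM2r ?invr_gt0// /powsum mulr_sumr.
    by apply: ler_sum => i _; rewrite powRM ?normc_ge0// ltW.
  rewrite -mulr_suml ler_pM2r ?invr_gt0//.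
  under eq_bigr => i _ do
    rewrite powRM ?normc_ge0 ?invr_ge0 ?(ltW C0)// powRV ?(ltW C0)//.
  rewrite -mulr_suml ler_pdivrMr ?powR_gt0// [leRHS]mulrC.
  exact: vw.
have hp : p^-1 = 1 - q^-1 by lra.
move: le; rewrite hp mulrBr mulr1 addrCA lerDl subr_ge0 ler_pM2r ?invr_gt0//.
Qed.

End CyclicBounds.

(** * The numerical range of [u - u^-1] *)

Section SinhComparison.
Context {R : realType}.
Implicit Types (p q : R).

(** The difference of the two sides vanishes at 0 and has derivative
    [2 g h (cosh (h x) - cosh (g x))], which is nonnegative. *)
Lemma expRB_sinh_le (g h x : R) : 0 <= g -> g <= h -> 0 <= x ->
  h * (expR (g * x) - expR (- (g * x))) <= g * (expR (h * x) - expR (- (h * x))).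
Proof.
move=> g0 gh x0.
pose F (x : R) := g * (expR (h * x) - expR (- h * x)) -
                  h * (expR (g * x) - expR (- g * x)).
pose F' (x : R) := g * h * (expR (h * x) + expR (- h * x) -
                  (expR (g * x) + expR (- g * x))).
have dF (y : R) : is_derive y 1 F (F' y).
  apply: is_derive_eq; rewrite /= /F' /GRing.scale /=; ring.
have F'0 y : 0 <= y -> 0 <= F' y.
  move=> y0; rewrite /F'.
  have -> : expR (h * y) + expR (- h * y) - (expR (g * y) + expR (- g * y)) =
      (expR (h * y) - expR (g * y)) * (1 - expR (- h * y - g * y)).
    rewrite mulrBl !mulrBr !mulr1 -!expRD.
    rewrite (_ : h * y + (- h * y - g * y) = - g * y); last by ring.
    rewrite (_ : g * y + (- h * y - g * y) = - h * y); last by ring.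
    by ring.
  apply: mulr_ge0; first by rewrite mulr_ge0// (le_trans g0).
  apply: mulr_ge0; first by rewrite subr_ge0 ler_expR ler_wpM2r.
  rewrite subr_ge0 -expR0 ler_expR -mulrBl mulr_le0_ge0//; lra.
have F0 : F 0 = 0 by rewrite /F !mulr0 expR0 subrr; ring.
have : F 0 <= F x.
  apply: (@ger0_derive1_ndecry _ F 0) => //.
  - by move=> y; rewrite in_itv/= derive1E derive_val => /andP[/ltW/F'0].
  - apply: derivable_within_continuous => y _; exact: (@ex_derive _ _ _ _ _ _ _ (dF y)).
by rewrite F0 /F subr_ge0 !mulNr.
Qed.

Lemma abs_expRB_le (g h x : R) : `|g| <= `|h| ->
  `|h| * `|expR (g * x) - expR (- (g * x))| <=
  `|g| * `|expR (h * x) - expR (- (h * x))|.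
Proof.
have E (k : R) : `|expR (k * x) - expR (- (k * x))| =
    expR (`|k| * `|x|) - expR (- (`|k| * `|x|)).
  rewrite -normrM; have [kx|kx] := lerP 0 (k * x).
    by rewrite (ger0_norm kx) ger0_norm// subr_ge0 ler_expR; lra.
  by rewrite (ltr0_norm kx) opprK distrC ger0_norm// subr_ge0 ler_expR; lra.
by move=> gh; rewrite !E; exact: expRB_sinh_le.
Qed.

(* Equal to [2 (a b) ^ (p / 2) |sinh ((1 - 2 / p) z)|] for [z = p ln (a / b) / 2]. *)
Definition skew_term p (a b : R) := a * b * `|a `^ (p - 2) - b `^ (p - 2)|.

Lemma skew_term_ge0 p a b : 0 <= a -> 0 <= b -> 0 <= skew_term p a b.
Proof. by move=> a0 b0; rewrite !mulr_ge0. Qed.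

Let skew_term_expR p (a b : R) : 0 < p -> 0 < a -> 0 < b ->
  skew_term p a b = expR (p * (ln a + ln b) / 2) *
   `|expR ((1 - 2 / p) * (p * (ln a - ln b) / 2)) -
     expR (- ((1 - 2 / p) * (p * (ln a - ln b) / 2)))|.
Proof.
move=> p0 a0 b0; rewrite -[X in _ = X * _]ger0_norm ?expR_ge0// -normrM mulrBr -!expRD.
rewrite /skew_term -[a in LHS]lnK ?posrE// -[b in LHS]lnK ?posrE//.
rewrite -expRD -[X in X * _]ger0_norm ?expR_ge0// -normrM mulrBr -!expRM -!expRD.
by congr `|expR _ - expR _|; field; rewrite gt_eqF.
Qed.

(** Raising to the power [q / p] turns p-th powers into q-th powers, so both terms have the same
    prefactor and the same [z]; only the factor [1 - 2 / p] inside sinh changes. Zero arguments are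
    separated because the exponential form takes logarithms. *)
Lemma skew_term_le p q a b : 1 <= p -> 1 <= q -> `|1 - 2 / q| <= `|1 - 2 / p| ->
  0 <= a -> 0 <= b ->
  `|1 - 2 / p| * skew_term q a b <=
  `|1 - 2 / q| * skew_term p (a `^ (q / p)) (b `^ (q / p)).
Proof.
move=> p1 q1 pq a0 b0; have p0 : 0 < p by lra.
have q0 : 0 < q by lra.
have qp : q / p != 0 by rewrite gt_eqF// divr_gt0.
move: a0; rewrite le_eqVlt => /predU1P[<-|a0].
  by rewrite powR0// /skew_term !mul0r !mulr0.
move: b0; rewrite le_eqVlt => /predU1P[<-|b0].
  by rewrite powR0// /skew_term mulr0 !mul0r !mulr0 mul0r mulr0.
rewrite !skew_term_expR ?powR_gt0// !ln_powR.
rewrite (_ : p * (q / p * ln a + q / p * ln b) / 2 = q * (ln a + ln b) / 2); last first.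
  by field; rewrite gt_eqF.
rewrite (_ : p * (q / p * ln a - q / p * ln b) / 2 = q * (ln a - ln b) / 2); last first.
  by field; rewrite gt_eqF.
rewrite mulrCA [leRHS]mulrCA ler_wpM2l ?expR_ge0//.
exact: abs_expRB_le.
Qed.

End SinhComparison.

(** * First-order bounds for 1 + t (u - u^-1) on cycles *)

Section CyclicSkew.
Context {R : realType}.
Implicit Types (p q C t : R) (n : nat).

(* Coefficients of [u * (1 + t (u - u^-1))]. *)
Definition skew_coef t : nat -> R[i] := nth 0 [:: (- t)%:C; 1; t%:C].

(* The point of the numerical range of [u - u^-1] given by [y], unnormalised. *)
Definition skew_form p n (y : 'I_n.+2 -> R[i]) : R :=
  \sum_j complex.Re ((y (j + 1) - y (j - 1)) * dualc p (y j)).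

(** The sum of the overview for the weights [w_j = s_j ^ p], on a cycle. *)
Definition skew_sum p n (s : 'I_n.+2 -> R) : R :=
  \sum_j skew_term p (s j) (s (j + 1)).

Let ReMr (z : R[i]) (a : R) : complex.Re (z * a%:C) = complex.Re z * a.
Proof. by case: z => x y /=; rewrite mulr0 subr0. Qed.

Let ReMl (z : R[i]) (a : R) : complex.Re (a%:C * z) = a * complex.Re z.
Proof. by rewrite mulrC ReMr mulrC. Qed.

Let Re_conjC (z w : R[i]) : complex.Re (z * w^*) = complex.Re (w * z^*).
Proof. by case: z w => a b [c d] /=; ring. Qed.

Let ReN (z : R[i]) : complex.Re (- z) = - complex.Re z.
Proof. by case: z. Qed.

(** Summation by parts: shifting the index in the terms with [y (j - 1)] collects both contributions
    of the edge from [j] to [j + 1]. They cancel at [p = 2], where [u - u^-1] is skew-adjoint. *)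
Lemma skew_formE p n (y : 'I_n.+2 -> R[i]) :
  skew_form p y = \sum_j complex.Re (y (j + 1) * (y j)^*) *
    (normc (y j) `^ (p - 2) - normc (y (j + 1)) `^ (p - 2)).
Proof.
rewrite /skew_form.
under eq_bigr do rewrite mulrBl ReD ReN.
rewrite big_split/= sumrN [X in _ - X](reindex_inj (addIr 1))/= -sumrB.
apply: eq_bigr => j _; rewrite addrK /dualc !mulrA !ReMr mulrBr; congr (_ - _).
by rewrite Re_conjC.
Qed.

Lemma skew_form_le p n (y : 'I_n.+2 -> R[i]) :
  `|skew_form p y| <= skew_sum p (fun j => normc (y j)).
Proof.
rewrite skew_formE; apply: (le_trans (ler_norm_sum _ _ _)).
apply: ler_sum => j _; rewrite normrM /skew_term ler_wpM2r//.
by apply: (le_trans (Re_le_normc _)); rewrite normcM normc_conj mulrC.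
Qed.

(** Evaluating at [j - 1] undoes the extra factor [u] in [skew_coef]. *)
Let cyc_op_skew t n (y : 'I_n.+2 -> R[i]) j :
  cyc_op 3 (skew_coef t) y (j - 1) = y j + t%:C * (y (j + 1) - y (j - 1)).
Proof.
rewrite /cyc_op !big_ord_recl big_ord0 /skew_coef /= addr0 addr0.
rewrite (_ : j - 1 + 1%:R = j); last by rewrite subrK.
rewrite (_ : j - 1 + 2%:R = j + 1); last by rewrite -[2%:R]/(1 + 1) addrA subrK.
by rewrite rmorphN mul1r; ring.
Qed.

Let powsum_shift p n (y : 'I_n.+2 -> R[i]) :
  powsum p (fun j => y (j - 1)) = powsum p y.
Proof. by rewrite /powsum [RHS](reindex_inj (addIr (- 1))). Qed.

(** Pairing the image of [y], shifted back, with the dual function of [y] yields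
    [powsum p y + t * skew_form p y]; by [holder_bound] this is at most [C * powsum p y]. *)
Lemma skew_form_lower p C t n (y : 'I_n.+2 -> R[i]) : 1 <= p -> 0 < C ->
  powsum p (cyc_op 3 (skew_coef t) y) <= C `^ p * powsum p y ->
  t * skew_form p y <= (C - 1) * powsum p y.
Proof.
move=> p1 C0 yC; have p0 : 0 < p by lra.
pose z j := cyc_op 3 (skew_coef t) y (j - 1).
rewrite -powsum_shift -/z in yC.
have := holder_bound p1 C0 (fun j => normc_ge0 (y j)) (fun j => normc_ge0 (z j)) yC.
rewrite mulrBl mul1r lerBrDl; apply: le_trans.
rewrite /powsum /skew_form mulr_sumr -big_split/=; apply: ler_sum => j _.
have -> : normc (y j) `^ p + t * complex.Re ((y (j + 1) - y (j - 1)) * dualc p (y j)) =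
    complex.Re (z j * dualc p (y j)).
  by rewrite /z cyc_op_skew [in RHS]mulrDl [in RHS]ReD mul_dualc// -mulrA ReMl.
apply: (le_trans (ler_norm _)); apply: (le_trans (Re_le_normc _)).
by rewrite normcM mulrC ler_wpM2r ?normc_ge0// normc_dualc_le.
Qed.

(* On a cycle the signs [e_j] cannot be prescribed independently; vanishing
   at [0] cuts the cycle open. *)
Lemma skew_form_signs p n (s : 'I_n.+2 -> R) : (forall j, 0 <= s j) -> s 0 = 0 ->
  exists y : 'I_n.+2 -> R[i], (forall j, normc (y j) = s j) /\
    skew_form p y = skew_sum p s.
Proof.
move=> s0 s00.
pose e (j : 'I_n.+2) : R := (-1) ^+ (s j `^ (p - 2) < s (j + 1) `^ (p - 2))%R.
(* Partial products: along the path the signs at [j] and [j + 1] multiply to [e j], the sign that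
   makes the term of this edge nonnegative. *)
pose sg (k : nat) : R := \prod_(i < k) e (inord i).
have e2 j : `|e j| = 1 by rewrite normrX normrN normr1 expr1n.
have sg1 k : `|sg k| = 1 by rewrite normr_prod big1// => i _; rewrite e2.
have sgsg k : sg k * sg k = 1.
  by rewrite -expr2 -real_normK ?num_real// sg1 expr1n.
have nE (j : 'I_n.+2) : normc (sg j * s j)%:C = s j.
  by rewrite normcR normrM sg1 mul1r ger0_norm.
exists (fun j : 'I_n.+2 => (sg j * s j)%:C); split => //.
rewrite skew_formE; apply: eq_bigr => j _; rewrite !nE.
(* The edge from the last point back to 0, where no sign relation holds, contributes nothing because
   [s 0 = 0]. *)
have [jn|jn] := ltnP j n.+1; last first.
  have -> : j + 1 = 0.
    apply/val_inj => /=; have -> : nat_of_ord j = n.+1.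
      by apply/eqP; rewrite eqn_leq jn -ltnS ltn_ord.
    by rewrite (modn_small (_ : 1 < n.+2)%N)// addn1 modnn.
  by rewrite ReMl /skew_term s00 !(mulr0, mul0r).
have -> : nat_of_ord (j + 1) = (j : nat).+1.
  by rewrite /= (modn_small (_ : 1 < n.+2)%N)// addn1 modn_small.
rewrite /sg big_ord_recr/= -/(sg j) inord_val.
rewrite oppr0 mulr0 subr0 /skew_term.
rewrite (_ : `|s j `^ (p - 2) - s (j + 1) `^ (p - 2)| =
   e j * (s j `^ (p - 2) - s (j + 1) `^ (p - 2))); last first.
  rewrite /e; have [lt|ge] := ltP (s j `^ (p - 2)) (s (j + 1) `^ (p - 2)).
    by rewrite expr1 mulN1r ltr0_norm// subr_lt0.
  by rewrite expr0 mul1r ger0_norm// subr_ge0.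
transitivity ((sg j * sg j) * (s j * s (j + 1) *
   (e j * (s j `^ (p - 2) - s (j + 1) `^ (p - 2))))); last by rewrite sgsg mul1r.
ring.
Qed.

(** The three vanishing conditions on [y] force the image [x] to vanish at 0, so that the bound on
    the numerical range applies to [x]. The factor [1 + 4 t^2] is the second-order price of passing
    from [1 - t D] to [1 + t D]. *)
Lemma skew_form_upper q k t n (y : 'I_n.+2 -> R[i]) : 1 <= q -> 0 <= t ->
  t * k < 1 ->
  (forall x : 'I_n.+2 -> R[i], x 0 = 0 -> skew_form q x <= k * powsum q x) ->
  y 0 = 0 -> y 1 = 0 -> y (- 1) = 0 ->
  powsum q (cyc_op 3 (skew_coef t) y) <=
    ((1 + 4 * t ^+ 2) / (1 - t * k)) `^ q * powsum q y.
Proof.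
move=> q1 t0 tk hk y0 y1 yN1; have q0 : 0 < q by lra.
pose x j := cyc_op 3 (skew_coef t) y (j - 1).
have xE j : x j = y j + t%:C * (y (j + 1) - y (j - 1)) by exact: cyc_op_skew.
have x0 : x 0 = 0 by rewrite xE y0 !add0r y1 yN1 subrr mulr0.
pose z j := x j - t%:C * (x (j + 1) - x (j - 1)).
have zE j : z j = (1 + 2 * t ^+ 2)%:C * y j + (- t ^+ 2)%:C * y (j + 2%:R)
   + (- t ^+ 2)%:C * y (j - 2%:R).
  rewrite (_ : j - 2%:R = j - 1 - 1); last by rewrite -addrA -opprD.
  rewrite /z !xE addrK subrK -[2%:R]/(1 + 1) opprD !addrA.
  by rewrite !(rmorphD, rmorphM, rmorphN, rmorphXn, rmorph1)/=; ring.
rewrite -powsum_shift -/x; set A := 1 - t * k; have A0 : 0 < A by rewrite /A; lra.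
have B0 : 0 < 1 + 4 * t ^+ 2 by have := sqr_ge0 t; lra.
have zy : powsum q z <= (1 + 4 * t ^+ 2) `^ q * powsum q y.
  (* Absolute values of the coefficients of [1 - t^2 D^2], and the shifts they belong to; their
     total is [1 + 4 t^2]. *)
  pose w (i : 'I_3) : R := nth 0 [:: 1 + 2 * t ^+ 2; t ^+ 2; t ^+ 2] i.
  pose sh (i : 'I_3) : 'I_n.+2 := nth 0 [:: 0; 2%:R; - 2%:R] i.
  have w0 i : 0 <= w i.
    by rewrite /w; case: i => -[|[|[|]]]//= _; have := sqr_ge0 t; lra.
  have ws : \sum_i w i = 1 + 4 * t ^+ 2.
    by rewrite !big_ord_recl big_ord0 /w /=; ring.
  have zw j : normc (z j) <= \sum_i w i * normc (y (j + sh i)).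
    rewrite zE !big_ord_recl big_ord0 /w /sh /= !addr0 [leRHS]addrA.
    apply: (le_trans (le_normcD _ _)); apply: lerD; last first.
      by rewrite normcM normcR normrN ger0_norm ?sqr_ge0.
    apply: (le_trans (le_normcD _ _)); apply: lerD; last first.
      by rewrite normcM normcR normrN ger0_norm ?sqr_ge0.
    by rewrite normcM normcR ger0_norm ?addr_ge0 ?mulr_ge0 ?sqr_ge0.
  apply: (@le_trans _ _ (\sum_j (\sum_i w i) `^ (q - 1) *
      \sum_i w i * normc (y (j + sh i)) `^ q)).
    apply: ler_sum => j _; apply: le_trans (powR_jensen _ _ _) => //; last first.
      by move=> i; exact: normc_ge0.
    by apply: ler_powR2 => //; [exact: ltW|exact: normc_ge0].
  rewrite -mulr_sumr exchange_big /=.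
  have -> : \sum_i \sum_j w i * normc (y (j + sh i)) `^ q = (\sum_i w i) * powsum q y.
    rewrite mulr_suml; apply: eq_bigr => i _; rewrite -mulr_sumr; congr (_ * _).
    by rewrite /powsum [RHS](reindex_inj (addIr (sh i))).
  by rewrite ws mulrA [_ `^ (q - 1) * _]mulrC mulr_powRB1// ltW.
(* Dissipativity of [D y = y (j + 1) - y (j - 1)], applied to [x = (1 + t D) y]
   and [z = (1 - t D) x = (1 - t ^ 2 D ^ 2) y]. *)
have xz : A `^ q * powsum q x <= powsum q z.
  have key C : 0 < C -> powsum q z <= C `^ q * powsum q x ->
      A * powsum q x <= C * powsum q x.
    move=> C0 zx.
    have := holder_bound q1 C0 (fun j => normc_ge0 (x j)) (fun j => normc_ge0 (z j)) zx.
    apply: le_trans; rewrite /A mulrBl mul1r -mulrA.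
    have tk' : t * skew_form q x <= t * (k * powsum q x) by rewrite ler_wpM2l// hk.
    apply: (@le_trans _ _ (powsum q x - t * skew_form q x)); first by rewrite lerD2l lerN2.
    rewrite /powsum /skew_form mulr_sumr -sumrB; apply: ler_sum => j _.
    have -> : normc (x j) `^ q - t * complex.Re ((x (j + 1) - x (j - 1)) * dualc q (x j)) =
      complex.Re (z j * dualc q (x j)).
      by rewrite /z [in RHS]mulrBl [in RHS]ReD ReN mul_dualc// -mulrA ReMl.
    apply: (le_trans (ler_norm _)); apply: (le_trans (Re_le_normc _)).
    by rewrite normcM mulrC ler_wpM2r ?normc_ge0// normc_dualc_le.
  have [->|xn] := eqVneq (powsum q x) 0; first by rewrite mulr0 powsum_ge0.
  have xp : 0 < powsum q x by rewrite lt_def xn powsum_ge0.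
  rewrite leNgt; apply/negP => zA.
  pose C0 := (powsum q z / powsum q x) `^ q^-1.
  have C00 : 0 <= C0 by exact: powR_ge0.
  have C0E : C0 `^ q = powsum q z / powsum q x.
    by rewrite powRVK ?gt_eqF// divr_ge0// powsum_ge0.
  have C0A : C0 < A.
    rewrite ltNge; apply/negP => AC; have := ler_powR2 (ltW q0) (ltW A0) AC.
    by rewrite C0E ler_pdivlMr// leNgt zA.
  (* [C0] is the exact ratio of the norms of [z] and [x] and may be 0, whereas [key] takes a
     positive constant; the midpoint is positive and still below [A]. *)
  have Ch : C0 <= (C0 + A) / 2 by lra.
  have Ch0 : 0 < (C0 + A) / 2 by lra.
  have := key _ Ch0; rewrite ler_pM2r//.
  have -> : (A <= (C0 + A) / 2) = false by apply/negP; lra.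
  suff -> : powsum q z <= ((C0 + A) / 2) `^ q * powsum q x by move/(_ isT).
  by rewrite -ler_pdivrMr// -C0E ler_powR2// ltW.
rewrite powRM ?invr_ge0 ?(ltW A0) ?(ltW B0)// powRV ?(ltW A0)// mulrAC.
by rewrite ler_pdivlMr ?powR_gt0// mulrC (le_trans xz).
Qed.

End CyclicSkew.

Section SkewComparison.
Context {R : realType}.
Implicit Types (p q C t : R) (n : nat).

Lemma skew_sum_bound p C t n (s : 'I_n.+2 -> R) : 1 <= p -> 0 < C -> 0 < t ->
  cyc_bound p 3 (skew_coef t) C -> (forall j, 0 <= s j) -> s 0 = 0 ->
  t * skew_sum p s <= (C - 1) * \sum_j s j `^ p.
Proof.
move=> p1 C0 t0 bC s0 s00; have [y [ys <-]] := skew_form_signs p s0 s00.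
apply: (le_trans (skew_form_lower p1 C0 (bC n y))).
rewrite le_eqVlt; apply/orP; left; apply/eqP; congr (_ * _).
by apply: eq_bigr => j _; rewrite ys.
Qed.

(** The weights 0, 1, 2 on a triangle suffice: the edge between the last two contributes
    [2 |1 - 2 ^ (p - 2)|], which is nonzero for [p != 2]. *)
Lemma skew_gap_pos p : 1 <= p -> p != 2 -> exists2 k : R, 0 < k &
  forall C t, 0 < C -> 0 < t -> cyc_bound p 3 (skew_coef t) C -> t * k <= C - 1.
Proof.
move=> p1 p2; pose s (j : 'I_3) : R := (j : nat)%:R.
have s0 j : 0 <= s j by [].
have P0 : 0 < \sum_j s j `^ p.
  rewrite (bigD1 1)//= ltr_pwDl//; first by rewrite powR_gt0.
  by rewrite sumr_ge0// => j _; exact: powR_ge0.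
have S0 : 0 < skew_sum p s.
  rewrite /skew_sum (bigD1 1)//= ltr_pwDl//.
    rewrite /skew_term !mulr_gt0// ?ltr0n// normr_gt0 subr_eq0 powR1.
    apply/eqP => /esym/eqP; rewrite powR_eq1; apply/negP.
    by rewrite !negb_or -leNgt ler0n subr_eq0 p2 andbT/= pnatr_eq1.
  by rewrite sumr_ge0// => j _; exact: skew_term_ge0.
exists (skew_sum p s / \sum_j s j `^ p); first exact: divr_gt0.
move=> C t C0 t0 bC; rewrite mulrA ler_pdivrMr//.
exact: skew_sum_bound bC _ _.
Qed.

(** [skew_form_upper] with [k = l (C - 1) / t]. To bound the q-form at [x], the p-bound is tested on
    [s = |x| ^ (q / p)], which has the same weights, and [skew_term_le] supplies the factor [l]. *)
Lemma cyc_bound_skew p q C t n (y : 'I_n.+2 -> R[i]) (l := `|1 - 2 / q| / `|1 - 2 / p|) :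
  1 <= p -> 1 <= q -> `|1 - 2 / q| < `|1 - 2 / p| -> 0 < C -> 0 < t ->
  cyc_bound p 3 (skew_coef t) C -> l * (C - 1) < 1 ->
  y 0 = 0 -> y 1 = 0 -> y (- 1) = 0 ->
  powsum q (cyc_op 3 (skew_coef t) y) <=
    ((1 + 4 * t ^+ 2) / (1 - l * (C - 1))) `^ q * powsum q y.
Proof.
move=> p1 q1 qp C0 t0 bC lC y0 y1 yN1.
have gp : 0 < `|1 - 2 / p| by exact: le_lt_trans qp.
have l0 : 0 <= l by rewrite divr_ge0.
have E : l * (C - 1) = t * (l * (C - 1) / t) by field; rewrite gt_eqF.
rewrite E in lC *; apply: skew_form_upper => //; first exact: ltW.
move=> x x0; pose s j := normc (x j) `^ (q / p).
have qp0 : q / p != 0 by rewrite gt_eqF// divr_gt0//; lra.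
have s0 j : 0 <= s j by exact: powR_ge0.
have s00 : s 0 = 0 by rewrite /s x0 normc0 powR0.
have := skew_sum_bound p1 C0 t0 bC s0 s00.
rewrite (_ : \sum_j s j `^ p = powsum q x); last first.
  by apply: eq_bigr => j _; rewrite -powRrM divfK// gt_eqF//; lra.
move=> h; apply: (@le_trans _ _ (l * skew_sum p s)); last first.
  rewrite [leRHS]mulrAC ler_pdivlMr// -[leLHS]mulrA -[leRHS]mulrA ler_wpM2l//.
  by rewrite [leLHS]mulrC.
apply: (le_trans (ler_norm _)); apply: (le_trans (skew_form_le _ _)).
rewrite /l mulrAC ler_pdivlMr// mulrC mulr_sumr /skew_sum mulr_sumr.
by apply: ler_sum => j _; apply: skew_term_le => //; rewrite ?normc_ge0 ?ltW.
Qed.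

End SkewComparison.

(** * Summation and [l^1(Z)] *)

Section Sums.
Context {R : realType}.
Implicit Types (T : choiceType).

Lemma rsum_ge0E T (u : T -> R) : (forall x, 0 <= u x) -> rsummable u ->
  rsum u = fine (\esum_(x in [set: T]) (u x)%:E)%E.
Proof.
move=> u0 su; rewrite -(eq_rsum (fun x => subr0 (u x))).
have s0 : rsummable (fun _ : T => 0 : R).
  by apply: le_rsummable su => x; rewrite normr0.
by rewrite rsumE// [X in _ - fine X]esum1// subr0.
Qed.

Lemma rsum_ge0 T (u : T -> R) : (forall x, 0 <= u x) -> rsummable u -> 0 <= rsum u.
Proof.
by move=> u0 su; rewrite rsum_ge0E// fine_ge0// esum_ge0// => x _; rewrite lee_fin.
Qed.

Lemma ler_rsum T (u v : T -> R) : (forall x, u x <= v x) ->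
  rsummable u -> rsummable v -> rsum u <= rsum v.
Proof.
move=> uv su sv; rewrite -subr_ge0 -rsumN// -rsumD//; last exact: rsummableN.
apply: rsum_ge0 => [x|]; first by rewrite subr_ge0.
by apply: rsummableD => //; exact: rsummableN.
Qed.

Lemma rsum0 T : rsum (fun _ : T => 0 : R) = 0.
Proof.
by rewrite /rsum !esum1 ?subrr// => x _; rewrite ?funeposE ?funenegE /= ?oppr0 maxxx.
Qed.

Lemma rsummable0 T : rsummable (fun _ : T => 0 : R).
Proof.
by rewrite /rsummable /summable esum1 ?ltry// => x _ /=; rewrite normr0.
Qed.

Lemma rsummable_sum T (I : Type) (r : seq I) (a : I -> T -> R) :
  (forall i, rsummable (a i)) -> rsummable (fun x => \sum_(i <- r) a i x).
Proof.
move=> sa; elim: r => [|i r ih].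
  rewrite (_ : (fun x => _) = (fun=> 0)); first exact: rsummable0.
  by apply/funext => x; rewrite big_nil.
rewrite (_ : (fun x => _) = (fun x => a i x + \sum_(i <- r) a i x)).
  exact: rsummableD.
by apply/funext => x; rewrite big_cons.
Qed.

Lemma rsum_sum T (I : Type) (r : seq I) (a : I -> T -> R) :
  (forall i, rsummable (a i)) ->
  rsum (fun x => \sum_(i <- r) a i x) = \sum_(i <- r) rsum (a i).
Proof.
move=> sa; elim: r => [|i r ih].
  by rewrite big_nil -[RHS](rsum0 T); apply: eq_rsum => x; rewrite big_nil.
rewrite big_cons -ih -rsumD//; last exact: rsummable_sum.
by apply: eq_rsum => x; rewrite big_cons.
Qed.

Lemma Re_csum T (u : T -> R[i]) : complex.Re (csum u) = rsum (fun x => complex.Re (u x)).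
Proof. by []. Qed.

(* Rotate the sum to the positive half-line and take real parts. *)
Lemma normc_csum T (u : T -> R[i]) : csummable u ->
  normc (csum u) <= rsum (fun x => normc (u x)).
Proof.
move=> su; set s := csum u.
have [->|s0] := eqVneq s 0.
  by rewrite normc0; apply: rsum_ge0 => // x; exact: normc_ge0.
have n0 : normc s != 0 by apply: contra s0 => /eqP/eq0_normc ->.
pose w : R[i] := s^* * (normc s)^-1%:C.
have nw : normc w = 1.
  by rewrite normcM normc_conj normcR ger0_norm ?invr_ge0 ?normc_ge0// mulfV.
have -> : normc s = complex.Re (csum (fun x => w * u x)).
  by rewrite csumZ// -/s /w mulrAC [s^* * s]mulrC mul_conjc -rmorphM /= expr2 mulfK.
rewrite Re_csum; apply: ler_rsum => //.
- move=> x; apply: (le_trans (ler_norm _)); apply: (le_trans (Re_le_normc _)).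
  by rewrite normcM nw mul1r.
- by have /csummableP[] := csummableZ w su.
Qed.

Lemma esum_single T (a : T -> \bar R) x0 : (forall x, x != x0 -> a x = 0%E) ->
  (0 <= a x0)%E -> (\esum_(x in [set: T]) a x = a x0)%E.
Proof.
move=> a0 ap; rewrite -(esum_set1 ap) (esum_mkcond [set x0]).
apply: eq_esum => k _; case: ifPn => // /negP kn0; apply: a0.
by apply/eqP => k0; apply: kn0; rewrite k0 inE.
Qed.

Lemma rsum_single T (u : T -> R) x0 : (forall x, x != x0 -> u x = 0) -> rsum u = u x0.
Proof.
move=> u0; rewrite /rsum !(@esum_single _ _ x0) ?funepos_ge0 ?funeneg_ge0//.
- by rewrite funeposE funenegE /= -!EFin_max /= -/(rpos _) -/(rneg _) -rposneg.
- by move=> k /u0 uk; rewrite ?funenegE ?funeposE /= uk ?oppr0 maxxx.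
- by move=> k /u0 uk; rewrite ?funenegE ?funeposE /= uk ?oppr0 maxxx.
Qed.

Lemma csum_single T (u : T -> R[i]) x0 : (forall x, x != x0 -> u x = 0) -> csum u = u x0.
Proof.
by move=> u0; rewrite /csum !(rsum_single (x0 := x0)); [case: (u x0)|move=> x /u0 ->..].
Qed.

Lemma csummable_single T (u : T -> R[i]) x0 : (forall x, x != x0 -> u x = 0) -> csummable u.
Proof.
move=> u0; rewrite /csummable /rsummable /summable (@esum_single _ _ x0)//.
  exact: ltry.
by move=> x /u0 /= ->; rewrite normc0 normr0.
Qed.

End Sums.

Section Ell1Facts.
Context {R : realType}.
Implicit Types (f g : ell1 R) (k : int).

Lemma ell1_normE f : ell1_norm f = rsum (fun k => normc (f k)).
Proof.
by rewrite rsum_ge0E//; [exact: (fun x => normc_ge0 (f x))|exact: ell1P].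
Qed.

Lemma ell1_norm_ge0 f : 0 <= ell1_norm f.
Proof. by rewrite ell1_normE; apply: rsum_ge0 => [x|]; [exact: normc_ge0|exact: ell1P]. Qed.

Lemma ell1_eq f g : (forall k, f k = g k) -> f = g.
Proof. by move=> fg; apply/val_inj/funext. Qed.

Lemma ell1_addE f g k : (f + g) k = f k + g k. Proof. by []. Qed.

Lemma ell1_oppE f k : (- f) k = - f k. Proof. by []. Qed.

Lemma ell1_scaleE (a : R[i]) f k : (a *: f) k = a * f k. Proof. by []. Qed.

Lemma ell1_mulE f g k : (f * g) k = Defs.conv f g k. Proof. by []. Qed.

Lemma ell1_sumE (I : Type) (r : seq I) (F : I -> ell1 R) k :
  (\sum_(i <- r) F i) k = \sum_(i <- r) F i k.
Proof. by elim/big_rec2: _ => // i b a _ <-. Qed.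

Lemma csummable_delta k : csummable (fun n : int => ((n == k)%:R : R[i])).
Proof. by apply: (@csummable_single _ _ _ k) => n /negPf ->. Qed.

Definition ell1_delta k : ell1 R := Ell1 (asboolT (csummable_delta k)).

Lemma ell1_deltaE k n : ell1_delta k n = (n == k)%:R. Proof. by []. Qed.

Lemma ell1_norm_delta k : ell1_norm (ell1_delta k) = 1.
Proof.
rewrite ell1_normE (rsum_single (x0 := k)) ?ell1_deltaE ?eqxx ?normc1// => n /negPf nk.
by rewrite ell1_deltaE nk normc0.
Qed.

Lemma ell1_deltaM k f n : (ell1_delta k * f) n = f (n - k).
Proof.
rewrite ell1_mulE /Defs.conv (csum_single (x0 := k)) => [|m /negPf mk].
  by rewrite ell1_deltaE eqxx mul1r.
by rewrite ell1_deltaE mk mul0r.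
Qed.

Lemma ell1_deltaD k l : ell1_delta k * ell1_delta l = ell1_delta (k + l).
Proof.
by apply: ell1_eq => n; rewrite ell1_deltaM !ell1_deltaE subr_eq addrC.
Qed.

Lemma ell1_delta0 : ell1_delta 0 = 1.
Proof. by apply: ell1_eq. Qed.

Lemma ell1_deltaX (m : nat) : ell1_delta 1 ^+ m = ell1_delta m%:Z.
Proof.
elim: m => [|m ih]; first by rewrite expr0 ell1_delta0.
by rewrite exprS ih ell1_deltaD; congr ell1_delta; rewrite -intS.
Qed.

Definition ell1_poly (d : nat) (c : nat -> R[i]) : ell1 R :=
  \sum_(k < d) c k *: ell1_delta 1 ^+ k.

(** Finitely supported functions are Laurent polynomials; a negative power of [u] is factored out to
    leave a polynomial, and [Fp_norm_deltaM] shows that this factor does not affect the norms. *)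
Lemma ell1_dense f (e : R) : 0 < e -> exists (K d : nat) (c : nat -> R[i]),
  ell1_norm (f - ell1_delta (- K%:Z) * ell1_poly d c) < e.
Proof.
move=> e0; have sf := ell1P f.
have fin := ge0_rsummable_fin (fun x => normc_ge0 (f x)) sf.
have nn x : (0 <= (normc (f x))%:E)%E by rewrite lee_fin normc_ge0.
have [_ [A [finA _] <-] hA] := @ub_ereal_sup_adherent _ _ e e0 fin.
have {}hA : (\esum_(x in [set: int]) (normc (f x))%:E - e%:E <
  \sum_(x \in A) (normc (f x))%:E)%E := hA.
have [K AK] : exists K : nat, forall x, A x -> (`|x|%N <= K)%N.
  have /finite_seqP[s ->] := finA; exists (\max_(i <- s) `|i|%N) => x /= xs.
  by apply: (@leq_bigmax_seq _ s xpredT (fun i : int => `|i|%N)).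
(* [2 K + 1] is the number of integers from [- K] to [K]. *)
exists K, (K.*2.+1), (fun m => f (m%:Z - K%:Z)).
pose B := [set x : int | (`|x|%N <= K)%N].
have gE n : (ell1_delta (- K%:Z) * ell1_poly K.*2.+1 (fun m => f (m%:Z - K%:Z))) n =
    if n \in B then f n else 0.
  rewrite ell1_deltaM opprK /ell1_poly ell1_sumE.
  under eq_bigr do rewrite ell1_scaleE ell1_deltaX ell1_deltaE.
  case: ifPn => [/set_mem nB|/negP nB].
    have h : (`|(n + K%:Z)%R|%N < K.*2.+1)%N by move: nB; rewrite /B /=; lia.
    rewrite (bigD1 (Ordinal h))//= big1 ?addr0.
      have -> : (`|(n + K%:Z)%R|%N)%:Z = n + K%:Z by move: nB; rewrite /B /=; lia.
      by rewrite eqxx mulr1 addrK.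
    move=> i /negP ih; case: eqP => [E|]; last by rewrite mulr0.
    by exfalso; apply: ih; apply/eqP/val_inj => /=; rewrite E.
  rewrite big1// => i _; case: eqP => [E|]; last by rewrite mulr0.
  exfalso; apply: nB; rewrite inE /B /=; have := ltn_ord i; lia.
rewrite /ell1_norm (@eq_esum _ _ _ _
  (fun n => if n \in ~` B then (normc (f n))%:E else 0%E)); last first.
  move=> n _; rewrite ell1_addE ell1_oppE gE in_setC.
  by case: ifPn => _ /=; rewrite ?subrr ?normc0// subr0.
rewrite -esum_mkcond; move: fin hA; rewrite (@esumID _ _ B setT)// !setTI => fin hA.
have hAB : (\sum_(x \in A) (normc (f x))%:E <= \esum_(x in B) (normc (f x))%:E)%E.
  by apply: esum_ge; exists A => //; split => // x /AK.
have := lt_le_trans hA hAB; move: fin.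
rewrite fin_numD => /andP[fB fC].
rewrite -(fineK fB) -(fineK fC); set b := fine _; set c := fine _.
by rewrite -[X in (X < _)%E]/((b + c - e)%:E) lte_fin /=; lra.
Qed.

End Ell1Facts.

(** * Transference *)

Section FpNormFacts.
Context {R : realType}.
Implicit Types (p q : R) (f g : ell1 R).

Lemma rep_le_Fp_norm p (E : completeNormedModType R[i]) (rho : ell1 R -> E -> E) f :
  separable_space E -> Lp_space p E -> contractive_rep rho ->
  opnorm (rho f) <= Fp_norm p f.
Proof.
by move=> sE lE cr; have [|//] := @Fp_valuesP R p f (opnorm (rho f)); exists E, rho.
Qed.

Lemma Fp_norm_le_ell1 p f : Fp_norm p f <= ell1_norm f.
Proof.
apply: Fp_norm_le; first exact: ell1_norm_ge0.
by move=> _ [E [rho [_ _ cr ->]]]; exact: rep_contractive.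
Qed.

Lemma Fp_normN p f : Fp_norm p (- f) = Fp_norm p f.
Proof. by rewrite -scaleN1r Fp_normZ normcN normc1 mul1r. Qed.

(** Both [ell1_delta k] and its inverse have norm at most 1. *)
Lemma Fp_norm_deltaM p k f : Fp_norm p (ell1_delta k * f) = Fp_norm p f.
Proof.
have le l g : Fp_norm p (ell1_delta l * g) <= Fp_norm p g.
  apply: (le_trans (Fp_normM _ _ _)); rewrite ler_piMl ?Fp_norm_ge0//.
  by rewrite (le_trans (Fp_norm_le_ell1 _ _))// ell1_norm_delta.
apply/eqP; rewrite eq_le le /=.
by apply: le_trans (le (- k) _); rewrite mulrA ell1_deltaD addNr ell1_delta0 mul1r.
Qed.

Lemma Fp_norm_le_poly p q :
  (forall d c, Fp_norm p (ell1_poly d c) <= Fp_norm q (ell1_poly d c)) ->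
  forall f, Fp_norm p f <= Fp_norm q f.
Proof.
move=> h f; apply/ler_addgt0Pr => e e0.
have e2 : 0 < e / 2 by lra.
have [K [d [c fe]]] := ell1_dense f e2.
set g := ell1_delta (- K%:Z) * ell1_poly d c in fe.
have gpq : Fp_norm p g <= Fp_norm q g by rewrite !Fp_norm_deltaM.
have h1 := Fp_normD p (f - g) g; rewrite subrK in h1.
have h2 := Fp_normD q (- (f - g)) f; rewrite opprB subrK -opprB Fp_normN in h2.
have h3 := Fp_norm_le_ell1 p (f - g); have h4 := Fp_norm_le_ell1 q (f - g).
lra.
Qed.

End FpNormFacts.

Section RepFacts.
Context {R : realType} (E : normedModType R[i]) (rho : ell1 R -> E -> E).
Hypothesis cr : contractive_rep rho.
Implicit Types (f g : ell1 R) (x y : E).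

Lemma rep0 x : rho 0 x = 0.
Proof.
have := rep_linear cr 1 0 0 x; rewrite !scale1r addr0 -[LHS]addr0.
by move=> /addrI.
Qed.

Lemma repZ (a : R[i]) f x : rho (a *: f) x = a *: rho f x.
Proof. by have := rep_linear cr a f 0 x; rewrite rep0 !addr0. Qed.

Lemma repD f g x : rho (f + g) x = rho f x + rho g x.
Proof. by have := rep_linear cr 1 f g x; rewrite !scale1r. Qed.

Lemma repB f g x : rho (f - g) x = rho f x - rho g x.
Proof. by rewrite -scaleN1r repD repZ scaleN1r. Qed.

Lemma rep_sum (I : Type) (r : seq I) (F : I -> ell1 R) x :
  rho (\sum_(i <- r) F i) x = \sum_(i <- r) rho (F i) x.
Proof.
elim: r => [|i r ih]; first by rewrite !big_nil rep0.
by rewrite !big_cons repD ih.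
Qed.

Lemma rep_le f x : rnorm (rho f x) <= ell1_norm f * rnorm x.
Proof.
apply: (le_trans (le_opnorm _ (rep_bounded cr f))).
by rewrite ler_wpM2r ?rnorm_ge0// rep_contractive.
Qed.

End RepFacts.

Section ComplexLp.
Context {R : realType} d (X : measurableType d) (mu : {measure set X -> \bar R}).
Local Open Scope ereal_scope.

Lemma measurable_normc (f : X -> R[i]) :
  measurable_fun [set: X] (fun x => complex.Re (f x)) ->
  measurable_fun [set: X] (fun x => complex.Im (f x)) ->
  measurable_fun [set: X] (fun x => normc (f x)).
Proof.
move=> mr mi.
rewrite (_ : (fun x => _) =
  (fun x => ((complex.Re (f x)) ^+ 2 + (complex.Im (f x)) ^+ 2) `^ 2^-1)%R).
  apply: (measurableT_comp (measurable_realfun.measurable_powR 2^-1)).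
  by apply: measurable_realfun.measurable_funD; exact: measurable_realfun.measurable_funX.
apply/funext => x; rewrite powR12_sqrt ?addr_ge0 ?sqr_ge0//.
by case: (f x).
Qed.

Lemma measurable_normc_powR p (f : X -> R[i]) : complex_Lp mu p f ->
  measurable_fun [set: X] (fun x => (normc (f x) `^ p)%:E).
Proof.
move=> [mr mi _]; apply/measurable_EFinP.
exact: (measurableT_comp (measurable_realfun.measurable_powR p) (measurable_normc mr mi)).
Qed.

Lemma Lnorm_normcE p (f : X -> R[i]) : p != 0%R ->
  Lnorm mu p%:E (fun x => (normc (f x))%:E) `^ p =
  \int[mu]_x (normc (f x) `^ p)%:E.
Proof.
move=> p0; rewrite (powR_Lnorm mu _ p0); apply: eq_integral => x _.
by rewrite abse_EFin ger0_norm ?normc_ge0.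
Qed.

Lemma complex_LpP p (f : X -> R[i]) : (0 < p)%R ->
  measurable_fun [set: X] (fun x => complex.Re (f x)) ->
  measurable_fun [set: X] (fun x => complex.Im (f x)) ->
  complex_Lp mu p f <-> \int[mu]_x (normc (f x) `^ p)%:E < +oo.
Proof.
move=> p0 mr mi; rewrite -Lnorm_normcE ?gt_eqF//; split=> [[_ _ fp]|fp].
  by apply: poweR_lty.
by split=> //; apply: lty_poweRy fp; rewrite gt_eqF.
Qed.

Lemma complex_LpZD p (a : R[i]) (f g : X -> R[i]) : (1 <= p)%R ->
  complex_Lp mu p f -> complex_Lp mu p g -> complex_Lp mu p (a *: f + g)%R.
Proof.
move=> p1 lf lg; have p0 : (0 < p)%R by lra.
have [mrf mif _] := lf; have [mrg mig _] := lg.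
have mr : measurable_fun [set: X] (fun x => complex.Re ((a *: f + g)%R x)).
  rewrite (_ : (fun x => _) = (fun x => complex.Re a * complex.Re (f x) -
     complex.Im a * complex.Im (f x) + complex.Re (g x))%R); last first.
    apply/funext => x; rewrite -[(a *: f + g)%R x]/(a * f x + g x)%R.
    by case: a (f x) (g x) => ? ? [? ?] [? ?].
  apply: measurable_realfun.measurable_funD => //.
  apply: measurable_realfun.measurable_funB.
    exact: measurable_realfun.measurable_funM.
  exact: measurable_realfun.measurable_funM.
have mi : measurable_fun [set: X] (fun x => complex.Im ((a *: f + g)%R x)).
  rewrite (_ : (fun x => _) = (fun x => complex.Re a * complex.Im (f x) +
     complex.Im a * complex.Re (f x) + complex.Im (g x))%R); last first.
    apply/funext => x; rewrite -[(a *: f + g)%R x]/(a * f x + g x)%R; clear mr.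
    by case: a (f x) (g x) => ? ? [? ?] [? ?].
  apply: measurable_realfun.measurable_funD => //.
  apply: measurable_realfun.measurable_funD.
    exact: measurable_realfun.measurable_funM.
  exact: measurable_realfun.measurable_funM.
apply/(complex_LpP p0 mr mi).
(* The constant of [powR_jensen] for two terms with weights [normc a] and 1. *)
pose K := ((normc a + 1) `^ (p - 1))%R.
have K0 : (0 <= K)%R by exact: powR_ge0.
have fp0 (h : X -> R[i]) x : 0 <= (normc (h x) `^ p)%:E by rewrite lee_fin powR_ge0.
apply: (@le_lt_trans _ _ (\int[mu]_x (K%:E * ((normc a)%:E * (normc (f x) `^ p)%:E +
    (normc (g x) `^ p)%:E)))).
  apply: ge0_le_integral => //.
  - apply/measurable_EFinP.
    exact: (measurableT_comp (measurable_realfun.measurable_powR p) (measurable_normc mr mi)).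
  - apply/measurable_EFinP; apply: measurable_realfun.measurable_funM => //.
    apply: measurable_realfun.measurable_funD; last first.
      by apply/measurable_EFinP; exact: measurable_normc_powR lg.
    apply: measurable_realfun.measurable_funM => //.
    by apply/measurable_EFinP; exact: measurable_normc_powR lf.
  - move=> x _; rewrite lee_fin -[(a *: f + g)%R x]/(a * f x + g x)%R.
    pose w (i : bool) : R := if i then normc a else 1%R.
    pose v (i : bool) : R := if i then normc (f x) else normc (g x).
    have := @powR_jensen R _ w v p p1; rewrite !big_bool /= !mul1r => h.
    apply: (le_trans _ (h _ _)); last 2 first.
    + by case; rewrite /w ?normc_ge0.
    + by case; rewrite /v ?normc_ge0.
    apply: ler_powR2; rewrite ?normc_ge0 ?(ltW p0)//.
    by rewrite -normcM; exact: le_normcD.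
rewrite ge0_integralZl_EFin//; last 2 first.
- by move=> x _; rewrite adde_ge0// mule_ge0// lee_fin normc_ge0.
- apply/measurable_EFinP; apply: measurable_realfun.measurable_funD; last first.
    by apply/measurable_EFinP; exact: measurable_normc_powR lg.
  apply: measurable_realfun.measurable_funM => //.
  by apply/measurable_EFinP; exact: measurable_normc_powR lf.
rewrite ge0_integralD//; last 3 first.
- by move=> x _; rewrite mule_ge0// lee_fin normc_ge0.
- apply/measurable_EFinP; apply: measurable_realfun.measurable_funM => //.
  by apply/measurable_EFinP; exact: measurable_normc_powR lf.
- exact: measurable_normc_powR lg.
rewrite ge0_integralZl_EFin ?normc_ge0//; last exact: measurable_normc_powR lf.
have /(complex_LpP p0 mrf mif) lf' := lf; have /(complex_LpP p0 mrg mig) lg' := lg.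
have a0 : 0 <= (normc a)%:E by rewrite lee_fin normc_ge0.
apply: lte_mul_pinfty; [by rewrite lee_fin|by []|].
by apply: lte_add_pinfty lg'; exact: lte_mul_pinfty lf'.
Qed.

Lemma complex_Lp0 p : (1 <= p)%R -> complex_Lp mu p (0 : X -> R[i])%R.
Proof.
move=> p1; have p0 : (0 < p)%R by lra.
apply/complex_LpP => //; rewrite (eq_integral (fun=> 0)) ?integral0 ?ltry// => x _.
by rewrite -[(0 : X -> R[i])%R x]/(0 : R[i])%R normc0 powR0 ?gt_eqF.
Qed.

End ComplexLp.

Section Transference.
Context {R : realType}.
Implicit Types (p q C : R) (c : nat -> R[i]) (m N : nat).

(** A bound on finite windows: [N] consecutive outputs involve only [N + m] inputs. In this form it
    applies pointwise to a sequence of functions. *)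
Definition path_bound p m c C := forall N (y : nat -> R[i]),
  \sum_(j < N) normc (\sum_(k < m) c k * y (j + k)%N) `^ p <=
  C `^ p * \sum_(j < N + m) normc (y j) `^ p.

(** Dividing by [N] and letting it grow; in [transference] this makes the [m] surplus terms at the
    end of the window negligible, which is where amenability of Z enters. *)
Lemma ler_natr_affine (a b e : R) :
  (forall N, N%:R * a <= b * (N%:R + e)) -> a <= b.
Proof.
move=> h; rewrite leNgt; apply/negP => ba.
have [N hN] : exists N : nat, b * e / (a - b) < N%:R.
  exists (Num.bound `|b * e / (a - b)|); apply: le_lt_trans (ler_norm _) _.
  exact: archi_boundP.
by move: hN; rewrite ltr_pdivrMr ?subr_gt0//; have := h N; lra.
Qed.

(** Choose functions representing the orbit [rho (u ^ k) x], apply the path bound to their values at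
    each point of the measure space, and integrate. Each of the [N] outputs has norm at least that
    of [rho (ell1_poly m c) x], and each of the [N + m] inputs at most 1. *)
Lemma transference p m c C (E : completeNormedModType R[i]) (rho : ell1 R -> E -> E)
    (x : E) : 1 <= p -> 0 < C -> Lp_space p E -> contractive_rep rho ->
  path_bound p m c C -> rnorm x <= 1 -> rnorm (rho (ell1_poly m c) x) <= C.
Proof.
move=> p1 C0 [d [X [mu [Pi [PiL PiN PiS]]]]] cr bC x1.
have p0 : 0 < p by lra.
pose u (k : nat) := ell1_delta 1 ^+ k : ell1 R.
have /choice[g gP] : forall k : nat, exists g : X -> R[i],
    complex_Lp mu p g /\ Pi g = rho (u k) x.
  by move=> k; have [g gl ge] := PiS (rho (u k) x); exists g.
have Pi0 : Pi 0 = 0.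
  have l0 := complex_Lp0 mu p1; have := PiL 1 0 0 l0 l0.
  by rewrite scaler0 scale1r addr0 -[LHS]addr0 => /addrI.
(* Built from the chosen [g], so that the identity with the path operator holds at every point and
   not just almost everywhere. *)
pose h (j n : nat) : X -> R[i] := \sum_(k < n) c k *: g (j + k)%N.
have hP j n : complex_Lp mu p (h j n) /\ Pi (h j n) = \sum_(k < n) c k *: rho (u (j + k)%N) x.
  elim: n => [|n [ihl ihe]].
    by rewrite /h !big_ord0; split=> //; exact: complex_Lp0.
  rewrite /h !big_ord_recr /= addrC -/(h j n); have [gl ge] := gP (j + n)%N.
  split; first exact: complex_LpZD.
  by rewrite PiL// ihe ge addrC.
set v := rho _ x.
(* [rho 1] may differ from the identity, so [v] is recovered from its translate by cancelling the
   powers of [u] inside [ell1]. *)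
have vh j : rnorm v <= rnorm (Pi (h j m)).
  rewrite (hP j m).2.
  have -> : \sum_(k < m) c k *: rho (u (j + k)%N) x =
      rho (ell1_delta 1 ^+ j * ell1_poly m c) x.
    rewrite /ell1_poly mulr_sumr (rep_sum cr); apply: eq_bigr => k _.
    by rewrite -scalerAr (repZ cr) -exprD.
  have -> : v = rho (ell1_delta (- j%:Z)) (rho (ell1_delta 1 ^+ j * ell1_poly m c) x).
    rewrite -(rep_mul cr) mulrA ell1_deltaX ell1_deltaD addNr.
    by rewrite ell1_delta0 mul1r.
  by apply: (le_trans (rep_le cr _ _)); rewrite ell1_norm_delta mul1r.
have PiI f : complex_Lp mu p f ->
    (\int[mu]_x (normc (f x) `^ p)%:E = (rnorm (Pi f) `^ p)%:E)%E.
  by move=> fl; rewrite -Lnorm_normcE ?gt_eqF// -PiN.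
have key N : N%:R * rnorm v `^ p <= C `^ p * (N%:R + m%:R).
  rewrite -lee_fin.
  apply: (@le_trans _ _ (\sum_(j < N) (rnorm (Pi (h j m)) `^ p)%:E)%E).
    rewrite sumEFin lee_fin mulr_natl -[X in _ *+ X]card_ord -sumr_const.
    by apply: ler_sum => j _; rewrite ler_powR2 ?(ltW p0) ?rnorm_ge0.
  rewrite (eq_bigr (fun j : 'I_N => \int[mu]_x (normc (h j m x) `^ p)%:E)%E); last first.
    by move=> j _; rewrite PiI//; exact: (hP _ _).1.
  rewrite -ge0_integral_sum//; last 2 first.
  - by move=> j; apply: measurable_normc_powR; exact: (hP _ _).1.
  - by move=> j y _; rewrite lee_fin powR_ge0.
  apply: (@le_trans _ _ (\int[mu]_x ((C `^ p)%:E *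
      \sum_(j < N + m) (normc (g j x) `^ p)%:E))%E).
    apply: ge0_le_integral => //.
    - by move=> y _; rewrite sume_ge0// => j _; rewrite lee_fin powR_ge0.
    - apply: emeasurable_sum => j; apply: measurable_normc_powR; exact: (hP _ _).1.
    - apply: emeasurable_funM => //; apply: emeasurable_sum => j.
      by apply: measurable_normc_powR; exact: (gP _).1.
    - move=> y _; rewrite !sumEFin -EFinM lee_fin.
      apply: le_trans (bC N (fun k => g k y)); rewrite le_eqVlt; apply/orP; left.
      apply/eqP; apply: eq_bigr => j _; congr (normc _ `^ p).
      by rewrite /h fct_sumE.
  rewrite ge0_integralZl_EFin ?powR_ge0//; last 2 first.
  - by move=> y _; rewrite sume_ge0// => j _; rewrite lee_fin powR_ge0.
  - by apply: emeasurable_sum => j; apply: measurable_normc_powR; exact: (gP _).1.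
  rewrite ge0_integral_sum//; last 2 first.
  - by move=> j; apply: measurable_normc_powR; exact: (gP _).1.
  - by move=> j y _; rewrite lee_fin powR_ge0.
  rewrite EFinM lee_wpmul2l ?lee_fin ?powR_ge0//.
  rewrite (eq_bigr (fun j : 'I_(N + m) => (rnorm (rho (u j) x) `^ p)%:E)%E); last first.
    by move=> j _; rewrite PiI ?(gP _).2//; exact: (gP _).1.
  rewrite sumEFin lee_fin -natrD -[X in _ <= X%:R]card_ord -sumr_const.
  apply: ler_sum => j _; apply: (@le_trans _ _ (1 `^ p)); last by rewrite powR1.
  rewrite ler_powR2 ?rnorm_ge0 ?(ltW p0)//.
  apply: (le_trans (rep_le cr _ _)).
  by rewrite /u ell1_deltaX ell1_norm_delta mul1r.
apply: (@ler_powR_inv _ p); rewrite ?rnorm_ge0 ?(ltW C0)//.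
exact: ler_natr_affine key.
Qed.

Lemma Fp_norm_transference p m c C : 1 <= p -> 0 < C -> path_bound p m c C ->
  Fp_norm p (ell1_poly m c) <= C.
Proof.
move=> p1 C0 bC; apply: Fp_norm_le; first exact: ltW.
move=> _ [E [rho [sE lE cr ->]]]; apply: opnorm_le => x x1.
exact: transference bC x1.
Qed.

Lemma val_ord_natr n (k : nat) : (k%:R : 'I_n.+2) = (k %% n.+2)%N :> nat.
Proof.
elim: k => [|k ih]; first by rewrite mod0n.
by rewrite mulrSr /= ih (modn_small (_ : 1 < n.+2)%N)// modnDml addn1.
Qed.

(* A path is placed on a longer cycle; the vanishing conditions at [0], [1]
   and [-1] can be met by leaving room around it. *)
Lemma cyc_path_bound p m c C : 0 < p ->
  (forall n (y : 'I_n.+2 -> R[i]), y 0 = 0 -> y 1 = 0 -> y (- 1) = 0 ->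
    powsum p (cyc_op m c y) <= C `^ p * powsum p y) ->
  path_bound p m c C.
Proof.
move=> p0 h N y; pose n := (N + m).+1.
(* On a cycle of [N + m + 3] points the path occupies 2 to [N + m + 1]; the points 0, 1 and
   [N + m + 2], which is [-1], stay free. *)
pose Y (i : nat) : R[i] := if (1 < i < (N + m).+2)%N then y (i - 2)%N else 0.
have Y0 : Y n.+1 = 0 by rewrite /Y ltnn andbF.
have -> : \sum_(j < N + m) normc (y j) `^ p = powsum p (fun i : 'I_n.+2 => Y i).
  have E i : Y i = 0 -> normc (Y i) `^ p = 0 by move=> ->; rewrite normc0 powR0 ?gt_eqF.
  rewrite /powsum -(big_mkord xpredT (fun i => normc (Y i) `^ p)) /n.
  rewrite big_nat_recl// big_nat_recl// big_nat_recr// big_mkord.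
  rewrite (E 0%N)// (E n.+1)// !add0r [RHS]addr0; apply: eq_bigr => j _.
  by rewrite /Y /= !ltnS ltn_ord subn2.
apply: le_trans (h n (fun i => Y i) _ _ _) => //; last first.
  rewrite (_ : nat_of_ord (-1 : 'I_n.+2) = n.+1)// /=.
  by rewrite (modn_small (_ : 1 < n.+2)%N)// subn1 modn_small.
have hN (j : 'I_N) : (j.+2 < n.+2)%N by have := ltn_ord j; rewrite /n; lia.
pose e (j : 'I_N) : 'I_n.+2 := Ordinal (hN j).
have ei : injective e by move=> i j /(congr1 val) /= [] /val_inj.
(* Only the [N] outputs whose windows lie inside the path are kept; the others are nonnegative. *)
rewrite /powsum (bigID (mem [set e j | j in [set: 'I_N]%SET]%SET)) /=.
rewrite big_imset /=; last by move=> i j _ _; exact: ei.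
apply: ler_wpDr; first by rewrite sumr_ge0// => i _; exact: powR_ge0.
rewrite le_eqVlt; apply/orP; left; apply/eqP.
apply: eq_big => [j|j _]; first by rewrite finset.in_setT.
congr (normc _ `^ p); apply: eq_bigr => k _; congr (_ * _).
have kn : (k < n.+2)%N by have := ltn_ord k; rewrite /n; lia.
have jk : (j + k < N + m)%N by have := ltn_ord j; have := ltn_ord k; lia.
have -> : nat_of_ord (e j + k%:R) = (j + k).+2.
  rewrite /= val_ord_natr (modn_small kn) !addSn modn_small//.
  by rewrite /n; lia.
by rewrite /Y !ltnS jk subn2.
Qed.

End Transference.

(** * [l^p] of a cycle *)

Section LpCycle.
Context {R : realType} (n : nat) (p : R) (p1 : 1 <= p).
Implicit Types (x y : 'I_n.+2 -> R[i]).

Let p0 : 0 < p. Proof. exact: lt_le_trans ltr01 p1. Qed.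
Let pn0 : p != 0. Proof. by rewrite gt_eqF. Qed.

Definition lpnorm x : R := powsum p x `^ p^-1.

Lemma lpnorm_ge0 x : 0 <= lpnorm x. Proof. exact: powR_ge0. Qed.

Lemma lpnormK x : lpnorm x `^ p = powsum p x.
Proof. by rewrite powRVK// powsum_ge0. Qed.

Lemma normc_le_lpnorm x j : normc (x j) <= lpnorm x.
Proof.
apply: (@ler_powR_inv _ p); rewrite ?normc_ge0 ?lpnorm_ge0//.
rewrite lpnormK /powsum (bigD1 j)//= lerDl sumr_ge0// => i _.
exact: powR_ge0.
Qed.

Lemma lpnorm_le x (e : R) : 0 <= e -> (forall j, normc (x j) <= e) ->
  lpnorm x <= n.+2%:R * e.
Proof.
move=> e0 xe; apply: (@ler_powR_inv _ p); rewrite ?lpnorm_ge0 ?mulr_ge0//.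
rewrite lpnormK powRM//; apply: (@le_trans _ _ (n.+2%:R * e `^ p)).
  rewrite mulr_natl -[X in _ *+ X]card_ord -sumr_const; apply: ler_sum => j _.
  by rewrite ler_powR2 ?normc_ge0 ?xe ?(ltW p0).
by rewrite ler_wpM2r ?powR_ge0// le1r_powR// ler1n.
Qed.

Lemma lpnorm_eq0 x : lpnorm x = 0 -> x = 0.
Proof.
move=> x0; apply/funext => j; apply/eq0_normc/eqP.
by rewrite eq_le normc_ge0 andbT -x0 normc_le_lpnorm.
Qed.

Lemma lpnormZ (c : R[i]) x : lpnorm (c *: x) = normc c * lpnorm x.
Proof.
rewrite /lpnorm (_ : powsum p (c *: x) = normc c `^ p * powsum p x).
  by rewrite powRM ?powR_ge0 ?powsum_ge0// powRKV// normc_ge0.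
rewrite /powsum mulr_sumr; apply: eq_bigr => j _.
by rewrite -[(c *: x) j]/(c * x j) normcM powRM ?normc_ge0.
Qed.

(** Minkowski's inequality: at each coordinate, [powR_jensen] for the normalised vectors with the
    two norms as weights. *)
Lemma powsumD_le x y (a b : R) : 0 < a -> 0 < b ->
  powsum p x = a `^ p -> powsum p y = b `^ p -> powsum p (x + y) <= (a + b) `^ p.
Proof.
move=> a0 b0 xa yb.
have unit z c : 0 < c -> powsum p z = c `^ p -> \sum_j (normc (z j) / c) `^ p = 1.
  move=> c0 zc; have ci : 0 <= c^-1 by rewrite invr_ge0 ltW.
  under eq_bigr => j _ do rewrite powRM ?normc_ge0// powRV ?(ltW c0)//.
  by rewrite -mulr_suml -/(powsum p z) zc mulfV// gt_eqF// powR_gt0.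
apply: (@le_trans _ _ (\sum_j (a + b) `^ (p - 1) *
    (a * (normc (x j) / a) `^ p + b * (normc (y j) / b) `^ p))).
  apply: ler_sum => j _.
  pose w (i : bool) : R := if i then a else b.
  pose v (i : bool) : R := if i then normc (x j) / a else normc (y j) / b.
  have := @powR_jensen R _ w v p p1; rewrite !big_bool /= => h.
  apply: (le_trans _ (h _ _)); last 2 first.
  - by case; exact: ltW.
  - by case; rewrite divr_ge0 ?normc_ge0// ltW.
  have -> : a * (normc (x j) / a) = normc (x j) by rewrite mulrC divfK// gt_eqF.
  have -> : b * (normc (y j) / b) = normc (y j) by rewrite mulrC divfK// gt_eqF.
  by apply: ler_powR2; [exact: ltW|exact: normc_ge0|exact: le_normcD].
rewrite -mulr_sumr big_split/= -!mulr_sumr !unit// !mulr1.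
by rewrite mulrC mulr_powRB1// addr_ge0// ltW.
Qed.

Lemma lpnormD x y : lpnorm (x + y) <= lpnorm x + lpnorm y.
Proof.
have [/eqP x0|xn] := boolP (lpnorm x == 0).
  by rewrite x0 (lpnorm_eq0 x0) !add0r.
have [/eqP y0|yn] := boolP (lpnorm y == 0).
  by rewrite y0 (lpnorm_eq0 y0) !addr0.
have a0 : 0 < lpnorm x by rewrite lt_def xn lpnorm_ge0.
have b0 : 0 < lpnorm y by rewrite lt_def yn lpnorm_ge0.
apply: (ler_powR_inv p0 (lpnorm_ge0 _) (addr_ge0 (ltW a0) (ltW b0))).
rewrite lpnormK; exact: powsumD_le a0 b0 (esym (lpnormK x)) (esym (lpnormK y)).
Qed.

End LpCycle.

(** The exponent and the proof of [1 <= p] are parameters of the type, so that the norm can be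
    inferred from the type. *)
Definition lp_cycle (R : realType) (n : nat) (p : R) (p1 : 1 <= p) : Type :=
  'I_n.+2 -> R[i].

Section LpCycleSpace.
Context {R : realType} (n : nat) (p : R) (p1 : 1 <= p).
Local Notation E := (lp_cycle n p1).
Implicit Types x y : E.

HB.instance Definition _ := GRing.Lmodule.copy E ('I_n.+2 -> R[i]).

Let normD x y : (lpnorm p (x + y))%:C <= (lpnorm p x)%:C + (lpnorm p y)%:C.
Proof. by rewrite -rmorphD lecR lpnormD. Qed.

Let normZ (k : R[i]) x : (lpnorm p (k *: x))%:C = `|k| * (lpnorm p x)%:C.
Proof. by rewrite lpnormZ// -[`|k|]/((normc k)%:C) -rmorphM. Qed.

Let norm0 x : (lpnorm p x)%:C = 0 -> x = 0.
Proof. by move=> /eqP; rewrite eq_complex /= eqxx andbT => /eqP/(lpnorm_eq0 p1). Qed.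

HB.instance Definition _ := Lmodule_isNormed.Build R[i] E normD normZ norm0.

Lemma lp_cycle_normE x : `|x| = (lpnorm p x)%:C. Proof. by []. Qed.

Lemma lp_cycle_rnormE x : rnorm x = lpnorm p x. Proof. by []. Qed.

Lemma complex_gt0_real (e : R[i]) : 0 < e -> exists2 r : R, 0 < r & r%:C < e.
Proof.
case: e => u w; rewrite ltcE /= => /andP[/eqP w0 u0]; exists (u / 2); first lra.
by rewrite ltcE /= w0 eqxx /=; lra.
Qed.

Lemma ball_lp_cycle x y (r : R) : ball x r%:C y <-> lpnorm p (x - y) < r.
Proof. by rewrite -ball_normE /= lp_cycle_normE ltcR. Qed.

Let coord_lim (F : set_system E) (h : R[i] -> R) (j : 'I_n.+2) :
  ProperFilter F -> cauchy F -> (forall z w, `|h z - h w| <= normc (z - w)) ->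
  exists l : R, forall e : R, 0 < e -> F [set x : E | `|l - h (x j)| < e].
Proof.
move=> PF Fc hh; pose g (x : E) := h (x j).
have : cvg (g @ F).
  apply: cauchy_cvg; apply: cauchy_exP => e e0.
  have /(_ e%:C) := (@cauchyP _ E F PF).1 Fc; rewrite ltcR => /(_ e0)[x Fx].
  exists (g x); suff : F [set y | ball (g x) e (g y)] by [].
  apply: filterS Fx => y /ball_lp_cycle xy.
  rewrite /= -ball_normE /= /g; apply: le_lt_trans xy; apply: (le_trans (hh _ _)).
  exact: (normc_le_lpnorm p1 (x - y) j).
move=> /cvg_ex[l gl]; exists l => e e0.
by have /cvgrPdist_lt/(_ e e0) := gl.
Qed.

Let complete (F : set_system E) : ProperFilter F -> cauchy F -> cvg F.
Proof.
move=> PF Fc.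
have hRe (z w : R[i]) : `|complex.Re z - complex.Re w| <= normc (z - w).
  by case: z w => a b [c d]; exact: (Re_le_normc ((a - c) +i* (b - d))).
have hIm (z w : R[i]) : `|complex.Im z - complex.Im w| <= normc (z - w).
  by case: z w => a b [c d]; exact: (Im_le_normc ((a - c) +i* (b - d))).
have /choice[lr hr] := fun j => @coord_lim F _ j PF Fc hRe.
have /choice[li hi] := fun j => @coord_lim F _ j PF Fc hIm.
pose l : E := fun j => lr j +i* li j.
apply/cvg_ex; exists l; apply/cvg_ballP => e e0.
have [r r0 re] := complex_gt0_real e0.
(* Real and imaginary parts within [s / 2] put each coordinate within [s], hence by [lpnorm_le] the
   vector within [n.+2 * s = r / 2]. *)
pose s := r / (n.+2%:R * 2); have s0 : 0 < s by rewrite divr_gt0// mulr_gt0.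
have : \forall x \near F, forall j : 'I_n.+2,
    `|lr j - complex.Re (x j)| < s / 2 /\ `|li j - complex.Im (x j)| < s / 2.
  apply: filter_forall => j.
  by apply: filterI; [apply: hr|apply: hi]; rewrite divr_gt0.
apply: filterS => x xl; apply: (@le_ball _ _ _ r%:C e); first exact: ltW.
apply/ball_lp_cycle; apply: (@le_lt_trans _ _ (n.+2%:R * s)).
  apply: lpnorm_le => //; first exact: ltW.
  move=> j; have [h1 h2] := xl j; apply: (le_trans (normc_le_ReIm _)).
  rewrite (splitr s) -[(l - x) j]/(l j - x j) /l.
  by case: (x j) h1 h2 => a b /= h1 h2; rewrite lerD// ltW.
rewrite /s invfM mulrCA !mulrA mulfK ?pnatr_eq0//.
by rewrite ltr_pdivrMr//; lra.
Qed.

HB.instance Definition _ := Uniform_isComplete.Build E complete.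

Lemma lp_cycle_separable : separable_space E.
Proof.
pose g (t : {ffun 'I_n.+2 -> rat * rat}) : E := fun j => ratr (t j).1 +i* ratr (t j).2.
exists (range g); split.
  exact: (sub_countable (card_image_le _ _) (countableP _)).
move=> O [a Oa] oO; have := open_nbhs_nbhs (conj oO Oa).
rewrite -nbhs_ballE => -[e /= e0 aO]; have [r r0 re] := complex_gt0_real e0.
pose s := r / (n.+2%:R * 2); have s0 : 0 < s by rewrite divr_gt0// mulr_gt0.
have approx (z : R) : exists t : rat, `|z - ratr t| <= s / 2.
  have [t] : exists t, ratr t \in `]z - s / 2, z + s / 2[.
    by apply: rat_in_itvoo; lra.
  by rewrite in_itv /= => /andP[h1 h2]; exists t; rewrite ler_norml; lra.
have /choice[tr htr] := fun j => approx (complex.Re (a j)).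
have /choice[ti hti] := fun j => approx (complex.Im (a j)).
pose t := [ffun j => (tr j, ti j)]; exists (g t); split; last by exists t.
apply: aO; apply: (@le_ball _ _ _ r%:C e); first exact: ltW.
apply/ball_lp_cycle; apply: (@le_lt_trans _ _ (n.+2%:R * s)).
  apply: lpnorm_le => //; first exact: ltW.
  move=> j; have h1 := htr j; have h2 := hti j.
  apply: (le_trans (normc_le_ReIm _)).
  rewrite (splitr s) -[(a - g t) j]/(a j - g t j) /g ffunE.
  by case: (a j) h1 h2 => u v /= h1 h2; rewrite lerD.
rewrite /s invfM mulrCA !mulrA mulfK ?pnatr_eq0//.
by rewrite ltr_pdivrMr//; lra.
Qed.

End LpCycleSpace.

Section CountingUpTo.
Context {R : realType} (N : nat).

(** A measure on all of [nat]: values at [N] and beyond form a null set, so its L^p-space is l^p of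
    [N] points. *)
Definition counting_below : set nat -> \bar R :=
  msum (fun k : nat => \d_k : {measure set nat -> \bar R}) N.

HB.instance Definition _ := Measure.on counting_below.

Let finite_counting_below : fin_num_fun counting_below.
Proof.
move=> A mA; rewrite /counting_below /msum; apply/sum_fin_numP => k _ _.
exact: fin_num_measure.
Qed.

HB.instance Definition _ :=
  Measure_isFinite.Build _ _ _ counting_below finite_counting_below.

Lemma integral_counting_below (f : nat -> \bar R) : (forall k, 0 <= f k)%E ->
  (\int[counting_below]_k f k = \sum_(k < N) f k)%E.
Proof.
move=> f0; rewrite /counting_below ge0_integral_measure_sum//.
by apply: eq_bigr => k _; rewrite integral_dirac// diracT mul1e.
Qed.

End CountingUpTo.

(** * The representation of l^1(Z) on l^p of a cycle *)

Section LpCycleRep.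
Context {R : realType} (n : nat) (p : R) (p1 : 1 <= p).
Local Notation E := (lp_cycle n p1).
Implicit Types (x y : E) (f g : ell1 R).

Lemma lp_cycle_Lp_space : Lp_space p E.
Proof.
have p0 : 0 < p by exact: lt_le_trans ltr01 p1.
pose Pi (f : nat -> R[i]) : E := fun j => f j.
exists _, nat, (counting_below n.+2), Pi; split.
- by [].
- move=> f lf; rewrite lp_cycle_rnormE unlock /Lnorm.
  rewrite integral_counting_below; last by move=> k; exact: poweR_ge0.
  rewrite /lpnorm /powsum -poweR_EFin -sumEFin; congr (_ `^ _)%E.
  apply: eq_bigr => j _; rewrite abse_EFin ger0_norm ?normc_ge0//.
- move=> x; exists (fun k => if (k < n.+2)%N then x (inord k) else 0); last first.
    by apply/funext => j; rewrite /Pi ltn_ord inord_val.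
  split=> //; rewrite unlock /Lnorm.
  rewrite integral_counting_below; last by move=> k; exact: poweR_ge0.
  by under eq_bigr do rewrite abse_EFin poweR_EFin; rewrite sumEFin poweR_EFin ltry.
Qed.

Lemma csummable_bounded f (b : int -> R[i]) (M : R) :
  (forall k, normc (b k) <= M) -> csummable (fun k => f k * b k).
Proof.
move=> bM; have M0 : 0 <= M by apply: le_trans (bM 0); exact: normc_ge0.
apply: le_rsummable (rsummableZ M (ell1P f)) => k.
rewrite normcM [leLHS]ger0_norm ?mulr_ge0 ?normc_ge0//.
by rewrite ger0_norm ?mulr_ge0 ?normc_ge0// mulrC ler_wpM2r ?normc_ge0.
Qed.

Definition cycle_rep f x : E := fun j => csum (fun k : int => f k * x (j + k%:~R)).

Let bnd x j : normc (x j) <= lpnorm p x. Proof. exact: normc_le_lpnorm. Qed.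

Lemma csummable_cycle f x (j : 'I_n.+2) : csummable (fun k : int => f k * x (j + k%:~R)).
Proof. by apply: csummable_bounded => k; exact: bnd. Qed.

Lemma cycle_rep_linear (c : R[i]) f g x :
  cycle_rep (c *: f + g) x = c *: cycle_rep f x + cycle_rep g x.
Proof.
apply/funext => j; rewrite -[RHS]/(c * cycle_rep f x j + cycle_rep g x j) /cycle_rep.
transitivity (csum (fun k : int => c * (f k * x (j + k%:~R)) + g k * x (j + k%:~R))).
  by apply: eq_csum => k; rewrite ell1_addE ell1_scaleE mulrDl mulrA.
rewrite (csumD (csummableZ c (csummable_cycle f x j)) (csummable_cycle g x j)).
by rewrite (csumZ c (csummable_cycle f x j)).
Qed.

Lemma cycle_rep_linear_r f : linear (cycle_rep f).
Proof.
move=> c x y; apply/funext => j.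
rewrite -[RHS]/(c * cycle_rep f x j + cycle_rep f y j) /cycle_rep.
transitivity (csum (fun k : int => c * (f k * x (j + k%:~R)) + f k * y (j + k%:~R))).
  apply: eq_csum => k; rewrite -[(c *: x + y) _]/(c * x (j + k%:~R) + y (j + k%:~R)).
  by ring.
rewrite (csumD (csummableZ c (csummable_cycle f x j)) (csummable_cycle f y j)).
by rewrite (csumZ c (csummable_cycle f x j)).
Qed.

Let shift_bij (k : int) : bijective (fun m : int => m - k).
Proof. by exists (fun m => m + k) => m; rewrite ?subrK ?addrK. Qed.

Lemma cycle_rep_mul f g x : cycle_rep (f * g) x = cycle_rep f (cycle_rep g x).
Proof.
apply/funext => j; rewrite /cycle_rep.
transitivity (csum (fun m : int => csum (fun k : int => f k * g (m - k) * x (j + m%:~R)))).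
  apply: eq_csum => m; rewrite ell1_mulE /Defs.conv mulrC -csumZ; last first.
    by apply: csummable_convrow; exact: ell1P.
  by apply: eq_csum => k; rewrite mulrC.
rewrite csum_exchange.
  apply: eq_csum => k.
  transitivity (csum (fun m : int => f k * (g (m - k) * x (j + k%:~R + (m - k)%:~R)))).
    by apply: eq_csum => m; rewrite mulrA -addrA -intrD [k + _]addrC subrK.
  rewrite csumZ; last first.
    apply: (reindex_csummable (u := fun l : int => g l * x (j + k%:~R + l%:~R)) (shift_bij k)).
    exact: csummable_cycle.
  by rewrite (reindex_csum (fun l : int => g l * x (j + k%:~R + l%:~R)) (shift_bij k)).
(* Domination over pairs for [csum_exchange]: [x] is bounded and the sheared product of [f] and [g]
   is summable. *)
have h := rsummableZ (lpnorm p x) (csummable_shear (ell1P f) (ell1P g)).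
apply: le_rsummable h => -[m k] /=.
rewrite normcM [leLHS]ger0_norm ?mulr_ge0 ?normc_ge0//.
rewrite ger0_norm ?mulr_ge0 ?normc_ge0 ?lpnorm_ge0// mulrC.
by rewrite ler_wpM2r ?normc_ge0.
Qed.

(** [powR_jensen] with the infinite family of weights [normc (f k)]; the bound [M] ensures that all
    the sums converge. *)
Lemma powR_rsum_jensen f (v : int -> R) (M : R) : (forall k, 0 <= v k <= M) ->
  (rsum (fun k => normc (f k) * v k)) `^ p <=
  ell1_norm f `^ (p - 1) * rsum (fun k => normc (f k) * v k `^ p).
Proof.
move=> vM; have p0 : 0 < p by exact: lt_le_trans ltr01 p1.
have sf : rsummable (fun k => normc (f k)) := ell1P f.
have v0 k : 0 <= v k by have /andP[] := vM k.
have M0 : 0 <= M by have /andP[/le_trans h /h] := vM 0.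
have sM (b : int -> R) (K : R) : (forall k, `|b k| <= K) ->
    rsummable (fun k => normc (f k) * b k).
  move=> bK; have K0 : 0 <= K by apply: le_trans (bK 0).
  apply: le_rsummable (rsummableZ K sf) => k.
  rewrite !normrM (ger0_norm K0) mulrC ler_wpM2r ?normr_ge0//.
have sv : rsummable (fun k => normc (f k) * v k).
  by apply: (sM _ M) => k; rewrite ger0_norm//; have /andP[] := vM k.
have svp : rsummable (fun k => normc (f k) * v k `^ p).
  apply: (sM _ (M `^ p)) => k; rewrite ger0_norm ?powR_ge0//.
  by apply: ler_powR2 => //; [exact: ltW|have /andP[] := vM k].
set S := rsum (fun k => normc (f k) * v k); set A := ell1_norm f.
have A0 : 0 <= A by exact: ell1_norm_ge0.
have S0 : 0 <= S by apply: rsum_ge0 => // k; rewrite mulr_ge0 ?normc_ge0.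
have [Az|An] := eqVneq A 0.
  have SM : S <= M * A.
    rewrite /A ell1_normE -rsumZ//; apply: ler_rsum => //; last exact: rsummableZ.
    by move=> k; rewrite mulrC ler_wpM2r ?normc_ge0//; have /andP[] := vM k.
  have -> : S = 0 by apply/eqP; rewrite eq_le S0 andbT (le_trans SM)// Az mulr0.
  rewrite powR0 ?gt_eqF// mulr_ge0 ?powR_ge0// rsum_ge0// => k.
  by rewrite mulr_ge0 ?powR_ge0 ?normc_ge0.
have Ap : 0 < A by rewrite lt_def An.
set b := S / A; have b0 : 0 <= b by rewrite divr_ge0.
have SE : S = A * b by rewrite /b mulrC divfK.
rewrite SE powRM// -(mulr_powRB1 A0 p0) -mulrA mulrCA ler_wpM2l ?powR_ge0//.
have -> : A * b `^ p = rsum (fun k => (b `^ p - p * b `^ (p - 1) * b) * normc (f k) +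
    p * b `^ (p - 1) * (normc (f k) * v k)).
  rewrite rsumD; [|exact: rsummableZ|exact: rsummableZ].
  by rewrite !rsumZ// -ell1_normE -/A -/S SE; ring.
apply: ler_rsum => //.
  move=> k; have := ler_wpM2l (normc_ge0 (f k)) (powR_tangent (v0 k) b0 p1).
  by apply: le_trans; rewrite le_eqVlt; apply/orP; left; apply/eqP; ring.
by apply: rsummableD; exact: rsummableZ.
Qed.

(** Jensen's inequality at each coordinate, then summation over the cycle, where translation leaves
    [powsum p x] unchanged. *)
Lemma cycle_rep_powsum f x :
  powsum p (cycle_rep f x) <= ell1_norm f `^ p * powsum p x.
Proof.
have p0 : 0 < p by exact: lt_le_trans ltr01 p1.
have sf : rsummable (fun k => normc (f k)) := ell1P f.
have vb (j : 'I_n.+2) (k : int) : 0 <= normc (x (j + k%:~R)) <= lpnorm p x.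
  by rewrite normc_ge0 bnd.
apply: (@le_trans _ _ (\sum_j ell1_norm f `^ (p - 1) *
    rsum (fun k : int => normc (f k) * normc (x (j + k%:~R)) `^ p))).
  apply: ler_sum => j _; apply: le_trans (powR_rsum_jensen f (vb j)).
  apply: ler_powR2; [exact: ltW|exact: normc_ge0|].
  apply: (le_trans (normc_csum (csummable_cycle f x j))).
  by rewrite le_eqVlt; apply/orP; left; apply/eqP/eq_rsum => k; rewrite normcM.
rewrite -mulr_sumr -rsum_sum; last first.
  move=> j; apply: le_rsummable (rsummableZ (lpnorm p x `^ p) sf) => k.
  rewrite !ger0_norm ?mulr_ge0 ?powR_ge0 ?normc_ge0// mulrC.
  by rewrite ler_wpM2r ?normc_ge0// ler_powR2 ?normc_ge0 ?(ltW p0)// bnd.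
rewrite (@eq_rsum _ _ _ (fun k => powsum p x * normc (f k))); last first.
  move=> k; rewrite -mulr_sumr mulrC; congr (_ * _).
  by rewrite /powsum [RHS](reindex_inj (addIr k%:~R)).
rewrite rsumZ// -ell1_normE [powsum p x * _]mulrC mulrA [_ `^ _ * _]mulrC.
by rewrite mulr_powRB1// ell1_norm_ge0.
Qed.

Lemma cycle_rep_le f x : rnorm (cycle_rep f x) <= ell1_norm f * rnorm x.
Proof.
have p0 : 0 < p by exact: lt_le_trans ltr01 p1.
rewrite !lp_cycle_rnormE.
apply: (ler_powR_inv p0 (lpnorm_ge0 _ _)).
  by apply: mulr_ge0; [exact: ell1_norm_ge0|exact: lpnorm_ge0].
rewrite powRM; [|exact: ell1_norm_ge0|exact: lpnorm_ge0].
have := cycle_rep_powsum f x.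
by rewrite -(lpnormK p1 x) -(lpnormK p1 (cycle_rep f x)).
Qed.

Lemma cycle_rep_contractive : contractive_rep cycle_rep.
Proof.
have bd f : bounded_operator (cycle_rep f).
  split; first exact: cycle_rep_linear_r.
  by exists (ell1_norm f) => x; exact: cycle_rep_le.
split.
- exact: bd.
- exact: cycle_rep_linear.
- exact: cycle_rep_mul.
- move=> f; apply: opnorm_le => x x1; apply: (le_trans (cycle_rep_le f x)).
  by rewrite ler_piMr// ell1_norm_ge0.
Qed.

Lemma cycle_rep_poly m (c : nat -> R[i]) x :
  cycle_rep (ell1_poly m c) x = cyc_op m c x.
Proof.
rewrite /ell1_poly (rep_sum cycle_rep_contractive); apply/funext => j.
rewrite fct_sumE /cyc_op; apply: eq_bigr => k _.
rewrite (repZ cycle_rep_contractive).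
rewrite -[(c k *: _) j]/(c k * cycle_rep (ell1_delta 1 ^+ k) x j); congr (_ * _).
rewrite /cycle_rep ell1_deltaX (csum_single (x0 := k%:Z)).
  by rewrite ell1_deltaE eqxx mul1r.
by move=> l /negPf lk; rewrite ell1_deltaE lk mul0r.
Qed.

End LpCycleRep.

(** The converse of transference: the actions on cycles are among the representations over which the
    supremum is taken. *)
Lemma cyc_bound_Fp_norm (R : realType) (p : R) m (c : nat -> R[i]) (C : R) : 1 <= p ->
  Fp_norm p (ell1_poly m c) <= C -> cyc_bound p m c C.
Proof.
move=> p1 hC n y; have p0 : 0 < p by exact: lt_le_trans ltr01 p1.
pose x : lp_cycle n p1 := y.
have cr := @cycle_rep_contractive R n p p1.
have le : lpnorm p (cyc_op m c y) <= C * lpnorm p y.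
  rewrite -(cycle_rep_poly m c x).
  apply: (le_trans (le_opnorm x (rep_bounded cr (ell1_poly m c)))).
  rewrite lp_cycle_rnormE ler_wpM2r ?lpnorm_ge0//; apply: le_trans hC.
  by apply: rep_le_Fp_norm; [exact: lp_cycle_separable|exact: lp_cycle_Lp_space|].
have C0 : 0 <= C by apply: le_trans hC; exact: Fp_norm_ge0.
rewrite -(lpnormK p1 y) -(lpnormK p1 (cyc_op m c y)).
rewrite -(powRM p C0 (lpnorm_ge0 p y)).
exact: ler_powR2 (ltW p0) (lpnorm_ge0 p (cyc_op m c y)) le.
Qed.

(** * Universality *)

Section Extension.
Context {R : realType} (q : R) (B : banach_algebra R[i]) (iota : ell1 R -> B).
Hypothesis iotaL : linear iota.
Hypothesis iotaM : forall f g, iota (f * g) = banach_mul (iota f) (iota g).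
Hypothesis iotaN : forall f, rnorm (iota f) = Fp_norm q f.
Hypothesis iota_dense : forall (a : B) (e : R), 0 < e ->
  exists f, rnorm (a - iota f) < e.
Implicit Types (a b : B) (f g h : ell1 R).

Let iotaB f g : iota f - iota g = iota (f - g).
Proof. by have := iotaL (-1) g f; rewrite !scaleN1r addrC => <-; rewrite addrC. Qed.

Let iota0 : iota 0 = 0.
Proof. by rewrite -(subrr 0) -iotaB subrr. Qed.

Lemma rnormB_sym (V : normedModType R[i]) (x y : V) : rnorm (x - y) = rnorm (y - x).
Proof. by rewrite /rnorm distrC. Qed.

Lemma rnormN (V : normedModType R[i]) (x : V) : rnorm (- x) = rnorm x.
Proof. by rewrite /rnorm normrN. Qed.

Lemma rnorm_dist (V : normedModType R[i]) (x y z : V) :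
  rnorm (x - z) <= rnorm (x - y) + rnorm (y - z).
Proof. by rewrite -[x - z](subrKA y) rnormD. Qed.

(** The restriction [e < 1] serves products of two approximations, where it keeps the error linear
    in [e]. *)
Lemma ler_add_small (x y K : R) : 0 <= K ->
  (forall e, 0 < e -> e < 1 -> x <= y + K * e) -> x <= y.
Proof.
move=> K0 h; apply/ler_addgt0Pr => e e0.
pose d := Num.min (e / (K + 1)) 2^-1.
have K1 : 0 < K + 1 by lra.
have d0 : 0 < d by rewrite lt_min divr_gt0//= invr_gt0.
have d1 : d < 1 by rewrite gt_min; apply/orP; right; lra.
apply: (le_trans (h d d0 d1)); rewrite lerD2l.
apply: (@le_trans _ _ ((K + 1) * d)); first by rewrite ler_wpM2r ?(ltW d0)//; lra.
have : d <= e / (K + 1) by rewrite ge_min lexx.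
by rewrite ler_pdivlMr// mulrC.
Qed.

Lemma rnorm_cauchy_cvg (E : completeNormedModType R[i]) (v : nat -> E) :
  (forall e : R, 0 < e -> exists n, forall i j, (n <= i)%N -> (n <= j)%N ->
     rnorm (v i - v j) < e) ->
  exists y, forall e : R, 0 < e -> exists n, forall i, (n <= i)%N -> rnorm (y - v i) < e.
Proof.
move=> vc; have : cvg (v @ \oo).
  apply: cauchy_cvg; apply: cauchy_exP => e e0.
  have [r r0 re] := complex_gt0_real e0; have [n vn] := vc r r0.
  exists (v n); exists n => // i /= ni; rewrite -ball_normE /=; apply: lt_trans re.
  by rewrite rnormE ltcR; apply: vn.
move=> /cvg_ex[y vy]; exists y => e e0.
have e0' : 0 < e%:C :> R[i] by rewrite ltcR.
have /cvgrPdist_lt/(_ e%:C e0')[n _ vn] := vy.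
by exists n => i ni; have := vn i ni; rewrite /= rnormE ltcR.
Qed.

Section OneRep.
Context (E : completeNormedModType R[i]) (rho : ell1 R -> E -> E).
Hypothesis cr : contractive_rep rho.
Hypothesis rho_le : forall f, opnorm (rho f) <= Fp_norm q f.
Implicit Types (x y z : E).

(* Characterises the value at [x] of the extension of [rho] to [B]. *)
Definition is_ext a x y := forall f,
  rnorm (y - rho f x) <= rnorm (a - iota f) * rnorm x.

Let rep_leq f x : rnorm (rho f x) <= rnorm (iota f) * rnorm x.
Proof.
apply: (le_trans (le_opnorm x (rep_bounded cr f))).
by rewrite iotaN ler_wpM2r ?rnorm_ge0.
Qed.

Let rhoD f x y : rho f (x + y) = rho f x + rho f y.
Proof. by have [l _] := rep_bounded cr f; have := l 1 x y; rewrite !scale1r. Qed.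

Let rhoZ f (c : R[i]) x : rho f (c *: x) = c *: rho f x.
Proof.
have [l _] := rep_bounded cr f; have := l c x 0; rewrite addr0 => ->.
have : rho f 0 = 0; last by move=> ->; rewrite addr0.
by have := l 1 0 0; rewrite !scale1r addr0 -[LHS]addr0 => /addrI.
Qed.

Lemma is_ext_unique a x y z : is_ext a x y -> is_ext a x z -> y = z.
Proof.
move=> hy hz; apply/eqP; rewrite -subr_eq0; apply/eqP/rnorm_eq0/eqP.
rewrite eq_le rnorm_ge0 andbT.
apply: (@ler_add_small _ _ (2 * rnorm x)); first by rewrite mulr_ge0 ?rnorm_ge0.
move=> e e0 _; have [f fe] := iota_dense a e0; rewrite add0r.
apply: (le_trans (rnorm_dist y (rho f x) z)).
rewrite (rnormB_sym _ z); have := hy f; have := hz f.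
by have := ler_wpM2r (rnorm_ge0 x) (ltW fe); lra.
Qed.

(** The value is the limit of [rho (f n) x] for [iota (f n)] tending to [a]; the sequence is Cauchy
    because [rho] is dominated by the norm of [B]. *)
Lemma is_ext_exists a x : exists y, is_ext a x y.
Proof.
have h0 n : 0 < n.+1%:R^-1 :> R by rewrite invr_gt0.
have /choice[f fa] := fun n => iota_dense a (h0 n).
have x0 := rnorm_ge0 x.
have [y yf] : exists y, forall e : R, 0 < e ->
    exists n, forall i, (n <= i)%N -> rnorm (y - rho (f i) x) < e.
  apply: rnorm_cauchy_cvg => e e0.
  (* The summand 1 covers [x = 0]; the 2 accounts for both indices of the Cauchy condition. *)
  have d0 : 0 < e / (2 * (rnorm x + 1)) by rewrite divr_gt0// mulr_gt0//; lra.
  have [n _ hn] := near_infty_natSinv_lt (PosNum d0); exists n => i j ni nj.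
  have := hn i ni; have := hn j nj; rewrite /= => hj hi.
  rewrite -(repB cr); apply: le_lt_trans (rep_leq _ _) _.
  rewrite -iotaB.
  have h1 := rnorm_dist (iota (f i)) a (iota (f j)).
  rewrite (rnormB_sym _ a) in h1.
  have h2 : rnorm (iota (f i) - iota (f j)) <= e / (rnorm x + 1).
    have -> : e / (rnorm x + 1) = e / (2 * (rnorm x + 1)) + e / (2 * (rnorm x + 1)).
      by field; rewrite gt_eqF//; lra.
    by have := lt_trans (fa i) hi; have := lt_trans (fa j) hj; lra.
  apply: (le_lt_trans (ler_wpM2r x0 h2)).
  by rewrite mulrAC ltr_pdivrMr; [rewrite ltr_pM2l//; lra|lra].
exists y => g; apply: (@ler_add_small _ _ (1 + rnorm x)); first lra.
move=> e e0 _; have [n hn] := yf e e0.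
have [m _ hm] := near_infty_natSinv_lt (PosNum e0).
set k := maxn n m; have := hn k (leq_maxl _ _); have := hm k (leq_maxr _ _).
rewrite /= => ke yk.
apply: (le_trans (rnorm_dist y (rho (f k) x) _)); rewrite -(repB cr).
have h1 := rep_leq (f k - g) x; rewrite -iotaB in h1.
have h2 := rnorm_dist (iota (f k)) a (iota g); rewrite (rnormB_sym _ a) in h2.
have h3 : rnorm (iota (f k) - iota g) <= e + rnorm (a - iota g).
  by have := lt_trans (fa k) ke; lra.
by have := ler_wpM2r x0 h3; lra.
Qed.

Lemma is_ext_le a x y : is_ext a x y -> rnorm y <= rnorm a * rnorm x.
Proof. by move=> /(_ 0); rewrite iota0 (rep0 cr) !subr0. Qed.

Lemma is_ext_linear (c : R[i]) a b x y z : is_ext a x y -> is_ext b x z ->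
  is_ext (c *: a + b) x (c *: y + z).
Proof.
move=> hy hz h; have c0 := normc_ge0 c; have x0 := rnorm_ge0 x.
apply: (@ler_add_small _ _ (2 * (normc c + 1) * rnorm x)).
  by rewrite !mulr_ge0//; lra.
move=> e e0 _; have [f fe] := iota_dense a e0; have [g ge] := iota_dense b e0.
(* With [a] and [b] replaced by [iota f] and [iota g], linearity of [rho] is exact; all that remains
   are errors proportional to [e]. *)
have -> : c *: y + z - rho h x =
    c *: (y - rho f x) + (z - rho g x) + rho (c *: f + g - h) x.
  rewrite (repB cr) (rep_linear cr) scalerBr.
  by rewrite [_ + (z - _)]addrACA -opprD subrKA.
have s1 := rnormD (c *: (y - rho f x) + (z - rho g x)) (rho (c *: f + g - h) x).
have s2 := rnormD (c *: (y - rho f x)) (z - rho g x); rewrite rnormZ in s2.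
have s3 := rep_leq (c *: f + g - h) x.
have s4 : rnorm (iota (c *: f + g - h)) <=
    normc c * e + e + rnorm (c *: a + b - iota h).
  rewrite -iotaB iotaL.
  have -> : c *: iota f + iota g - iota h =
      - (c *: (a - iota f)) - (b - iota g) + (c *: a + b - iota h).
    rewrite scalerBr !opprB [_ - c *: a + _]addrACA -opprD.
    by rewrite subrKA.
  apply: (le_trans (rnormD _ _)); rewrite lerD2r.
  apply: (le_trans (rnormD _ _)); rewrite !rnormN rnormZ.
  by have := ler_wpM2l c0 (ltW fe); lra.
have s5 := ler_wpM2r x0 s4.
have s6 := ler_wpM2l c0 (le_trans (hy f) (ler_wpM2r x0 (ltW fe))).
have s7 := le_trans (hz g) (ler_wpM2r x0 (ltW ge)).
apply: (le_trans s1); apply: (le_trans (lerD s2 s3)).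
have E1 : (normc c * e + e + rnorm (c *: a + b - iota h)) * rnorm x =
  normc c * (e * rnorm x) + e * rnorm x + rnorm (c *: a + b - iota h) * rnorm x by ring.
have E2 : 2 * (normc c + 1) * rnorm x * e =
  2 * (normc c * (e * rnorm x)) + 2 * (e * rnorm x) by ring.
lra.
Qed.

Lemma is_ext_linear_r (c : R[i]) a x x' y y' : is_ext a x y -> is_ext a x' y' ->
  is_ext a (c *: x + x') (c *: y + y').
Proof.
move=> hy hy' g; set X := c *: x + x'.
have c0 := normc_ge0 c; have x0 := rnorm_ge0 x; have x0' := rnorm_ge0 x'.
have X0 := rnorm_ge0 X.
apply: (@ler_add_small _ _ (normc c * rnorm x + rnorm x' + rnorm X)).
  by rewrite !addr_ge0 ?mulr_ge0.
move=> e e0 _; have [f fe] := iota_dense a e0.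
have -> : c *: y + y' - rho g X =
    c *: (y - rho f x) + (y' - rho f x') + rho (f - g) X.
  rewrite (repB cr) /X !rhoD !rhoZ scalerBr.
  by rewrite [_ + (y' - _)]addrACA -opprD subrKA.
have s1 := rnormD (c *: (y - rho f x) + (y' - rho f x')) (rho (f - g) X).
have s2 := rnormD (c *: (y - rho f x)) (y' - rho f x'); rewrite rnormZ in s2.
have s3 := rep_leq (f - g) X; rewrite -iotaB in s3.
have s4 := rnorm_dist (iota f) a (iota g); rewrite (rnormB_sym _ a) in s4.
have s5 : rnorm (iota f - iota g) <= e + rnorm (a - iota g) by lra.
have s6 := ler_wpM2r X0 s5.
have s7 := ler_wpM2l c0 (le_trans (hy f) (ler_wpM2r x0 (ltW fe))).
have s8 := le_trans (hy' f) (ler_wpM2r x0' (ltW fe)).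
have E1 : (normc c * rnorm x + rnorm x' + rnorm X) * e =
  normc c * (e * rnorm x) + e * rnorm x' + e * rnorm X by ring.
lra.
Qed.

Lemma is_ext_mul a b x y z : is_ext b x y -> is_ext a y z ->
  is_ext (banach_mul a b) x z.
Proof.
move=> hy hz h; have x0 := rnorm_ge0 x; have y0 := rnorm_ge0 y.
have a0 := rnorm_ge0 a; have b0 := rnorm_ge0 b.
(* One summand for each error: replacing [a] at [y], replacing [b] at [x] under [rho f], and
   replacing the product [a b]. The bound [rnorm a + 1] for [iota f] uses [e < 1]. *)
pose K := rnorm y + (rnorm a + 1) * rnorm x + (rnorm b + rnorm a + 1) * rnorm x.
apply: (@ler_add_small _ _ K); first by rewrite /K !addr_ge0 ?mulr_ge0//; lra.
move=> e e0 e1; have [f fe] := iota_dense a e0; have [g ge] := iota_dense b e0.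
have fa : rnorm (iota f) <= rnorm a + 1.
  have := rnormD (- (a - iota f)) a; rewrite opprB subrK rnormB_sym; lra.
have -> : z - rho h x = (z - rho f y) + rho f (y - rho g x) + rho (f * g - h) x.
  rewrite (repB cr) (rep_mul cr) -scaleN1r rhoD -[- rho g x]scaleN1r rhoZ !scaleN1r.
  by rewrite !subrKA.
have s1 := rnormD ((z - rho f y) + rho f (y - rho g x)) (rho (f * g - h) x).
have s2 := rnormD (z - rho f y) (rho f (y - rho g x)).
have s3 := rep_leq f (y - rho g x); have s4 := rep_leq (f * g - h) x.
have nM (u v : B) : rnorm (banach_mul u v) <= rnorm u * rnorm v.
  by have := banach_normM u v; rewrite !rnormE -rmorphM lecR.
have s5 : rnorm (iota (f * g - h)) <=
    e * rnorm b + (rnorm a + 1) * e + rnorm (banach_mul a b - iota h).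
  rewrite -iotaB iotaM.
  apply: (le_trans (rnorm_dist _ (banach_mul a b) _)); rewrite lerD2r rnormB_sym.
  have -> : banach_mul a b - banach_mul (iota f) (iota g) =
      banach_mul (a - iota f) b + banach_mul (iota f) (b - iota g).
    rewrite banach_mulDl banach_mulDr -[- iota f]scaleN1r -[- iota g]scaleN1r.
    by rewrite banach_scaleAl banach_scaleAr !scaleN1r subrKA.
  apply: (le_trans (rnormD _ _)); apply: lerD.
    by apply: (le_trans (nM _ _)); rewrite ler_wpM2r// ltW.
  by apply: (le_trans (nM _ _)); rewrite ler_pM ?rnorm_ge0// ltW.
have s6 := ler_wpM2r x0 s5.
have s7 := le_trans (hz f) (ler_wpM2r y0 (ltW fe)).
have s8 := le_trans (hy g) (ler_wpM2r x0 (ltW ge)).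
have s9 : rnorm (iota f) * rnorm (y - rho g x) <= (rnorm a + 1) * (e * rnorm x).
  by apply: ler_pM; rewrite ?rnorm_ge0.
have E1 : K * e = e * rnorm y + (rnorm a + 1) * (e * rnorm x) +
   (e * rnorm b + (rnorm a + 1) * e) * rnorm x by rewrite /K; ring.
have E2 : (e * rnorm b + (rnorm a + 1) * e + rnorm (banach_mul a b - iota h)) * rnorm x =
  (e * rnorm b + (rnorm a + 1) * e) * rnorm x +
  rnorm (banach_mul a b - iota h) * rnorm x by ring.
lra.
Qed.

End OneRep.

(* A contractive homomorphism [psi] into [B] turns every representation of [B]
   into a representation of [ell1 R] again, to which universality of
   [Fp_norm q] applies. *)
Lemma rnorm_hom_le_Fp_norm (psi : ell1 R -> B) f : linear psi ->
  (forall f g, psi (f * g) = banach_mul (psi f) (psi g)) ->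
  (forall f, rnorm (psi f) <= ell1_norm f) ->
  rnorm (psi f) <= Fp_norm q f.
Proof.
move=> psiL psiM psiN.
(* One [e] for replacing [psi f] by [iota g], another for comparing [rho g] with [rho' f]. *)
apply: (@ler_add_small _ _ 2) => // e e0 _.
have [g ge] := iota_dense (psi f) e0.
have h1 := rnormD (psi f - iota g) (iota g); rewrite subrK iotaN in h1.
suff : Fp_norm q g <= Fp_norm q f + e by lra.
apply: Fp_norm_le; first by rewrite addr_ge0 ?Fp_norm_ge0// ltW.
move=> _ [E [rho [sE lE cr ->]]].
have rho_le k : opnorm (rho k) <= Fp_norm q k by exact: rep_le_Fp_norm.
(* Extend [rho] to [B] and pull back along [psi]; the result [rho'] acts on the same L^q-space. *)
have /choice[ext extP] : forall t : ell1 R * E, exists y, is_ext rho (psi t.1) t.2 y.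
  by move=> t; exact: is_ext_exists cr rho_le _ _.
pose rho' (k : ell1 R) (x : E) := ext (k, x).
have rhoP k x : is_ext rho (psi k) x (rho' k x) := extP (k, x).
have rho'_le k x : rnorm (rho' k x) <= ell1_norm k * rnorm x.
  apply: (le_trans (is_ext_le cr (rhoP k x))).
  by rewrite ler_wpM2r ?rnorm_ge0.
have cr' : contractive_rep rho'.
  split.
  - move=> k; split; last by exists (ell1_norm k).
    move=> c x y; apply: (is_ext_unique (rhoP _ _)).
    exact: is_ext_linear_r.
  - move=> c k l x; apply: (is_ext_unique (rhoP _ _)); rewrite psiL.
    exact: is_ext_linear.
  - move=> k l x; apply: (is_ext_unique (rhoP _ _)); rewrite psiM.
    exact: is_ext_mul (rhoP _ _) (rhoP _ _).
  - move=> k; apply: opnorm_le => x x1; apply: (le_trans (rho'_le k x)).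
    by rewrite ler_piMr// ell1_norm_ge0.
have le' := rep_le_Fp_norm f sE lE cr'.
apply: opnorm_le => x x1.
have h2 := rnormD (rho g x - rho' f x) (rho' f x); rewrite subrK rnormB_sym in h2.
have h3 := rhoP f x g.
have h4 : rnorm (psi f - iota g) * rnorm x <= e.
  rewrite -[leRHS]mulr1; apply: ler_pM; rewrite ?rnorm_ge0//; exact: ltW.
have h5 := opnorm_ge (rep_bounded cr' f) x1.
lra.
Qed.

End Extension.

(** * From isometric isomorphisms to inequalities of norms *)

Section Isomorphism.
Context {R : realType}.
Implicit Types (p q : R).

Definition FpZ_iota p (f : ell1 R) : FpZ p := to_completion (Fp_seminorm p) f.

Lemma FpZ_iota_norm p f : rnorm (FpZ_iota p f) = Fp_norm p f.
Proof. by rewrite /rnorm /FpZ_iota to_completion_norm. Qed.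

Lemma FpZ_iota_dense p (a : FpZ p) (e : R) : 0 < e ->
  exists f, rnorm (a - FpZ_iota p f) < e.
Proof.
move=> e0; have e0' : 0 < e%:C :> R[i] by rewrite ltcR.
have ne : (ball a e%:C)^° !=set0 by exists a; exact: nbhsx_ballx.
have [b [ab [f _ fb]]] := @to_completion_dense _ _ (Fp_seminorm p) _ ne (@open_interior _ _).
exists f; have := interior_subset ab; rewrite -ball_normE /= -fb.
by rewrite rnormE ltcR.
Qed.

Lemma isometrically_isomorphic_sym (K : numFieldType) (A B : banach_algebra K) :
  isometrically_isomorphic A B -> isometrically_isomorphic B A.
Proof.
move=> [phi [[psi pK Kp] pl pM pN]]; exists psi; split.
- by exists phi.
- by move=> c x y; apply: (can_inj pK); rewrite pl !Kp.
- by move=> x y; apply: (can_inj pK); rewrite pM !Kp.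
- by move=> x; rewrite -pN Kp.
Qed.

(** The homomorphism [psi] is the canonical map into F^p(Z) followed by the isomorphism, which may
    send [u] anywhere. *)
Lemma Fp_norm_isomorphic_le p q f :
  isometrically_isomorphic (FpZ p) (FpZ q) -> Fp_norm p f <= Fp_norm q f.
Proof.
move=> [phi [_ pl pM pN]].
have pR a : rnorm (phi a) = rnorm a by rewrite /rnorm pN.
rewrite -FpZ_iota_norm -pR.
apply: (@rnorm_hom_le_Fp_norm _ q (FpZ q) (FpZ_iota q) _ _ _ _
  (fun f => phi (FpZ_iota p f))).
- exact: to_completion_linear.
- exact: to_completionM.
- exact: FpZ_iota_norm.
- exact: FpZ_iota_dense.
- by move=> c g h; rewrite -pl; congr phi; exact: to_completion_linear.
- by move=> g h; rewrite -pM; congr phi; exact: to_completionM.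
- by move=> g; rewrite pR FpZ_iota_norm Fp_norm_le_ell1.
Qed.

Lemma isometrically_isomorphic_refl (K : numFieldType) (A : banach_algebra K) :
  isometrically_isomorphic A A.
Proof. by exists id; split => //; exists id. Qed.

(** Equal norms make the two seminorm records equal, hence the completions are literally the same
    algebra. *)
Lemma FpZ_eq p q : (forall f : ell1 R, Fp_norm p f = Fp_norm q f) ->
  isometrically_isomorphic (FpZ p) (FpZ q).
Proof.
move=> /funext pq; rewrite /FpZ (_ : Fp_seminorm p = Fp_seminorm q).
  exact: isometrically_isomorphic_refl.
rewrite /Fp_seminorm; move: (Fp_norm_ge0 p) (Fp_normD p) (Fp_normZ p) (Fp_normM p).
by rewrite pq => *; congr AlgSeminorm; exact: Prop_irrelevance.
Qed.

End Isomorphism.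

(** * Comparison of the norms at two exponents *)

Section Comparison.
Context {R : realType}.
Implicit Types (p q t : R).

(** From F^p to l^p of cycles, by duality to l^q of cycles, and by transference to F^q. *)
Lemma Fp_norm_conj_le p q f : 1 < p -> 1 < q -> p^-1 + q^-1 = 1 ->
  Fp_norm q f <= Fp_norm p f.
Proof.
move=> p1 q1 pq; apply: Fp_norm_le_poly => d c; apply/ler_addgt0Pr => e e0.
(* The margin [e] makes the constant positive, as duality and transference require. *)
have C0 : 0 < Fp_norm p (ell1_poly d c) + e by rewrite ltr_wpDl ?Fp_norm_ge0.
apply: Fp_norm_transference => //; first exact: ltW.
apply: cyc_path_bound => [|n y _ _ _]; first by lra.
apply: (cyc_bound_dual p1 q1 pq C0); apply: cyc_bound_Fp_norm; first exact: ltW.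
by rewrite lerDl ltW.
Qed.

Lemma Fp_norm_poly_le p d (c : nat -> R[i]) :
  Fp_norm p (ell1_poly d c) <= \sum_(k < d) normc (c k).
Proof.
rewrite /ell1_poly; elim: d => [|d ih].
  by rewrite !big_ord0 -(scale0r 0) Fp_normZ normc0 mul0r.
rewrite !big_ord_recr /=; apply: (le_trans (Fp_normD _ _ _)); apply: lerD => //.
rewrite Fp_normZ ler_piMr ?normc_ge0// (le_trans (Fp_norm_le_ell1 _ _))//.
by rewrite ell1_deltaX ell1_norm_delta.
Qed.

Lemma Fp_norm_skew_neq p q : 1 <= p -> 1 <= q -> `|1 - 2 / q| < `|1 - 2 / p| ->
  ~ (forall f : ell1 R, Fp_norm p f = Fp_norm q f).
Proof.
move=> p1 q1 gqp E; have gp : 0 < `|1 - 2 / p| by exact: le_lt_trans gqp.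
have p2 : p != 2.
  by apply: contraTneq gp => ->; rewrite divff// subrr normr0 ltxx.
have [k k0 hk] := skew_gap_pos p1 p2.
pose l := `|1 - 2 / q| / `|1 - 2 / p|.
have l0 : 0 <= l by rewrite divr_ge0.
have l1 : l < 1 by rewrite ltr_pdivrMr// mul1r.
have kl : 0 < k * (1 - l) by rewrite mulr_gt0// subr_gt0.
(* The bound [t <= 1 / 4] gives [C - 1 <= 3 t] and [l (C - 1) < 1]. The divisor 15 exceeds the
   coefficient 14 of [t ^ 2] in the final estimate. *)
pose t := Num.min 4^-1 (k * (1 - l) / 15).
have t0 : 0 < t by rewrite lt_min invr_gt0 ltr0n/= divr_gt0.
have t4 : t <= 4^-1 by rewrite ge_min lexx.
have tk : t <= k * (1 - l) / 15 by rewrite ge_min lexx orbT.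
pose g := ell1_poly 3 (skew_coef t).
(* The margin [t ^ 2] makes [C] positive and has no first-order effect. *)
pose C := Fp_norm p g + t ^+ 2.
have tt : 0 < t ^+ 2 by rewrite exprn_gt0.
have C0 : 0 < C by rewrite ltr_wpDl ?Fp_norm_ge0.
have bC : cyc_bound p 3 (skew_coef t) C.
  by apply: cyc_bound_Fp_norm => //; rewrite lerDl ltW.
have low := hk _ _ C0 t0 bC.
have up : C <= 1 + 2 * t + t ^+ 2.
  rewrite lerD2r; apply: (le_trans (Fp_norm_poly_le _ _ _)).
  have -> : \sum_(j < 3) normc (skew_coef t j) =
      normc (- t)%:C + (normc (1 : R[i]) + normc t%:C).
    by rewrite !big_ord_recl big_ord0 addr0.
  by rewrite normc1 !normcR normrN ger0_norm ?(ltW t0)//; lra.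
have d3 : C - 1 <= 3 * t by nra.
have d0 : 0 <= C - 1 by apply: le_trans low; rewrite mulr_ge0 ?ltW.
have ld : l * (C - 1) < 1 by nra.
have A0 : 0 < 1 - l * (C - 1) by lra.
have K0 : 0 < (1 + 4 * t ^+ 2) / (1 - l * (C - 1)) by rewrite divr_gt0//; lra.
have : Fp_norm q g <= (1 + 4 * t ^+ 2) / (1 - l * (C - 1)).
  apply: Fp_norm_transference => //; apply: cyc_path_bound; first by lra.
  by move=> n y y0 y1 yN1; apply: cyc_bound_skew.
rewrite -E ler_pdivlMr// (_ : Fp_norm p g = C - t ^+ 2); last by rewrite /C addrK.
set d := C - 1 in low d3 d0 ld A0 *.
have -> : C = 1 + d by rewrite /d; ring.
have ldd : l * d <= d by rewrite ler_piMl// ltW.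
have dd : d * d <= 9 * t ^+ 2 by nra.
have lddd : l * d * d <= d * d by rewrite ler_wpM2r.
have tl : 0 <= t ^+ 2 * (l * d) by rewrite !mulr_ge0// ltW.
have h2 : t * (k * (1 - l)) <= d * (1 - l).
  by rewrite mulrA ler_wpM2r// subr_ge0 ltW.
have h3 : t * (15 * t) <= t * (k * (1 - l)).
  by rewrite ler_wpM2l ?(ltW t0)// mulrC -ler_pdivlMr.
(* Expanding [h1] gives [5 t^2] from the second-order terms and [9 t^2] from [l d^2], by [d <= 3 t].
   But [d (1 - l)] is also at least [15 t^2], by [h2] and [h3]. *)
move=> h1; have : d * (1 - l) <= 14 * t ^+ 2 by nra.
nra.
Qed.

Lemma norm_1B2V_eq p q : 1 <= p -> 1 <= q ->
  `|1 - 2 / p| = `|1 - 2 / q| -> p = q \/ p^-1 + q^-1 = 1.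
Proof.
move=> p1 q1 /eqP; rewrite eqr_norm2 => /orP[]/eqP h.
  by left; apply: invr_inj; lra.
by right; lra.
Qed.

End Comparison.

Theorem theorem3p4 (R : realType) (p q : R) (hp : 1 <= p) (hq : 1 <= q) :
  isometrically_isomorphic (FpZ p) (FpZ q) <-> (p = q \/ p^-1 + q^-1 = 1).
Proof.
split=> [iso|[->|pq]].
- have E (f : ell1 R) : Fp_norm p f = Fp_norm q f.
    apply/eqP; rewrite eq_le; apply/andP; split.
      exact: Fp_norm_isomorphic_le iso.
    exact: Fp_norm_isomorphic_le (isometrically_isomorphic_sym iso).
  have [lt|lt|] := ltgtP `|1 - 2 / p| `|1 - 2 / q|.
  + by have := @Fp_norm_skew_neq _ q p hq hp lt (fun f => esym (E f)).
  + by have := @Fp_norm_skew_neq _ p q hp hq lt E.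
  + exact: norm_1B2V_eq.
- exact: isometrically_isomorphic_refl.
- have pV0 : 0 < p^-1 by rewrite invr_gt0 (lt_le_trans ltr01).
  have qV0 : 0 < q^-1 by rewrite invr_gt0 (lt_le_trans ltr01).
  have p1 : 1 < p by rewrite -invf_lt1 ?(lt_le_trans ltr01)//; lra.
  have q1 : 1 < q by rewrite -invf_lt1 ?(lt_le_trans ltr01)//; lra.
  have qp : q^-1 + p^-1 = 1 by rewrite addrC.
  apply: FpZ_eq => f; apply/eqP; rewrite eq_le; apply/andP; split.
    exact: Fp_norm_conj_le q1 p1 qp.
  exact: Fp_norm_conj_le p1 q1 pq.
Qed.
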